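(* Let $L$ be a rectifiable generalized link, with endpoint constraints $M_x$ and obstacles $g_{ij}<0$. Then $L$ is strongly critical for link-ropelength if and only if $L$ has finite total curvature (so that its curvature force $\mathcal{K}$ is defined) and there is a positive Radon measure $\mu$ on $\mathrm{Strut}(L)\sqcup\mathrm{Wall}(L)$ such that $$-\mathcal{K}=(A_S\oplus A_W)^*\mu$$ as linear functionals on $\mathrm{VF}_c(L)$. This means that $-\mathcal{K}$ and $(A_S\oplus A_W)^*\mu$ agree as forces ($\mathbb{R}^3$-valued Radon measures) along $L$ except at endpoints $x\in\partial L$, where they may differ by an atomic force in a direction normal to $M_x$.
   Context: A curve is a continuous map from a compact oriented 1-manifold with boundary $M$ (finitely many components, circles or intervals) to $\mathbb{R}^3$, up to orientation-preserving reparametrization; points of the curve are points of $M$, identified with their images when convenient. A generalized link is a curve $L$ with pairwise disjoint components $L_1,\dots,L_N$, together with: for each endpoint $x\in\partial L$ an affine subspace $M_x\subset\mathbb{R}^3$ of dimension $0$, $1$ or $2$ on which $x$ lies and is constrained to stay; and for each $i$ finitely many obstacles $\{p\in\mathbb{R}^3: g_{ij}(p)<0\}$, where $g_{ij}$ is a $C^1$ function with $0$ as a regular value, $L_i$ being constrained to stay in $\{\min_j g_{ij}\ge0\}$ (and $L$ satisfies these constraints). A rectifiable curve is parametrized by arclength $s$, with unit tangent $T$ a.e. The link-thickness $\mathrm{LThi}(L)$ is the minimum distance between points on different components; $\mathrm{Strut}(L)$ is the compact space of unordered pairs $\{x,y\}$ of points on different components with $|y-x|=\mathrm{LThi}(L)$.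 $\mathrm{Wall}_{ij}(L)=L_i\cap\{g_{ij}=0\}$ and $\mathrm{Wall}(L)=\bigsqcup_{i,j}\mathrm{Wall}_{ij}(L)$ (disjoint union). $\mathrm{VF}(L)$ is the space of continuous $\mathbb{R}^3$-valued vector fields along $L$; $\mathrm{VF}_c(L)$ is the subspace of compatible ones, i.e. $\xi_x$ is tangent to $M_x$ for each $x\in\partial L$. A vector field is smooth if it is a smooth function of arclength. $\delta_\xi\mathrm{Len}(L)=\int_L\langle T,d\xi/ds\rangle\,ds$. $\delta^+_\xi\mathrm{LThi}(L)=\frac{d}{dt^+}|_{t=0}\mathrm{LThi}(L+t\xi)$. With $O(L)=\min_{i,j}\min_{x\in L_i}g_{ij}(x)$, its first variation when $O(L)=0$ is $\delta^+_\xi O(L)=\min_{i,j}\min_{x\in \mathrm{Wall}_{ij}(L)}\langle\xi_x,\nabla g_{ij}\rangle$; if $\mathrm{Wall}(L)=\emptyset$ (no active obstacle) the obstacle term is omitted, i.e. taken to be $+\infty$. $L$ is strongly critical for link-ropelength if there is $\varepsilon>0$ such that $\min\big(\delta^+_\xi\mathrm{LThi}(L),\delta^+_\xi O(L)\big)\le-\varepsilon$ for all compatible smooth $\xi$ with $\delta_\xi\mathrm{Len}(L)=-1$. Rigidity operators: $A_S\xi(\{x,y\})=\langle\xi_y-\xi_x,y-x\rangle/|y-x|$ on $\mathrm{Strut}(L)$, and $A_W\xi(x)=\langle\xi_x,\nabla g_{ij}(x)\rangle$ for $x\in\mathrm{Wall}_{ij}(L)$. The adjoint is given by $\int_L\langle\xi,d(A_S\oplus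 A_W)^*\mu\rangle=\int_{\mathrm{Strut}(L)}A_S\xi\,d\mu+\int_{\mathrm{Wall}(L)}A_W\xi\,d\mu$. The total curvature of a curve is the supremum of total turning angles of inscribed polygons; it is finite for a rectifiable curve iff $T$ has bounded variation. The curvature force $\mathcal{K}$ is then the $\mathbb{R}^3$-valued Radon measure along $L$ given by the distributional derivative of $T$ in arclength, together with, at each endpoint of $L$, an atom equal to the inward-pointing unit tangent vector; thus $\delta_\xi\mathrm{Len}(L)=-\int_L\langle\xi,d\mathcal{K}\rangle$. *)

(* Defs.v *)
From HB Require Import structures.
From mathcomp Require Import all_boot all_order all_algebra.
From mathcomp Require Import all_classical all_reals all_analysis.

Set Implicit Arguments.
Unset Strict Implicit.
Unset Printing Implicit Defensive.

Import Order.TTheory GRing.Theory Num.Theory.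
Import numFieldNormedType.Exports.

Local Open Scope classical_set_scope.
Local Open Scope ring_scope.

Section euclidean_space.
Context {R : realType}.

(* The library norm on 'rV[R]_3 is the sup norm: it is used for the topology
   only, all metric notions below go through [enorm]. *)
Definition dot (u v : 'rV[R]_3) : R := \sum_(k < 3) u 0 k * v 0 k.

Definition enorm (u : 'rV[R]_3) : R := Num.sqrt (dot u u).

Definition angle (u v : 'rV[R]_3) : R := acos (dot u v / (enorm u * enorm v)).

Definition gradient (g : 'rV[R]_3 -> R) (p : 'rV[R]_3) : 'rV[R]_3 :=
  \row_(k < 3) 'D_(delta_mx 0 k) (g : 'rV[R]_3 -> R^o) p.

Definition C1 (g : 'rV[R]_3 -> R) : Prop :=
  (forall p, differentiable (g : 'rV[R]_3 -> R^o) p) /\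
  continuous (gradient g).

Definition smooth (f : R -> R) : Prop :=
  forall (n : nat) (s : R), derivable (derive1n n (f : R -> R^o)) s 1.

End euclidean_space.

Section charge_integral.
Context d (T : measurableType d) (R : realType).
Variable nu : {charge set T -> \bar R}.

Let exP := cid (Hahn_decomposition nu).
Let exN := cid (svalP exP).

(* Integral against a signed measure, through its Jordan decomposition (which
   does not depend on the chosen Hahn decomposition). *)
Definition charge_integral (D : set T) (f : T -> R) : R :=
  \int[jordan_pos (svalP exN)]_(x in D) f x
  - \int[jordan_neg (svalP exN)]_(x in D) f x.

End charge_integral.

Definition param_dom {R : realType} (cyc : bool) (l : R) : set R :=
  if cyc then `[0, l[%classic else `[0, l]%classic.

Definition end_param {R : realType} (l : R) (b : bool) : R := if b then l else 0.

(* Component [i] is the image of [0, clen i] under [curve i], an interval, or a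
   circle when [circ i]; in that case the two ends of [0, clen i] are the same
   point.  The affine subspace constraining the end of [i] selected by the
   boolean ([false]: parameter 0, [true]: parameter [clen i]) is
   [anchor i b + adir i b].  Both fields are irrelevant when [circ i]. *)
Record glink (R : realType) := GLink {
  ncomp : nat;
  circ : 'I_ncomp -> bool;
  clen : 'I_ncomp -> R;
  curve : 'I_ncomp -> R -> 'rV[R]_3;
  anchor : 'I_ncomp -> bool -> 'rV[R]_3;
  adir : 'I_ncomp -> bool -> {vspace 'rV[R]_3};
  nobs : 'I_ncomp -> nat;
  obs : forall i : 'I_ncomp, 'I_(nobs i) -> 'rV[R]_3 -> R;
  clen_gt0 : forall i, 0 < clen i;
  curve_continuous : forall i, {within `[0, clen i], continuous (curve i)};
  curve_circ : forall i, circ i -> curve i (clen i) = curve i 0;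
  curve_disjoint : forall i j s t, i != j ->
    param_dom (circ i) (clen i) s -> param_dom (circ j) (clen j) t ->
    curve i s <> curve j t;
  adir_dim : forall i b, ~~ circ i -> (\dim (adir i b) <= 2)%N;
  anchored : forall i b, ~~ circ i ->
    curve i (end_param (clen i) b) - anchor i b \in adir i b;
  obs_C1 : forall i j, C1 (@obs i j);
  obs_regular : forall i j p, @obs i j p = 0 -> gradient (@obs i j) p <> 0;
  obs_ge0 : forall i j s,
    param_dom (circ i) (clen i) s -> 0 <= @obs i j (curve i s) }.

Arguments obs {R} g i _ _ : rename.

Section generalized_link.
Context {R : realType}.
Implicit Types (L : glink R).

Local Notation MR := (measurableTypeR R).

Definition pdom L (i : 'I_(ncomp L)) : set R := param_dom (circ i) (clen i).

Definition epar L (i : 'I_(ncomp L)) (b : bool) : R := end_param (clen i) b.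

Definition consecutive (T : Type) (cyc : bool) (p : seq T) : seq (T * T) :=
  zip p (if cyc then rot 1 p else behead p).

Definition edges (cyc : bool) (p : seq 'rV[R]_3) : seq 'rV[R]_3 :=
  [seq q.2 - q.1 | q <- consecutive cyc p].

Definition curve_length (c : R -> 'rV[R]_3) (a b : R) : \bar R :=
  ereal_sup [set (\sum_(e <- edges false (map c (a :: s))) enorm e)%:E
            | s in itv_partition a b].

Definition arclength_parametrized L : Prop :=
  forall (i : 'I_(ncomp L)) (a b : R), 0 <= a -> a <= b -> b <= clen i ->
    curve_length (curve i) a b = (b - a)%:E.

Definition turning (cyc : bool) (p : seq 'rV[R]_3) : R :=
  \sum_(q <- consecutive cyc (edges cyc p)) angle q.1 q.2.

(* Consecutive vertices are distinct points of R^3, so that every edge has a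
   direction; the polygon is cyclic when the component is a circle. *)
Definition inscribed L (i : 'I_(ncomp L)) (s : seq R) : Prop :=
  [/\ sorted <%R s, forall t, t \in s -> pdom i t &
      forall e, e \in edges (circ i) (map (curve i) s) -> e != 0].

Definition total_curvature L : \bar R :=
  (\sum_(i < ncomp L)
     ereal_sup [set (turning (circ i) (map (curve i) s))%:E
               | s in inscribed i])%E.

Definition finite_total_curvature L : Prop := (total_curvature L < +oo)%E.

(* A vector field is given by its values on [0, clen i] for every [i]. *)
Definition vfield L := 'I_(ncomp L) -> R -> 'rV[R]_3.

Definition VF L (xi : vfield L) : Prop :=
  forall i, {within `[0, clen i], continuous (xi i)} /\
    (circ i -> xi i (clen i) = xi i 0).

Definition compatible L (xi : vfield L) : Prop :=
  forall i b, ~~ circ i -> xi i (epar i b) \in adir i b.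

Definition VFc L (xi : vfield L) : Prop := VF xi /\ compatible xi.

(* Smoothness up to the ends of an interval means smooth extendability. *)
Definition smooth_field L (xi : vfield L) : Prop :=
  forall i, (forall k, smooth (fun s => xi i s 0 k)) /\
    (circ i -> forall s, xi i (s + clen i) = xi i s).

(* [derive1] is total: it is the unit tangent T at almost every parameter when
   [L] is parametrized by arclength. *)
Definition tangent L (i : 'I_(ncomp L)) (s : R) : 'rV[R]_3 :=
  derive1 (curve i) s.

Definition dLen L (xi : vfield L) : R :=
  \sum_(i < ncomp L)
    \int[@lebesgue_measure R]_(s in `[0, clen i]) dot (tangent i s) (derive1 (xi i) s).

(* [thickness L c] for an arbitrary family of maps [c] on the components of [L]:
   the link-thickness of the displaced curve. *)
Definition thickness L (c : 'I_(ncomp L) -> R -> 'rV[R]_3) : \bar R :=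
  ereal_inf [set x : \bar R | exists i j s t,
    [/\ i != j, pdom i s, pdom j t & x = (enorm (c j t - c i s))%:E]].

Definition LThi L : \bar R := thickness (@curve R L).

Definition displace L (xi : vfield L) (t : R) : 'I_(ncomp L) -> R -> 'rV[R]_3 :=
  fun i s => curve i s + t *: xi i s.

(* The limit exists for every [xi] continuous along [L], distinct components
   being disjoint and compact.  With at most one component there are no
   pairs of points to constrain ([LThi L] is +oo) and the thickness term is omitted. *)
Definition dLThi L (xi : vfield L) : \bar R :=
  if (1 < ncomp L)%N then
    lim (((thickness (displace xi t) - LThi L) * (t^-1)%:E)%E @[t --> 0^'+])
  else +oo%E.

(* The unordered pair {x, y} of points on different components is represented
   by the ordered pair whose first point is on the component of lower index. *)
Definition strut L (i j : 'I_(ncomp L)) : set (MR * MR) :=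
  [set z | [/\ (i < j)%N, pdom i z.1, pdom j z.2 &
               (enorm (curve j z.2 - curve i z.1))%:E = LThi L]].

Definition wall L (i : 'I_(ncomp L)) (j : 'I_(nobs i)) : set MR :=
  [set s | pdom i s /\ obs L i j (curve i s) = 0].

Definition AS L (xi : vfield L) (i j : 'I_(ncomp L)) (z : MR * MR) : R :=
  dot (xi j z.2 - xi i z.1) (curve j z.2 - curve i z.1)
  / enorm (curve j z.2 - curve i z.1).

Definition AW L (xi : vfield L) (i : 'I_(ncomp L)) (j : 'I_(nobs i)) (s : MR) : R :=
  dot (xi i s) (gradient (obs L i j) (curve i s)).

(* The infimum is attained when the wall is not empty; otherwise it is +oo. *)
Definition dO L (xi : vfield L) : \bar R :=
  ereal_inf [set x : \bar R | exists i j s,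
    wall (i := i) j s /\ x = (AW xi j s)%:E].

Definition strongly_critical L : Prop :=
  exists2 eps : R, 0 < eps &
    forall xi : vfield L, smooth_field xi -> compatible xi -> dLen xi = -1 ->
      (Order.min (dLThi xi) (dO xi) <= (- eps)%:E)%E.

(* A positive Radon measure on the disjoint union of the compact spaces Strut(L)
   and Wall(L), that is, a family of finite Borel measures on the pieces.  The
   half-open parametrization of circles is a Borel isomorphism. *)
Record contact_measure L := ContactMeasure {
  mu_strut : 'I_(ncomp L) -> 'I_(ncomp L) ->
    {finite_measure set (MR * MR)%type -> \bar R};
  mu_wall : forall i : 'I_(ncomp L), 'I_(nobs i) ->
    {finite_measure set MR -> \bar R};
  mu_strut_supp : forall i j, mu_strut i j (~` strut i j) = 0%E;
  mu_wall_supp : forall i (j : 'I_(nobs i)), @mu_wall i j (~` wall j) = 0%E }.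

Definition contact_integral L (mu : contact_measure L) (xi : vfield L) : R :=
  (\sum_(i < ncomp L) \sum_(j < ncomp L)
     \int[mu_strut mu i j]_(z in strut i j) AS xi i j z) +
  \sum_(i < ncomp L) \sum_(j < nobs i)
     \int[mu_wall mu j]_(s in wall j) AW xi j s.

(* An R^3-valued Radon measure along [L]: three signed Borel measures on the
   parameter domain of every component. *)
Record force L := Force {
  fcomp :> 'I_(ncomp L) -> 'I_3 -> {charge set MR -> \bar R};
  force_supp : forall i k (B : set MR), measurable B -> B `&` pdom i = set0 ->
    fcomp i k B = 0%E }.

Definition force_pair L (F : force L) (xi : vfield L) : R :=
  \sum_(i < ncomp L) \sum_(k < 3)
    charge_integral (F i k) (pdom i) (fun s => xi i s 0 k).

Definition force_atom L (F : force L) (i : 'I_(ncomp L)) (s : R) : 'rV[R]_3 :=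
  \row_(k < 3) fine (F i k [set s]).

Definition test_function L (i : 'I_(ncomp L)) (phi : R -> R) : Prop :=
  smooth phi /\
  if circ i then forall s, phi (s + clen i) = phi s
  else exists a b : R, [/\ 0 < a, b < clen i &
         forall s, s < a \/ b < s -> phi s = 0].

(* Away from the ends of intervals [K] is the distributional derivative of T;
   its atoms there are the inward one-sided tangent vectors. *)
Definition is_curvature_force L (K : force L) : Prop :=
  (forall i k phi, test_function i phi ->
     \int[@lebesgue_measure R]_(s in `[0, clen i])
        (tangent i s 0 k * derive1 (phi : R -> R^o) s)
     = - charge_integral (K i k) (pdom i) phi) /\
  (forall i, ~~ circ i ->
     (t^-1 *: (curve i t - curve i 0) @[t --> 0^'+] --> force_atom K i 0) /\
     (t^-1 *: (curve i (clen i - t) - curve i (clen i)) @[t --> 0^'+]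
        --> force_atom K i (clen i))).

Definition is_adjoint_force L (mu : contact_measure L) (F : force L) : Prop :=
  forall xi : vfield L, VF xi -> force_pair F xi = contact_integral mu xi.

Definition balanced_on_VFc L (K F : force L) : Prop :=
  forall xi : vfield L, VFc xi -> - force_pair K xi = force_pair F xi.

Definition balanced_upto_normal_atoms L (K F : force L) : Prop :=
  (forall i k (B : set MR), measurable B -> B `<=` pdom i ->
     (~~ circ i -> forall b, ~ B (epar i b)) -> (- K i k B)%E = F i k B) /\
  (forall i b, ~~ circ i -> forall v : 'rV[R]_3, v \in adir i b ->
     dot v (- force_atom K i (epar i b) - force_atom F i (epar i b)) = 0).

End generalized_link.

(* Main.v *)
(* Strong criticality says that dLen xi <= C * max(0, sup A xi) on compatible
   smooth fields, A xi being the rate A_S xi, A_W xi at the active contacts: by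
   convexity of the norm, the derivative of the thickness is the least rate over
   the struts.  So xi |-> dLen xi factors through A, and Hahn-Banach extends the
   resulting functional to a positive one on all bounded functions of the set of
   contacts, where no topology is needed.  On functions of finitely many bounded
   coordinates this functional is integration against a measure: splitting the
   contacts by a sequence of binary tests on the coordinates cuts an interval
   into nested pieces of prescribed lengths, and the measure is the image of
   Lebesgue measure under the limit of the coordinates.

   Then dLen is given by an adjoint force F on compatible fields.  By
   du Bois-Reymond's lemma T = c0 - F(]0, s]) almost everywhere on an arc, so T
   has bounded variation.  Turning angles are bounded by the variation of T, the
   one-sided tangents at the ends exist, and integration by parts identifies the
   curvature force.  In the other direction, integration by parts gives
   dLen xi = <F, xi>, the integral of A xi against mu, and dLen xi = -1 forces
   min A xi <= -1/(1 + |mu|).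

   Smooth plateau functions localize the balance at an interval or at an end
   point, which determines the forces up to normal atoms at the ends. *)
Require Import Defs.
From HB Require Import structures.
From mathcomp Require Import all_boot all_order all_algebra.
From mathcomp Require Import all_classical all_reals all_analysis.
From mathcomp Require Import measurable_realfun ring lra.

Set Implicit Arguments.
Unset Strict Implicit.
Unset Printing Implicit Defensive.

Import Order.TTheory GRing.Theory Num.Theory.
Import numFieldNormedType.Exports.

Local Open Scope classical_set_scope.
Local Open Scope ring_scope.

(** One functional [Lam] on the contacts is read twice. Cut by the indicators of the strut and wall
    classes, it gives the contact measure; weighted by the positive and negative parts of the
    contact forces on a component, it gives the adjoint force. Both pair with a continuous field
    [xi] to [Lam (rate xi)], which is why one is adjoint to the other. Criticality speaks of smooth
    fields, balance of continuous ones. This gap is not closed by density: smooth tests determine a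
    force away from the ends of intervals, and at an end its atom in the permitted directions; this
    already implies the balance on continuous compatible fields. The curvature force cannot simply
    be [- F]. Testing with compatible fields leaves the end atoms of [F] undetermined in the normal
    directions, whereas those of [K] are one-sided tangents; so on intervals [K] is assembled from
    the interior of [- F] and the limits of the tangent. The constant of the domination is [eps^-1]:
    a field with [dLen xi = lam > 0] is tested through [- xi / lam]. *)

Local Notation MR R := (measurableTypeR R).

(** * Integrals and charges *)

Section integral_lemmas.
Context d (T : measurableType d) (R : realType).
Implicit Types (mu : {measure set T -> \bar R}) (D : set T).
Import HBNNSimple.

(* The integral of a nonnegative function, measurable or not, is a supremum over
   the simple functions below it. *)
Lemma ae_ge0_le_integralT mu (f g : T -> \bar R) :
  (forall x, 0 <= f x)%E -> (forall x, 0 <= g x)%E ->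
  {ae mu, forall x, f x <= g x}%E ->
  (\int[mu]_x f x <= \int[mu]_x g x)%E.
Proof.
move=> f0 g0 [N [mN N0 fgN]].
rewrite !ge0_integralTE//; apply: ge_ereal_sup => _ [h /= hf <-].
have mNC : measurable (~` N) by exact: measurableC.
(* Cutting [h] off on the null set [N] puts it below [g] everywhere and leaves its integral
   unchanged. *)
apply: (@le_trans _ _ (sintegral mu (proj_nnsfun h mNC))); last first.
  apply: ereal_sup_ubound; exists (proj_nnsfun h mNC) => // x /=.
  rewrite /proj_nnsfun/= mindicE; have [xN|xN] := boolP (x \in ~` N).
    rewrite mulr1 (le_trans (hf x))//; apply: contrapT => nfg.
    by move: xN; rewrite inE; apply; exact: fgN.
  by rewrite mulr0.
rewrite -!integralT_nnsfun; apply: ae_ge0_le_integral => //.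
- by move=> x _; rewrite lee_fin.
- exact/measurable_EFinP.
- by move=> x _; rewrite lee_fin.
- exact/measurable_EFinP.
exists N; split => // x /= /not_implyP [_ hx]; apply: contrapT => xN; apply: hx.
by rewrite mindicE mem_set// mulr1.
Qed.

(** Valid for arbitrary functions: this is what allows the total function [tangent] to be replaced,
    under an integral, by a measurable density equal to it almost everywhere. *)
Lemma ae_integral_eq mu D (f g : T -> \bar R) :
  {ae mu, forall x, D x -> f x = g x} ->
  (\int[mu]_(x in D) f x = \int[mu]_(x in D) g x)%E.
Proof.
move=> [N [mN N0 fgN]].
have fg x : ~ N x -> (f \_ D) x = (g \_ D) x.
  move=> xN; rewrite /patch; case: ifPn => //; rewrite inE => Dx.
  by apply: contrapT => nfg; apply: xN; apply: fgN => /= /(_ Dx).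
rewrite [LHS]integral_mkcond [RHS]integral_mkcond [LHS]integralE [RHS]integralE.
by congr (_ - _)%E; apply/eqP; rewrite eq_le; apply/andP; split;
  (apply: ae_ge0_le_integralT => //; exists N; split => // x /= ne;
   apply: contrapT => /fg fgx; apply: ne; rewrite ?funeposE ?funenegE fgx).
Qed.

Lemma ae_Rintegral_eq mu D (f g : T -> R) :
  {ae mu, forall x, D x -> f x = g x} ->
  \int[mu]_(x in D) f x = \int[mu]_(x in D) g x.
Proof.
move=> [N [mN N0 fgN]]; congr fine; apply: ae_integral_eq.
by exists N; split => // x /= ne; apply: fgN => /= e; apply: ne => /e ->.
Qed.

Lemma integral_null_compl mu D (f : T -> \bar R) :
  measurable D -> mu (~` D) = 0%E -> (\int[mu]_x f x = \int[mu]_(x in D) f x)%E.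
Proof.
move=> mD D0; rewrite [RHS]integral_mkcond; apply: ae_integral_eq.
exists (~` D); split => //; first exact: measurableC.
by move=> x /= ne Dx; apply: ne => _; rewrite patchE mem_set.
Qed.

Lemma integral_mrestr mu D (mD : measurable D) (f : T -> \bar R) :
  (\int[mrestr mu mD]_x f x = \int[mu]_(x in D) f x)%E.
Proof.
rewrite (integral_null_compl _ mD); last first.
  by rewrite -[LHS]/(mu (~` D `&` D)) setICl measure0.
by apply: eq_measure_integral => A mA AD; rewrite -[LHS]/(mu (A `&` D)) setIidl.
Qed.

Lemma integrable_bnd mu D (M : R) (f : T -> R) : measurable D -> (mu D < +oo)%E ->
  measurable_fun D f -> (forall x, D x -> `|f x| <= M) ->
  mu.-integrable D (EFin \o f).
Proof.
move=> mD Dfin mf fM; apply: measurable_bounded_integrable => //.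
exists M; split; first exact: num_real.
by move=> N MN x Dx; exact: le_trans (fM x Dx) (ltW MN).
Qed.

Lemma finite_measure_lty (m : {finite_measure set T -> \bar R}) D :
  measurable D -> (m D < +oo)%E.
Proof. by move=> mD; rewrite -ge0_fin_numE// fin_num_measure. Qed.

Lemma integrable_fin_bnd (m : {finite_measure set T -> \bar R}) D (M : R)
    (f : T -> R) :
  measurable D -> measurable_fun D f -> (forall x, D x -> `|f x| <= M) ->
  m.-integrable D (EFin \o f).
Proof. by move=> mD; apply: integrable_bnd => //; exact: finite_measure_lty. Qed.

Lemma Rintegral_sum mu D (I : Type) (s : seq I) (P : pred I) (f : I -> T -> R) :
  measurable D -> (forall i, mu.-integrable D (EFin \o f i)) ->
  \int[mu]_(x in D) (\sum_(i <- s | P i) f i x) =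
  \sum_(i <- s | P i) \int[mu]_(x in D) f i x.
Proof.
move=> mD intf; elim: s => [|i s ih].
  under eq_Rintegral do rewrite big_nil.
  by rewrite big_nil Rintegral_cst// mul0r.
under eq_Rintegral do rewrite big_cons; rewrite big_cons.
case: (P i) => //.
rewrite RintegralD// ?ih//.
rewrite (_ : _ \o _ = (fun x => \sum_(j <- s | P j) (f j x)%:E)%E); last first.
  by apply/funext => x /=; rewrite sumEFin.
apply: (@integrable_sum _ _ _ mu D mD _ s P (fun j => EFin \o f j)) => j _.
exact: intf.
Qed.

Lemma Rintegral_dist mu D (f g : T -> R) (e : R) : measurable D -> (mu D < +oo)%E ->
  mu.-integrable D (EFin \o f) -> mu.-integrable D (EFin \o g) ->
  (forall x, D x -> `|f x - g x| <= e) ->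
  `|\int[mu]_(x in D) f x - \int[mu]_(x in D) g x| <= e * fine (mu D).
Proof.
move=> mD Dfin intf intg fg.
have intfg : mu.-integrable D (EFin \o (fun x => f x - g x)).
  exact: (integrableB mD intf intg).
rewrite -RintegralB// (le_trans (le_normr_Rintegral mD intfg))//.
rewrite -Rintegral_cst//; apply: le_Rintegral => //.
- by have := integrable_norm intfg.
- exact: (@integrable_bnd _ _ `|e|).
Qed.

Lemma Rintegral_measure_add (m1 m2 : {finite_measure set T -> \bar R}) D (M : R)
    (f : T -> R) :
  measurable D -> measurable_fun D f -> (forall x, D x -> `|f x| <= M) ->
  \int[measure_add m1 m2]_(x in D) f x =
  \int[m1]_(x in D) f x + \int[m2]_(x in D) f x.
Proof.
move=> mD mf fM; have i1 := integrable_fin_bnd m1 mD mf fM.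
have i2 := integrable_fin_bnd m2 mD mf fM.
rewrite [LHS]/Rintegral integral_measure_add//.
by rewrite fineD//; exact: integrable_fin_num.
Qed.

End integral_lemmas.
Arguments Rintegral_dist {d T R mu D f g} e.

Section charge_integral_lemmas.
Context d (T : measurableType d) (R : realType).

(** The Jordan parts [p], [n] and any other decomposition [m1], [m2] of [nu] satisfy
    [p + m2 = n + m1]. The comparison takes place between these two positive finite measures. All
    later work on charges goes through this lemma. *)
Lemma charge_integral_sub (nu : {charge set T -> \bar R})
    (m1 m2 : {finite_measure set T -> \bar R}) D (f : T -> R) (M : R) :
  (forall A, measurable A -> nu A = m1 A - m2 A)%E ->
  measurable D -> measurable_fun D f -> (forall x, D x -> `|f x| <= M) ->
  charge_integral nu D f = \int[m1]_(x in D) f x - \int[m2]_(x in D) f x.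
Proof.
move=> nuE mD mf fM; rewrite /charge_integral.
set exP := cid _; set exN := cid _.
set P := sval exP; set N := sval exN.
pose p := jordan_pos (svalP exN); pose n := jordan_neg (svalP exN).
have E : (\int[measure_add p m2]_(x in D) (f x)%:E =
         \int[measure_add n m1]_(x in D) (f x)%:E)%E.
  apply: eq_measure_integral => A mA AD.
  have h : (p A - n A = m1 A - m2 A)%E.
    by rewrite -nuE// (jordan_decomp (svalP exN))// /cadd/= /cscale EFinN mulN1e.
  transitivity (p A + m2 A)%E; first exact: measure_addE.
  transitivity (n A + m1 A)%E; last exact/esym/measure_addE.
  have : [/\ p A \is a fin_num, n A \is a fin_num, m1 A \is a fin_num
    & m2 A \is a fin_num] by split; apply: fin_num_measure.
  move: (p A) (n A) (m1 A) (m2 A) h => [a| |] [b| |] [c| |] [e| |] //= h [] // _ _ _ _.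
  by move: h => [h]; rewrite -!EFinD; congr _%:E; lra.
have := congr1 fine E; rewrite -/(Rintegral (measure_add p m2) D f).
rewrite -/(Rintegral (measure_add n m1) D f).
have := Rintegral_measure_add (jordan_pos (svalP exN)) m2 mD mf fM.
have := Rintegral_measure_add (jordan_neg (svalP exN)) m1 mD mf fM.
by rewrite -/p -/n => -> -> ?; lra.
Qed.

End charge_integral_lemmas.

Lemma lebesgue_itv_lty (R : realType) (x y : bool) (a b : R) :
  (@lebesgue_measure R [set` Interval (BSide x a) (BSide y b)] < +oo)%E.
Proof. by rewrite lebesgue_measure_itv; case: ifP => //= _; rewrite -EFinD ltry. Qed.

Lemma fine_lebesgue_itv (R : realType) (x y : bool) (a b : R) : a <= b ->
  fine (@lebesgue_measure R [set` Interval (BSide x a) (BSide y b)]) = b - a.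
Proof.
move=> ab; rewrite lebesgue_measure_itv/= lte_fin.
by case: ltgtP ab => // -> _; rewrite subrr.
Qed.

(** * Positive linear functionals *)

Section positive_functionals.
Context {R : realType} {X : Type}.
Implicit Types (f g h : X -> R) (Lam : (X -> R) -> R).

Definition bnd f := exists M : R, forall x, `|f x| <= M.

Lemma bndD f g : bnd f -> bnd g -> bnd (fun x => f x + g x).
Proof.
move=> [M hM] [N hN]; exists (M + N) => x.
exact: le_trans (ler_normD _ _) (lerD _ _).
Qed.

Lemma bndM f g : bnd f -> bnd g -> bnd (fun x => f x * g x).
Proof.
move=> [M hM] [N hN]; exists (M * N) => x.
by rewrite normrM ler_pM.
Qed.

Lemma bndc (a : R) : bnd (fun=> a).
Proof. by exists `|a|. Qed.

Lemma bndZ a f : bnd f -> bnd (fun x => a * f x).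
Proof. exact/bndM/bndc. Qed.

Lemma bndN f : bnd f -> bnd (fun x => - f x).
Proof. by move=> [M hM]; exists M => x; rewrite normrN. Qed.

Lemma bndB f g : bnd f -> bnd g -> bnd (fun x => f x - g x).
Proof. by move=> bf bg; apply: bndD => //; apply: bndN. Qed.

Lemma bnd_indic (A : set X) : bnd \1_A.
Proof. by exists 1 => x; rewrite indicE; case: (_ \in _); rewrite ?normr1 ?normr0. Qed.

Record posfun Lam : Prop := PosFun {
  posfunD : forall f g, bnd f -> bnd g ->
    Lam (fun x => f x + g x) = Lam f + Lam g;
  posfunZ : forall a f, bnd f -> Lam (fun x => a * f x) = a * Lam f;
  posfun_ge0 : forall f, bnd f -> (forall x, 0 <= f x) -> 0 <= Lam f }.

Section dominated_graph.
Variables (C : R) (C0 : 0 <= C).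
Implicit Types G : set ((X -> R) * R).

Record domgraph G : Prop := DomGraph {
  dg_add : forall p q, G p -> G q -> G ((fun x => p.1 x + q.1 x), p.2 + q.2);
  dg_scale : forall a p, G p -> G ((fun x => a * p.1 x), a * p.2);
  dg_bnd : forall p, G p -> bnd p.1;
  dg_dom : forall p b, G p -> 0 <= b -> (forall x, p.1 x <= b) -> p.2 <= C * b }.

(** The difference of the two pairs has first component 0, so the domination with bound 0 applies in
    both directions. Single-valuedness thus comes from domination; for the length it says that
    [dLen] depends on a field through its rates only. *)
Lemma domgraph_fun G p q : domgraph G -> G p -> G q -> p.1 = q.1 -> p.2 = q.2.
Proof.
move=> GG; suff H p' q' : G p' -> G q' -> p'.1 = q'.1 -> p'.2 <= q'.2.
  by move=> Gp Gq e; apply/eqP; rewrite eq_le !H.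
move=> Gp Gq e.
have := dg_dom GG (dg_add GG Gp (dg_scale GG (-1) Gq)) (lexx 0).
rewrite /= mulr0 e mulN1r subr_le0; apply => x.
by rewrite mulN1r subrr.
Qed.

(** The value [t] of [h] has to satisfy [q.2 - C * b <= t <= C * b' - q'.2] whenever [q.1 - h <= b]
    and [q'.1 + h <= b']. Every such lower bound is below every such upper bound, because [q + q']
    is dominated by [b + b']. Scaling reduces the other multiples of [h] to these two
    inequalities. *)
Lemma domgraph_extend G h : domgraph G -> G !=set0 -> bnd h ->
  exists H, [/\ domgraph H, G `<=` H & exists t, H (h, t)].
Proof.
move=> GG [p0 Gp0] bh.
have G0 : G ((fun=> 0), 0).
  have := dg_scale GG 0 Gp0; rewrite mul0r.
  by under eq_fun do rewrite mul0r.
pose U := [set C * qb.2 - qb.1.2 | qb in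
  [set qb : ((X -> R) * R) * R | [/\ G qb.1, 0 <= qb.2 &
     forall x, qb.1.1 x + h x <= qb.2]]].
have [M hM] := bh.
have M0 : 0 <= `|M| by [].
have hM' x : h x <= `|M|.
  by rewrite (le_trans (ler_norm _))// (le_trans (hM x))// ler_norm.
have hNM x : - h x <= `|M|.
  by rewrite (le_trans (ler_norm _))// normrN (le_trans (hM x))// ler_norm.
have U0 : U !=set0.
  exists (C * `|M| - 0); exists (((fun=> 0), 0), `|M|) => //; split => //= x.
  by rewrite add0r.
have low q b : G q -> 0 <= b -> (forall x, q.1 x - h x <= b) ->
    lbound U (q.2 - C * b).
  move=> Gq b0 qb _ [[q' b'] [/= Gq' b'0 q'b'] <-].
  have := dg_dom GG (dg_add GG Gq Gq') (addr_ge0 b0 b'0).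
  rewrite /= => /(_ _)/wrap[].
    by move=> x; have := qb x; have := q'b' x; lra.
  by lra.
have lU : has_lbound U.
  exists (0 - C * `|M|); apply: (low ((fun=> 0), 0)) => //= x.
  by rewrite sub0r.
pose t := inf U.
exists [set p | exists a q, [/\ G q, p.1 = (fun x => q.1 x + a * h x) & p.2 = q.2 + a * t]].
split.
- split.
  + move=> _ _ [a [q [Gq -> ->]]] [a' [q' [Gq' -> ->]]].
    exists (a + a'), ((fun x => q.1 x + q'.1 x), q.2 + q'.2); split.
    * exact: dg_add.
    * by apply/funext => x /=; ring.
    * by rewrite /=; ring.
  + move=> c _ [a [q [Gq -> ->]]].
    exists (c * a), ((fun x => c * q.1 x), c * q.2); split.
    * exact: dg_scale.
    * by apply/funext => x /=; ring.
    * by rewrite /=; ring.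
  + move=> _ [a [q [Gq -> _]]]; apply: bndD; first exact: dg_bnd Gq.
    exact: bndZ.
  + move=> p b [a [q [Gq -> ->]]] b0 H.
    have [a0|a0|a0] := ltgtP a 0; last 2 first.
    * have /ge_inf -/(_ lU) : U (C * (b / a) - a^-1 * q.2).
        exists (((fun x => a^-1 * q.1 x), a^-1 * q.2), b / a) => //; split => /=.
        - exact: dg_scale.
        - by rewrite divr_ge0// ltW.
        - move=> x; rewrite ler_pdivlMr// mulrDl mulrAC mulVf ?gt_eqF// mul1r.
          by rewrite (mulrC (h x)).
      rewrite -/t => le_t.
      have : a * t <= a * (C * (b / a) - a^-1 * q.2) by rewrite ler_pM2l.
      rewrite (_ : a * (_ - _) = C * b - q.2); first by lra.
      by field; rewrite gt_eqF.
    * rewrite a0 mul0r addr0; apply: (dg_dom GG Gq b0) => x.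
      by have := H x; rewrite a0 mul0r addr0.
    * have : lbound U ((- a^-1) * q.2 - C * (- b / a)).
        apply: (low ((fun x => - a^-1 * q.1 x), - a^-1 * q.2)) => /=.
        - exact: dg_scale.
        - by rewrite mulNr -mulrN -invrN divr_ge0// oppr_ge0 ltW.
        - move=> x; rewrite mulNr -opprD lerNl mulNr opprK ler_ndivrMr//.
          rewrite mulrDl mulrAC mulVf ?lt_eqF// mul1r (mulrC (h x)); exact: H.
      move=> /(lb_le_inf U0); rewrite -/t => le_t.
      have : a * t <= a * (- a^-1 * q.2 - C * (- b / a)) by rewrite ler_nM2l.
      rewrite (_ : a * (_ - _) = C * b - q.2); first by lra.
      by field; rewrite lt_eqF.
- move=> q Gq; exists 0, q; rewrite mul0r addr0; split => //.
  by apply/funext => x; rewrite mul0r addr0.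
- exists t, 1, ((fun=> 0), 0); split => //=; last by rewrite mul1r add0r.
  by apply/funext => x; rewrite mul1r add0r.
Qed.

(* Hahn-Banach for the sublinear functional [C * max 0 (sup f)]; the linear
   functional to be extended is given by its graph. *)
Lemma hahn_banach_positive G : domgraph G -> G !=set0 ->
  exists Lam, [/\ posfun Lam, forall p, G p -> Lam p.1 = p.2 &
    Lam (fun=> 1) <= C].
Proof.
move=> GG G0.
pose P A := domgraph A /\ (A = set0 \/ G `<=` A).
have [F FP Ftot|A [[AG AGs] Amax]] := @Zorn_bigcup _ P.
  split; last first.
    have [[A [FA A0]]|nA] := pselect (exists A, F A /\ A !=set0).
      right; have [_ [A00|GA]] := FP _ FA; first by rewrite A00 in A0; case: A0.
      by move=> x Gx; exists A => //; apply: GA.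
    left; apply/seteqP; split => // x [A FA Ax]; apply: nA; exists A; split => //.
    by exists x.
  have two p q : (\bigcup_(X in F) X) p -> (\bigcup_(X in F) X) q ->
      exists2 A, F A & A p /\ A q.
    move=> [A FA Ap] [B FB Bq].
    have [AB|BA] := Ftot _ _ FA FB; [exists B|exists A] => //; split => //.
      exact: AB.
    exact: BA.
  split.
  - move=> p q Up Uq; have [A FA [Ap Aq]] := two _ _ Up Uq.
    by exists A => //; apply: (dg_add (FP _ FA).1).
  - move=> a p [A FA Ap]; exists A => //; exact: (dg_scale (FP _ FA).1).
  - move=> p [A FA Ap]; exact: (dg_bnd (FP _ FA).1 Ap).
  - move=> p b [A FA Ap]; exact: (dg_dom (FP _ FA).1 Ap).
have GA : G `<=` A.
  case: AGs => // A0; exfalso; apply: (Amax G).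
    by rewrite A0 properEneq; split => //; apply/eqP => e; case: G0 => x; rewrite -e.
  by split => //; right.
have [a Aa] : A !=set0 by case: G0 => x /GA; exists x.
(* An unbounded function receives a value about which nothing is claimed. *)
have tot h : exists t, bnd h -> A (h, t).
  have [bh|nb] := pselect (bnd h); last by exists 0.
  have [H [HG AH [t Ht]]] := domgraph_extend AG (ex_intro _ _ Aa) bh.
  exists t => _; suff -> : A = H by [].
  apply: contrapT => AneH; apply: (Amax H).
    by rewrite properEneq; split => //; apply/eqP.
  by split => //; right; apply: subset_trans GA AH.
pose Lam h := projT1 (cid (tot h)).
have LamP h : bnd h -> A (h, Lam h) by rewrite /Lam; case: cid.
have LamE p : A p -> Lam p.1 = p.2.
  move=> Ap; have bp := dg_bnd AG Ap.
  exact: (@domgraph_fun A (p.1, Lam p.1) p AG (LamP _ bp) Ap).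
have LamN f : bnd f -> Lam (fun x => -1 * f x) = - Lam f.
  by move=> bf; have /= -> := LamE _ (dg_scale AG (-1) (LamP _ bf)); rewrite mulN1r.
exists Lam; split.
- split.
  + by move=> f g bf bg; apply: (LamE (_, _) (dg_add AG (LamP _ bf) (LamP _ bg))).
  + by move=> c f bf; apply: (LamE (_, _) (dg_scale AG c (LamP _ bf))).
  (* Positivity: [- f] is bounded above by 0, where the domination reads [- Lam f <= 0]. *)
  + move=> f bf f0.
    have := dg_dom AG (LamP _ (bndZ (-1) bf)) (lexx 0).
    rewrite /= LamN// mulr0 oppr_le0; apply => x.
    by rewrite mulN1r oppr_le0.
- by move=> p /GA; apply: LamE.
- have := dg_dom AG (LamP _ (bndc 1)) ler01; rewrite /= mulr1; exact.
Qed.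

End dominated_graph.
End positive_functionals.

(** * Representing measures *)

Section riesz.
Context {R : realType} {X : Type}.
Variable Lam : (X -> R) -> R.
Hypothesis LamP : posfun Lam.

Lemma posfunB f g : bnd f -> bnd g ->
  Lam (fun x => f x - g x) = Lam f - Lam g.
Proof.
move=> bf bg; rewrite -mulN1r -(posfunZ LamP)// -(posfunD LamP)//; last exact: bndZ.
by congr Lam; apply/funext => x; rewrite mulN1r.
Qed.

Lemma posfun_le f g : bnd f -> bnd g -> (forall x, f x <= g x) ->
  Lam f <= Lam g.
Proof.
move=> bf bg fg; rewrite -subr_ge0 -posfunB//; apply: (posfun_ge0 LamP).
  exact: bndB.
by move=> x; rewrite subr_ge0.
Qed.

Lemma posfun_cst (a : R) : Lam (fun=> a) = a * Lam (fun=> 1).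
Proof.
rewrite -(posfunZ LamP)//; last exact: bndc.
by congr Lam; apply/funext => x; rewrite mulr1.
Qed.

Lemma posfun_dist f g (e : R) : bnd f -> bnd g -> (forall x, `|f x - g x| <= e) ->
  `|Lam f - Lam g| <= e * Lam (fun=> 1).
Proof.
move=> bf bg fg; rewrite -posfunB// -posfun_cst ler_norml; apply/andP; split.
  rewrite -mulN1r -(posfunZ LamP); last exact: bndc.
  apply: posfun_le; [exact: bndc|exact: bndB|move=> x].
  by rewrite mulN1r; have := fg x; rewrite ler_norml => /andP[].
apply: posfun_le; [exact: bndB|exact: bndc|move=> x].
by have := fg x; rewrite ler_norml => /andP[].
Qed.

Lemma bnd_sum (I : Type) (s : seq I) (P : pred I) (f : I -> X -> R) :
  (forall i, bnd (f i)) -> bnd (fun x => \sum_(i <- s | P i) f i x).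
Proof.
move=> bf; elim: s => [|i s ih].
  by under eq_fun do rewrite big_nil; exact: bndc.
under eq_fun do rewrite big_cons.
by case: (P i) => //; exact: bndD.
Qed.

Lemma posfun_sum (I : Type) (s : seq I) (P : pred I) (f : I -> X -> R) :
  (forall i, bnd (f i)) ->
  Lam (fun x => \sum_(i <- s | P i) f i x) = \sum_(i <- s | P i) Lam (f i).
Proof.
move=> bf; elim: s => [|i s ih].
  under eq_fun do rewrite big_nil.
  by rewrite big_nil posfun_cst mul0r.
under eq_fun do rewrite big_cons; rewrite big_cons.
by case: (P i) => //; rewrite (posfunD LamP)// ?ih//; exact: bnd_sum.
Qed.

(* A finitely additive probability-like functional is carried over to Lebesgue
   measure on [0, Lam 1[: the binary tests [B] split X into nested cylinders,
   and a cylinder receives a subinterval whose length is its mass. *)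
Variable B : nat -> X -> bool.

Definition word n x : seq bool := [seq B k x | k <- iota 0 n].

Definition cyl (w : seq bool) : set X := [set x | word (size w) x = w].

Definition mass w := Lam (\1_(cyl w)).

Lemma size_word n x : size (word n x) = n.
Proof. by rewrite size_map size_iota. Qed.

Lemma wordS n x : word n.+1 x = rcons (word n x) (B n x).
Proof. by rewrite /word -addn1 iotaD map_cat/= cats1 add0n. Qed.

Lemma mass_ge0 w : 0 <= mass w.
Proof.
apply: (posfun_ge0 LamP); first exact: bnd_indic.
by move=> x; rewrite indicE.
Qed.

Lemma cyl_rcons w b x : (x \in cyl (rcons w b)) =
  (x \in cyl w) && (B (size w) x == b).
Proof.
apply/idP/andP; rewrite ?inE /cyl/= size_rcons wordS.
  by move/rcons_inj => -[-> ->].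
by move=> [-> /eqP ->].
Qed.

Lemma mass_split w : mass w = mass (rcons w false) + mass (rcons w true).
Proof.
rewrite /mass -(posfunD LamP)//; try exact: bnd_indic.
congr Lam; apply/funext => x; rewrite !indicE !cyl_rcons.
by case: (x \in _); case: (B _ _); rewrite /= ?addr0 ?add0r.
Qed.

Lemma mass0 w : (forall x, ~ cyl w x) -> mass w = 0.
Proof.
move=> w0; rewrite /mass -[RHS](mul0r (Lam (fun=> 1))) -posfun_cst.
by congr Lam; apply/funext => x; rewrite indicE memNset.
Qed.

Lemma mass_nil : mass [::] = Lam (fun=> 1).
Proof. by congr Lam; apply/funext => x; rewrite indicE mem_set. Qed.

(** Left end of the subinterval of [w]: each letter [true] of [w] skips the mass of the sibling
    cylinder ending in [false]. *)
Definition lft (w : seq bool) : R :=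
  \sum_(k < size w | nth false w k) mass (rcons (take k w) false).

Lemma lft_rcons w b :
  lft (rcons w b) = lft w + (if b then mass (rcons w false) else 0).
Proof.
rewrite /lft size_rcons big_mkcond big_ord_recr/= nth_rcons ltnn eqxx.
rewrite -cats1 take_cat ltnn subnn take0 cats0; congr (_ + _).
rewrite [RHS]big_mkcond; apply: eq_bigr => i _.
by rewrite nth_cat ltn_ord take_cat ltn_ord.
Qed.

(** The itinerary of [t]: at each node the next letter tells on which side of the cut point [t]
    lies. *)
Fixpoint wd n (t : R) : seq bool :=
  if n is n'.+1 then
    rcons (wd n' t) (lft (wd n' t) + mass (rcons (wd n' t) false) <= t)
  else [::].

Lemma size_wd n t : size (wd n t) = n.
Proof. by elim: n => //= n ih; rewrite size_rcons ih. Qed.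

Lemma take_wd m n t : (m <= n)%N -> take m (wd n t) = wd m t.
Proof.
elim: n => [|n ih]; first by rewrite leqn0 => /eqP ->.
rewrite leq_eqVlt => /predU1P[->|]; first by rewrite take_oversize// size_wd.
by rewrite ltnS => mn; rewrite /= -cats1 takel_cat ?size_wd// ih.
Qed.

Let M := Lam (fun=> 1).

Definition node w : set R := `[lft w, lft w + mass w[.

Lemma node_wd n (t : R) : 0 <= t < M -> node (wd n t) t.
Proof.
move=> tM; elim: n => [|n].
  by rewrite /node/= in_itv/= /lft big_ord0 add0r mass_nil.
rewrite /node/= !in_itv/= lft_rcons => /andP[ltt tlt].
have [le|lt] := leP (lft (wd n t) + mass (rcons (wd n t) false)) t.
  by rewrite le/= -addrA -mass_split.
by rewrite addr0 ltt.
Qed.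

(** The node of [rcons w b] is contained in that of [w], where the induction hypothesis recovers
    [w]; the position of [t] relative to the cut then gives [b]. *)
Lemma nodeE w (t : R) : 0 <= t < M -> node w t <-> wd (size w) t = w.
Proof.
move=> tM; split; last by move=> <-; rewrite -[in node]/(node _); exact: node_wd.
elim/last_ind: w => // w b ih; rewrite size_rcons /node/= !in_itv/= lft_rcons.
have m0 := mass_ge0 (rcons w false); have m1 := mass_ge0 (rcons w true).
have mw := mass_split w.
have H : lft w <= t < lft w + mass w -> wd (size w) t = w.
  by move=> ?; apply: ih; rewrite /node/= in_itv/=.
case: b => /andP[h1 h2]; rewrite H; try (apply/andP; split; lra).
  by rewrite h1.
by congr rcons; apply/negbTE; rewrite -ltNge; lra.
Qed.

Lemma node_sub w (t : R) : node w t -> 0 <= t < M.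
Proof.
elim/last_ind: w => [|w b].
  by rewrite /node/= in_itv/= /lft big_ord0 add0r mass_nil.
move=> ih; rewrite {1}/node/= in_itv/= lft_rcons => /andP[h1 h2]; apply: ih.
have m0 := mass_ge0 (rcons w false); have m1 := mass_ge0 (rcons w true).
have mw := mass_split w.
by rewrite /node/= in_itv/=; case: b h1 h2 => h1 h2; apply/andP; split; lra.
Qed.

Lemma lebesgue_node w : lebesgue_measure (node w) = (mass w)%:E.
Proof.
rewrite lebesgue_measure_itv/= lte_fin ltrDl; case: ifPn => [_|].
  by rewrite -EFinD; congr _%:E; ring.
by rewrite -leNgt => w0; congr _%:E; apply/eqP; rewrite eq_le w0 mass_ge0.
Qed.

Lemma sum_indic_tuple n (w : seq bool) (g : seq bool -> R) : size w = n ->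
  \sum_(v : n.-tuple bool) g v * (w == v)%:R = g w.
Proof.
move=> sw; have wn : size w == n by apply/eqP.
rewrite (bigD1 (Tuple wn))//= eqxx mulr1 big1 ?addr0// => v /eqP vw.
case: eqP => [wv|]; rewrite ?mulr0//.
by exfalso; apply: vw; apply: val_inj.
Qed.

(** Both sides are the sum over the words [v] of length [n] of [g v * mass v]: on the left the
    cylinders partition [X], on the right the nodes partition [[0, M[]. *)
Lemma Lam_word n (g : seq bool -> R) :
  Lam (fun x => g (word n x)) =
  \int[lebesgue_measure]_(t in `[0, M[) g (wd n t).
Proof.
transitivity (\sum_(v : n.-tuple bool) g v * mass v).
  transitivity (Lam (fun x => \sum_(v : n.-tuple bool) g v * \1_(cyl v) x)).
    congr Lam; apply/funext => x.
    rewrite -(sum_indic_tuple g (size_word n x)); apply: eq_bigr => v _.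
    congr (_ * _); rewrite indicE; congr (_%:R); congr nat_of_bool.
    by apply/eqP/idP; rewrite inE /cyl/= size_tuple.
  rewrite posfun_sum; last by move=> v; exact/bndZ/bnd_indic.
  by apply: eq_bigr => v _; rewrite (posfunZ LamP)//; exact: bnd_indic.
have mM : measurable (`[0, M[%classic : set (MR R)) by exact: measurable_itv.
have fM : (@lebesgue_measure R `[0%R, M[%classic < +oo)%E.
  exact: lebesgue_itv_lty.
transitivity (\int[lebesgue_measure]_(t in `[0, M[)
   (\sum_(v : n.-tuple bool) g v * \1_(node v) t)); last first.
  apply: eq_Rintegral => t; rewrite inE/= in_itv/= => tM.
  rewrite -(sum_indic_tuple g (size_wd n t)); apply: eq_bigr => v _.
  congr (_ * _); rewrite indicE; congr (_%:R); congr nat_of_bool.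
  have := nodeE v tM; rewrite size_tuple => nv.
  by apply/idP/eqP => [/set_mem/nv|/nv/mem_set].
have inti v : (@lebesgue_measure R).-integrable `[0, M[ (EFin \o \1_(node v)).
  apply: (@integrable_bnd _ _ _ _ _ 1) => //.
    by apply: measurable_indic; exact: measurable_itv.
  by move=> x _; rewrite indicE; case: (_ \in _); rewrite ?normr1 ?normr0.
rewrite Rintegral_sum//; last first.
  by move=> v; have := integrableZl mM (g v) (inti v).
apply: eq_bigr => v _; rewrite RintegralZl//; congr (_ * _).
have mn : measurable (node v : set (MR R)) by exact: measurable_itv.
rewrite /Rintegral (@integral_indic _ _ _ _ _ mM)// setIidl.
  exact/esym/(congr1 fine (lebesgue_node v)).
by move=> t /node_sub; rewrite /= in_itv.
Qed.

(* Threshold tests [u b x < j / (N + 1)] for all [b], [j], [N]: they determine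
   the coordinates [u] up to any precision. *)
Definition thresholds (u : bool -> X -> R) (k : nat) (x : X) : bool :=
  if unpickle k is Some (b, j, N) then u b x < j%:R / N.+1%:R else false.

End riesz.

(** * Images and restrictions of finite measures *)

Section finite_pushforward.
Context d1 d2 (T1 : measurableType d1) (T2 : measurableType d2) (R : realType).
Variables (m : {finite_measure set T1 -> \bar R}) (f : T1 -> T2).
Hypothesis mf : measurable_fun [set: T1] f.

Definition fpush : set T2 -> \bar R := pushforward m f.

Let fpush0 : fpush set0 = 0%E.
Proof. by rewrite /fpush /pushforward preimage_set0 measure0. Qed.

Let fpush_ge0 A : (0 <= fpush A)%E.
Proof. exact: measure_ge0. Qed.

Let fpush_sigma_additive : semi_sigma_additive fpush.
Proof. exact: measure_semi_sigma_additive. Qed.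

HB.instance Definition _ := isMeasure.Build _ _ _ fpush
  fpush0 fpush_ge0 fpush_sigma_additive.

Let fpush_fin : fin_num_fun fpush.
Proof.
by move=> U mU; apply: fin_num_measure; rewrite -[X in measurable X]setTI; exact: mf.
Qed.

HB.instance Definition _ := Measure_isFinite.Build _ _ _ fpush fpush_fin.

Definition finite_push : {finite_measure set T2 -> \bar R} := fpush.

Lemma finite_pushE A : finite_push A = m (f @^-1` A).
Proof. by []. Qed.

Lemma Rintegral_finite_push D (g : T2 -> R) (K : R) :
  measurable D -> measurable_fun setT g -> (forall x, `|g x| <= K) ->
  \int[finite_push]_(y in D) g y = \int[m]_(x in f @^-1` D) g (f x).
Proof.
move=> mD mg gK; congr fine.
rewrite (@integral_pushforward _ _ _ _ _ _ mf m D (EFin \o g))//.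
  exact/measurable_EFinP.
apply: (@integrable_fin_bnd _ _ _ _ _ K) => //.
- by rewrite -[X in measurable X]setTI; exact: mf.
- by apply: measurable_funTS; exact: (measurableT_comp mg mf).
Qed.

End finite_pushforward.

Section lebesgue_restriction.
Context {R : realType}.

(** The bound [BSide b l] is open for [b = true] and closed for [b = false]: [[0, l[] carries the
    nodes, [[0, l]] serves for Fubini's theorem. *)
Definition lebesgue_0 (b : bool) (l : R) : set (MR R) -> \bar R :=
  mrestr (@lebesgue_measure R) (measurable_itv (Interval (BLeft 0) (BSide b l))).

HB.instance Definition _ b l := Measure.on (lebesgue_0 b l).

Let lebesgue_0_fin b l : fin_num_fun (lebesgue_0 b l).
Proof.
move=> U mU; rewrite ge0_fin_numE// /lebesgue_0/mrestr.
pose I : set (MR R) := [set` Interval (BLeft 0) (BSide b l)].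
apply: (@le_lt_trans _ _ (@lebesgue_measure R I)); last exact: lebesgue_itv_lty.
have mI : measurable I by exact: measurable_itv.
by apply: le_measure; rewrite ?inE//; exact: measurableI.
Qed.

HB.instance Definition _ b l :=
  Measure_isFinite.Build _ _ _ (lebesgue_0 b l) (@lebesgue_0_fin b l).

Lemma Rintegral_lebesgue_0 b (l : R) (g : MR R -> R) :
  \int[lebesgue_0 b l]_x g x =
  \int[lebesgue_measure]_(x in [set` Interval (BLeft 0) (BSide b l)]) g x.
Proof. by congr fine; exact: integral_mrestr. Qed.

End lebesgue_restriction.

(** * Representation on functions of two bounded coordinates *)

Section riesz_coordinates.
Context {R : realType} {X : Type}.
Variable Lam : (X -> R) -> R.
Hypothesis LamP : posfun Lam.
Variables (u : bool -> X -> R) (L : bool -> R).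
Hypothesis L0 : forall b, 0 <= L b.
Hypothesis u0L : forall b x, 0 <= u b x <= L b.

Let B := thresholds u.
Let M := Lam (fun=> 1).

(** With [N.+1%:R^-1 < e], coordinates that differ by [e] are separated by some [j / (N + 1)], whose
    test then gives different letters. Only finitely many [j] occur below the bounds [L b], and [n]
    exceeds the codes of all their tests. *)
Lemma thresholds_modulus (e : R) : 0 < e -> exists n, forall x y,
  word B n x = word B n y -> forall b, `|u b x - u b y| < e.
Proof.
move=> e0.
pose N := Num.truncn e^-1.
have N0 : 0 < N.+1%:R :> R by rewrite ltr0n.
have Ne : N.+1%:R^-1 < e.
  by rewrite invf_plt ?posrE// truncnS_gt.
pose J b := (Num.truncn (L b * N.+1%:R)).+2.
pose n := \max_(b : bool) \max_(j < J b) (pickle (b, nat_of_ord j, N)).+1.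
exists n => x y xy.
suff H z w b : word B n z = word B n w -> u b w - u b z < e.
  by move=> b; rewrite ltr_norml ltrNl opprB !H.
move=> zw; rewrite ltNge; apply/negP => le_e.
pose j := (Num.truncn (u b z * N.+1%:R)).+1.
have /andP[uz0 uzL] := u0L b z; have /andP[uw0 uwL] := u0L b w.
have uzN0 : 0 <= u b z * N.+1%:R by rewrite mulr_ge0// ltW.
have /andP[jz zj] := truncn_itv uzN0.
have zj' : u b z < j%:R / N.+1%:R by rewrite ltr_pdivlMr.
have jw : j%:R / N.+1%:R <= u b w.
  apply: (@le_trans _ _ (u b z + N.+1%:R^-1)); last first.
    by rewrite -lerBrDl; exact: le_trans (ltW Ne) le_e.
  rewrite ler_pdivrMr// mulrDl mulVf ?gt_eqF// /j -addn1 natrD lerD2r//.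
have jJ : (j < J b)%N.
  rewrite /J /j ltnS ltnS; apply: le_truncn.
  by rewrite ler_pM2r.
have kn : (pickle (b, j, N) < n)%N.
  rewrite /n; apply: (leq_trans _ (leq_bigmax b)).
  exact: (leq_trans _ (leq_bigmax (Ordinal jJ))).
have := congr1 (fun s => nth false s (pickle (b, j, N))) zw.
rewrite !(nth_map 0%N) ?size_iota// !nth_iota// add0n /B /thresholds pickleK.
by rewrite zj' ltNge jw.
Qed.

Definition nval b (w : seq bool) : R := xget 0 [set u b x | x in cyl B w].

Lemma nval_bounds b w : 0 <= nval b w <= L b.
Proof.
rewrite /nval; case: xgetP => [_ -> [x _ <-]|_]; first exact: u0L.
by rewrite lexx L0.
Qed.

Lemma nval_close b (e : R) n w x : 0 < e ->
  (forall x y, word B n x = word B n y -> forall b, `|u b x - u b y| < e) ->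
  cyl B w x -> (n <= size w)%N -> `|nval b w - u b x| < e.
Proof.
move=> e0 H wx nw; rewrite /nval; case: xgetP => [_ -> [y wy <-]|]; last first.
  by move=> /(_ (u b x)) []; exists x.
have tk z : cyl B w z -> word B n z = take n w.
  move=> <-; rewrite /word -map_take; congr map.
  by rewrite take_iota (minn_idPl nw).
by apply: H; rewrite !tk.
Qed.

Definition qapprox n b (t : R) : R :=
  if 0 <= t < M then nval b (wd Lam B n t) else 0.

Lemma measurable_qapprox n b : measurable_fun setT (qapprox n b : MR R -> R).
Proof.
rewrite (_ : qapprox n b =
    fun t => \sum_(v : n.-tuple bool) nval b v * \1_(node Lam B v) t).
  apply: measurable_sum => v; apply: measurable_funM; first exact: measurable_cst.
  by apply: measurable_indic; exact: measurable_itv.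
apply/funext => t; rewrite /qapprox; case: ifPn => tM.
  rewrite -(sum_indic_tuple (nval b) (size_wd Lam B n t)); apply: eq_bigr => v _.
  have := nodeE LamP B v tM; rewrite size_tuple => nv.
  congr (_ * _); rewrite indicE; congr (_%:R); congr nat_of_bool.
  by apply/eqP/idP => [/nv/mem_set|/set_mem/nv].
rewrite big1// => v _; rewrite indicE memNset ?mulr0// => /(node_sub LamP).
by move/negP : tM.
Qed.

(** An empty cylinder has mass 0, so its node is empty and cannot contain [t]. *)
Lemma cyl_wd n t : 0 <= t < M -> exists x, cyl B (wd Lam B n t) x.
Proof.
move=> tM; apply: contrapT => nx.
have := node_wd LamP B n tM; rewrite /node/= in_itv/= mass0//.
  by rewrite addr0 => /andP[h1 h2]; lra.
by move=> x ?; apply: nx; exists x.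
Qed.

(** The cylinders along the itinerary of [t] are nested, and past [n0] each coordinate oscillates by
    less than [e / 2] on them; a point of the smaller one compares the two representative values.
    The rank [n0] does not depend on [t]. *)
Lemma qapprox_close (e : R) : 0 < e -> exists n0, forall n m b t,
  (n0 <= n)%N -> (n0 <= m)%N -> `|qapprox n b t - qapprox m b t| < e.
Proof.
move=> e0; have e20 : 0 < e / 2 by lra.
have [n0 H] := thresholds_modulus e20; exists n0.
suff K n m b t : (n0 <= n)%N -> (n <= m)%N -> `|qapprox n b t - qapprox m b t| < e.
  move=> n m b t hn hm; have /orP[nm|mn] := leq_total n m; first exact: K.
  by rewrite distrC; exact: K.
move=> hn nm; rewrite /qapprox; case: ifPn => tM; last by rewrite subrr normr0.
have [x wx] := cyl_wd m tM.
have wx' : cyl B (wd Lam B n t) x.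
  rewrite /cyl/= size_wd -(take_wd Lam B t nm) -wx /word -map_take take_iota.
  by rewrite size_wd (minn_idPl nm).
have := @nval_close b _ _ _ _ e20 H wx; rewrite size_wd => /(_ (leq_trans hn nm)).
have := @nval_close b _ _ _ _ e20 H wx'; rewrite size_wd => /(_ hn).
by rewrite !ltr_norml => /andP[? ?] /andP[? ?]; apply/andP; split; lra.
Qed.

Definition qlim b (t : R) : R := lim (qapprox n b t @[n --> \oo]).

Lemma cvg_qapprox b t : qapprox n b t @[n --> \oo] --> qlim b t.
Proof.
apply/cauchy_cvgP/cauchy_ballP => e e0; near_simpl.
have [n0 H] := qapprox_close e0.
exists ([set n | (n0 <= n)%N], [set n | (n0 <= n)%N]); first by split; exists n0.
by move=> [n m] [/= hn hm]; rewrite /ball/=; exact: H.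
Qed.

Lemma measurable_qlim b : measurable_fun setT (qlim b : MR R -> R).
Proof.
apply: (@measurable_fun_cvg _ _ _ _ (fun n => qapprox n b)).
  by move=> n; exact: measurable_qapprox.
by move=> t _; exact: cvg_qapprox.
Qed.

Lemma qlim_bounds b t : 0 <= qlim b t <= L b.
Proof.
have H n : 0 <= qapprox n b t <= L b.
  by rewrite /qapprox; case: ifP => _; rewrite ?nval_bounds// lexx L0.
apply/andP; split.
  apply: limr_ge; first by apply/cvg_ex; exists (qlim b t); exact: cvg_qapprox.
  by near=> n; have /andP[] := H n.
apply: limr_le; first by apply/cvg_ex; exists (qlim b t); exact: cvg_qapprox.
by near=> n; have /andP[] := H n.
Unshelve. all: by end_near. Qed.

Lemma qlim_close (e : R) : 0 < e -> exists n0, forall n b t, (n0 <= n)%N ->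
  `|qapprox n b t - qlim b t| <= e.
Proof.
move=> e0; have [n0 H] := qapprox_close e0; exists n0 => n b t hn.
have cv : `|qapprox n b t - qapprox m b t| @[m --> \oo] -->
          `|qapprox n b t - qlim b t|.
  by apply: cvg_norm; apply: cvgB; [exact: cvg_cst|exact: cvg_qapprox].
rewrite -(cvg_lim _ cv)//; apply: limr_le; first by apply/cvg_ex; eexists; exact: cv.
near=> m; apply/ltW/H => //.
by near: m; exists n0.
Unshelve. all: by end_near. Qed.

(** The admissible functions live on the whole plane, since the image of the contacts under the
    coordinates is an arbitrary subset of a rectangle. Measurability is required for the product of
    the Borel structures. *)
Record uc (f : R * R -> R) : Prop := Uc {
  uc_bnd : exists K : R, forall z, `|f z| <= K;
  uc_meas : measurable_fun setT (f : (MR R * MR R)%type -> R);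
  uc_cont : forall e : R, 0 < e -> exists2 d : R, 0 < d & forall z z',
    `|z.1 - z'.1| < d -> `|z.2 - z'.2| < d -> `|f z - f z'| < e }.

(** Replacing the coordinates by their representatives on cylinders of length [n] changes either
    side by at most [e' * M], and [Lam_word] equates the results. The denominator [M + 1] in [e']
    covers the case [M = 0]. *)
Lemma Lam_coordinates (f : R * R -> R) : uc f ->
  Lam (fun x => f (u false x, u true x)) =
  \int[lebesgue_measure]_(t in `[0, M[) f (qlim false t, qlim true t).
Proof.
move=> [[K fK] mf cf].
have M0 : 0 <= M by apply: (posfun_ge0 LamP) => //; exact: bndc.
have leb0M : @lebesgue_measure R `[0%R, M[%classic = M%:E.
  rewrite lebesgue_measure_itv/= lte_fin; case: ifPn => [_|].
    by rewrite -EFinD subr0.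
  by rewrite -leNgt => M0'; congr _%:E; apply/eqP; rewrite eq_le M0 M0'.
have fin : (@lebesgue_measure R `[0%R, M[%classic < +oo)%E by rewrite leb0M ltry.
have mq : measurable_fun (`[0, M[%classic : set (MR R))
    (fun t => f (qlim false t, qlim true t)).
  apply: measurable_funTS; apply: (measurableT_comp mf).
  by apply/measurable_fun_pairP; split; exact: measurable_qlim.
suff H (e : R) : 0 < e ->
  `|Lam (fun x => f (u false x, u true x)) -
    \int[lebesgue_measure]_(t in `[0, M[) f (qlim false t, qlim true t)| <= e.
  apply/eqP; rewrite -subr_eq0 -normr_le0; apply/ler_addgt0Pl => e e0.
  by rewrite addr0; exact: H.
move=> e0; pose e' := e / (2 * (M + 1)).
have e'0 : 0 < e' by rewrite divr_gt0// mulr_gt0// ltr_wpDl.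
have [d d0 fd] := cf _ e'0; have d20 : 0 < d / 2 by lra.
have [n1 H1] := thresholds_modulus d0; have [n2 H2] := qlim_close d20.
pose n := maxn n1 n2; pose g w := f (nval false w, nval true w).
have bf : bnd (fun x => f (u false x, u true x)) by exists K.
have bg : bnd (fun x => g (word B n x)) by exists K => x; exact: fK.
have nc b x : `|u b x - nval b (word B n x)| < d.
  rewrite distrC; apply: (@nval_close b d n1 _ x d0 H1).
    by rewrite /cyl/= size_word.
  by rewrite size_word leq_maxl.
have D1 : `|Lam (fun x => f (u false x, u true x)) -
            Lam (fun x => g (word B n x))| <= e' * M.
  apply: (posfun_dist LamP) => // x; apply/ltW/fd; exact: nc.
have D2 : `|\int[lebesgue_measure]_(t in `[0, M[) g (wd Lam B n t) -
   \int[lebesgue_measure]_(t in `[0, M[) f (qlim false t, qlim true t)| <= e' * M.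
  rewrite -[X in e' * X](_ : fine (@lebesgue_measure R `[0%R, M[%classic) = M); last first.
    by rewrite leb0M.
  apply: Rintegral_dist => //.
  - apply: (@integrable_bnd _ _ _ _ _ K) => //; last by move=> t _; exact: fK.
    apply: (@eq_measurable_fun _ _ _ _ _ (fun t => f (qapprox n false t, qapprox n true t))).
      by move=> t /[!inE]/=; rewrite in_itv/= /qapprox /g => ->.
    apply: measurable_funTS; apply: (measurableT_comp mf).
    by apply/measurable_fun_pairP; split; exact: measurable_qapprox.
  - by apply: (@integrable_bnd _ _ _ _ _ K) => // t _; exact: fK.
  - move=> t /=; rewrite in_itv/= => tM; apply/ltW/fd => /=.
    + have := H2 n false t (leq_maxr _ _); rewrite /qapprox tM => h.
      by rewrite (le_lt_trans h)//; lra.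
    + have := H2 n true t (leq_maxr _ _); rewrite /qapprox tM => h.
      by rewrite (le_lt_trans h)//; lra.
rewrite -(Lam_word LamP) in D2.
rewrite (le_trans (ler_distD (Lam (fun x => g (word B n x))) _ _))//.
rewrite (le_trans (lerD D1 D2))//.
have M10 : 0 < M + 1 by rewrite ltr_wpDl.
rewrite (_ : _ + _ = e * (M / (M + 1))); last by rewrite /e'; field; rewrite gt_eqF.
by rewrite ger_pMr// ler_pdivrMr// mul1r lerDl.
Qed.

Theorem riesz_markov : exists m : {finite_measure set (MR R * MR R)%type -> \bar R},
  m (~` [set z | 0 <= z.1 <= L false /\ 0 <= z.2 <= L true]) = 0%E /\
  forall f, uc f -> Lam (fun x => f (u false x, u true x)) = \int[m]_z f z.
Proof.
have mq : measurable_fun [set: MR R] (fun t => (qlim false t, qlim true t) : (MR R * MR R)%type).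
  by apply/measurable_fun_pairP; split; exact: measurable_qlim.
exists (finite_push (lebesgue_0 true M) mq); split.
  rewrite finite_pushE (_ : _ @^-1` _ = set0) ?measure0//.
  apply/seteqP; split => // t /=; apply; split; exact: qlim_bounds.
move=> f [[K fK] mf cf].
rewrite (Rintegral_finite_push _ mq measurableT mf fK) preimage_setT.
rewrite Rintegral_lebesgue_0.
by rewrite Lam_coordinates//; split => //; exists K.
Qed.

End riesz_coordinates.

(** * Smooth functions *)

Section smooth_functions.
Context {R : realType}.
Implicit Types (f g : R -> R) (C : set (R -> R)).

Lemma is_derive1_cvg f (x l : R) :
  (h^-1 *: (f (h + x) - f x)) @[h --> 0^'] --> l -> is_derive x 1 f l.
Proof.
move=> H; have H' : (h^-1 *: (f (h *: 1 + x) - f x)) @[h --> 0^'] --> l.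
  rewrite (_ : (fun h => _) = (fun h => h^-1 *: (f (h + x) - f x)))//.
  by apply/funext => h; rewrite /GRing.scale/= mulr1.
apply: DeriveDef; first by apply/cvg_ex; exists l.
exact: cvg_lim H'.
Qed.

Lemma is_derive1_near f g (x l : R) : {near x, f =1 g} -> is_derive x 1 g l ->
  is_derive x 1 f l.
Proof.
move=> fg [dg <-]; have gf : {near x, g =1 f}.
  by apply: filterS fg => y ->.
apply: DeriveDef; first exact: near_eq_derivable dg.
exact/esym/near_eq_derive.
Qed.

Lemma is_derive1_0 f (x K : R) :
  (forall h, `|f (h + x) - f x| <= K * h ^+ 2) -> is_derive x 1 f 0.
Proof.
move=> H; apply: is_derive1_cvg.
have K0 : 0 <= K by have := le_trans (normr_ge0 _) (H 1); rewrite expr1n mulr1.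
apply/cvgrPdist_le => e e0; near=> h; rewrite sub0r normrN normrM.
have h0 : h != 0 by near: h; exact: nbhs_dnbhs_neq.
rewrite normfV ler_pdivrMl ?normr_gt0// (le_trans (H h))//.
rewrite -(real_normK (num_real h)) expr2 mulrCA ler_wpM2l//.
have hK : `|h| <= e / (K + 1).
  near: h; apply: dnbhs0_le; rewrite divr_gt0// ltr_wpDl//.
rewrite (le_trans (ler_wpM2l K0 hK))// mulrCA ger_pMr//.
by rewrite ler_pdivrMr ?mul1r ?lerDl// ltr_wpDl.
Unshelve. all: by end_near. Qed.

Lemma derive1E_is f (x l : R) : is_derive x 1 f l -> derive1 f x = l.
Proof. by rewrite derive1E => -[_ <-]. Qed.

(** Coinduction for smoothness: exhibiting a class stable under derivation replaces formulas for
    higher derivatives. Products, affine substitutions, [flat] and periodizations are all handled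
    this way. *)
Lemma smooth_class C : (forall f, C f -> exists2 f', C f' &
  forall s : R, is_derive s 1 f (f' s)) -> forall f, C f -> smooth f.
Proof.
move=> H f Cf n; elim: n f Cf => [|n ih] f Cf s; have [f' Cf' df] := H _ Cf.
  by have [] := df s.
rewrite derive1Sn (_ : derive1 f = f'); first exact: ih.
by apply/funext => t; exact: derive1E_is.
Qed.

Lemma smooth_is_derive f (s : R) : smooth f -> is_derive s 1 f (derive1 f s).
Proof. by move=> sf; rewrite derive1E; apply/derivableP; exact: (sf 0%N). Qed.

Lemma smooth_derive1 f : smooth f -> smooth (derive1 f).
Proof. by move=> sf n s; have := sf n.+1 s; rewrite derive1Sn. Qed.

Lemma smooth_prim f g : smooth g -> (forall s : R, is_derive s 1 f (g s)) -> smooth f.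
Proof.
move=> sg df; have E : derive1 f = g by apply/funext => s; exact: derive1E_is.
move=> [|n] s; first by have [] := df s.
by rewrite derive1Sn E; exact: sg.
Qed.

Lemma smooth_continuous f : smooth f -> continuous f.
Proof.
move=> sf s; apply: differentiable_continuous; apply/derivable1_diffP.
exact: (sf 0%N).
Qed.

Lemma smooth_cst (a : R) : smooth (fun=> a).
Proof.
apply: (@smooth_class [set f | exists a, f = fun=> a]); last by exists a.
by move=> _ [b ->]; exists (fun=> 0); [exists 0|move=> s; exact: is_derive_cst].
Qed.

(** Products of smooth functions are not stable under derivation, but their finite sums are, by
    Leibniz's rule; this is the class given to [smooth_class]. *)
Inductive prodsum : (R -> R) -> Prop :=
| prodsum_mul f g : smooth f -> smooth g -> prodsum (fun s => f s * g s)
| prodsum_add f g : prodsum f -> prodsum g -> prodsum (fun s => f s + g s).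

Lemma smooth_prodsum f : prodsum f -> smooth f.
Proof.
move=> Cf; apply: (@smooth_class prodsum _ _ Cf).
move=> {Cf} {}f; elim=> {f} [f g sf sg|f g _ [f' Cf' df] _ [g' Cg' dg]].
  exists (fun s => f s * derive1 g s + derive1 f s * g s).
    exact: (prodsum_add (prodsum_mul sf (smooth_derive1 sg)) (prodsum_mul (smooth_derive1 sf) sg)).
  move=> s.
  have -> : f s * derive1 g s + derive1 f s * g s = f s *: derive1 g s + g s *: derive1 f s.
    by rewrite /GRing.scale/= (mulrC (derive1 f s)).
  by apply: is_deriveM; exact: smooth_is_derive.
exists (fun s => f' s + g' s); first exact: (prodsum_add Cf' Cg').
by move=> s; exact: (is_deriveD (df s) (dg s)).
Qed.

Lemma smoothM f g : smooth f -> smooth g -> smooth (fun s => f s * g s).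
Proof. by move=> sf sg; exact: (smooth_prodsum (prodsum_mul sf sg)). Qed.

Lemma smoothD f g : smooth f -> smooth g -> smooth (fun s => f s + g s).
Proof.
move=> sf sg; apply: smooth_prodsum.
rewrite (_ : (fun s => _) = (fun s => f s * 1 + g s * 1)).
  have s1 := @smooth_cst 1.
 exact: (prodsum_add (prodsum_mul sf s1) (prodsum_mul sg s1)).
by apply/funext => s; rewrite !mulr1.
Qed.

Lemma smooth_affine f (a b : R) : smooth f -> smooth (fun s => f (a * s + b)).
Proof.
move=> sf; apply: (@smooth_class [set h | exists (c : R) g,
  smooth g /\ h = fun s => c * g (a * s + b)]); last first.
  by exists 1, f; split; [exact: sf|apply/funext => s; rewrite mul1r].
move=> _ [c [g [sg ->]]]; exists (fun s => (c * a) * derive1 g (a * s + b)).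
  by exists (c * a), (derive1 g); split; [exact: smooth_derive1|].
move=> s; have -> : c * a * derive1 g (a * s + b) = c *: (derive1 g (a * s + b) * a).
  by rewrite /GRing.scale/= mulrA mulrAC.
apply: is_deriveZ.
suff daff : is_derive s 1 (fun s => a * s + b) a.
  exact: (@is_derive1_comp _ g (fun s => a * s + b) s _ _ (smooth_is_derive _ sg) daff).
rewrite -[X in is_derive _ _ _ X]addr0; apply: is_deriveD.
rewrite -[X in is_derive _ _ _ X]mulr1; exact: is_deriveZ.
Qed.

Definition flat (p : {poly R}) (x : R) : R :=
  if 0 < x then p.[x^-1] * expR (- x^-1) else 0.

(** With [y = 1 / x], the exponential series gives [y ^+ (i + 2) <= (i + 2)! * expR y], hence
    [y ^+ i * expR (- y) <= (i + 2)! * x ^+ 2]. A quadratic bound makes the derivative at 0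
    vanish. *)
Lemma flat_bound (p : {poly R}) : exists K : R, forall x, `|flat p x| <= K * x ^+ 2.
Proof.
exists (\sum_(i < size p) `|p`_i| * (i.+2)`!%:R) => x; rewrite /flat.
case: ifPn => [x0|_]; last by rewrite normr0 mulr_ge0 ?sqr_ge0 ?sumr_ge0// => i _; rewrite mulr_ge0.
pose y := x^-1; rewrite -/y; have y0 : 0 < y by rewrite invr_gt0.
have xy : x = y^-1 by rewrite invrK.
rewrite normrM (ger0_norm (expR_ge0 _)) horner_coef (le_trans (ler_wpM2r (expR_ge0 _) (ler_norm_sum _ _ _)))//.
rewrite !mulr_suml; apply: ler_sum => i _.
rewrite normrM -!mulrA ler_wpM2l// normrX (ger0_norm (ltW y0)) expRN.
rewrite ler_pdivrMr ?expR_gt0// xy -mulrA [leRHS]mulrA.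
have := expR_ge1Dxn i.+1 (ltW y0) => h.
have -> : y ^+ i = y ^+ i.+2 * y^-1 ^+ 2.
  by rewrite exprVn -addn2 exprD mulfK// expf_neq0// gt_eqF.
rewrite [leRHS]mulrAC ler_wpM2r//; first by rewrite exprn_ge0// invr_ge0 ltW.
by rewrite mulrC -ler_pdivrMr ?ltr0n ?fact_gt0// (le_trans _ h)// lerDr.
Qed.

Lemma flat_derive (p : {poly R}) (x : R) :
  is_derive x 1 (flat p) (flat ('X^2 * (p - p^`())) x).
Proof.
have [x0|x0|->] := ltgtP x 0.
- rewrite {2}/flat ltNge (ltW x0)/=.
  have d0 : is_derive x 1 (fun=> 0 : R) (0 : R) by exact: is_derive_cst.
  apply: (is_derive1_near _ d0).
  by near=> y; rewrite /flat ltNge ltW//=; near: y; exact: lt_nbhsl.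
- rewrite {2}/flat x0.
  have dV : is_derive x 1 (fun y : R => y^-1) (- x ^- 2).
    rewrite -[X in is_derive _ _ _ X]mulr1.
    exact: (@is_deriveV _ _ _ 1 1 (lt0r_neq0 x0) (is_derive_id x 1)).
  have d1 : is_derive x 1 (fun y => p.[y^-1]) (p^`().[x^-1] * - x ^- 2).
    have dp := is_derive_poly p x^-1.
    exact: (@is_derive1_comp _ (horner p) (fun y => y^-1) x _ _ dp dV).
  have d2 : is_derive x 1 (fun y : R => expR (- y^-1)) (expR (- x^-1) * x ^- 2).
    have dNV : is_derive x 1 (fun y : R => - y^-1) (x ^- 2).
      by rewrite -[X in is_derive _ _ _ X]opprK; exact: (is_deriveN dV).
    exact: (@is_derive1_comp _ expR (fun y => - y^-1) x _ _ (is_derive_expR _) dNV).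
  suff d12 : is_derive x 1 (fun y => p.[y^-1] * expR (- y^-1))
      (('X^2 * (p - p^`())).[x^-1] * expR (- x^-1)).
    apply: (is_derive1_near _ d12).
    by near=> y; rewrite /flat ifT//; near: y; exact: lt_nbhsr.
  have := is_deriveM d1 d2; congr is_derive.
  rewrite /GRing.scale/= hornerM hornerD hornerN hornerXn exprVn; ring.
- rewrite {2}/flat ltxx; have [K HK] := flat_bound p.
  apply: (@is_derive1_0 _ _ K) => h; rewrite addr0 {2}/flat ltxx subr0.
  exact: HK.
Unshelve. all: by end_near. Qed.

Lemma smooth_flat p : smooth (flat p).
Proof.
apply: (@smooth_class [set f | exists p, f = flat p]); last by exists p.
move=> _ [q ->]; exists (flat ('X^2 * (q - q^`()))); first by eexists.
exact: flat_derive.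
Qed.

Definition bump (x : R) : R := flat 1 x * flat 1 (-1 * x + 1).

Lemma smooth_bump : smooth bump.
Proof.
exact: (smoothM (@smooth_flat 1) (@smooth_affine _ (-1) 1 (@smooth_flat 1))).
Qed.

Lemma flat1_ge0 x : 0 <= flat 1 x.
Proof. by rewrite /flat; case: ifP => // _; rewrite hornerC mul1r expR_ge0. Qed.

Lemma bump_ge0 x : 0 <= bump x.
Proof. by rewrite mulr_ge0 ?flat1_ge0. Qed.

Lemma bump_gt0 x : 0 < x < 1 -> 0 < bump x.
Proof.
move=> /andP[x0 x1]; rewrite /bump /flat x0 ifT; last by lra.
by rewrite !hornerC !mul1r mulr_gt0 ?expR_gt0.
Qed.

Lemma bump_out x : x <= 0 \/ 1 <= x -> bump x = 0.
Proof.
move=> [x0|x1]; rewrite /bump /flat; first by rewrite ltNge x0/= mul0r.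
by rewrite [X in _ * X]ifF ?mulr0//; apply/negbTE; rewrite -leNgt; lra.
Qed.

Lemma bump_le1 x : bump x <= 1.
Proof.
have H y : flat 1 y <= 1.
  rewrite /flat; case: ifPn => // y0; rewrite hornerC mul1r.
  by rewrite -expR0 ler_expR oppr_le0 invr_ge0 ltW.
by rewrite -[leRHS]mulr1 ler_pM ?flat1_ge0.
Qed.

End smooth_functions.

(** * Smooth steps and plateaus *)

Section smooth_step.
Context {R : realType}.
Notation leb := (@lebesgue_measure R).

Lemma measurable_smooth (f : R -> R) : smooth f ->
  measurable_fun setT (f : measurableTypeR R -> R).
Proof.
move=> sf; apply: continuous_measurable_fun; exact: smooth_continuous sf.
Qed.

Lemma integrable_bump : leb.-integrable setT (EFin \o @bump R).
Proof.
have m01 : measurable (`[0, 1]%classic : set (measurableTypeR R)) by exact: measurable_itv.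
have i01 : leb.-integrable `[0, 1] (EFin \o @bump R).
  apply: (@integrable_bnd _ _ _ _ _ 1) => //.
  - exact: lebesgue_itv_lty.
  - by apply: measurable_funTS; exact: (measurable_smooth (@smooth_bump R)).
  - by move=> x _; rewrite ger0_norm ?bump_ge0// bump_le1.
have := (@integrable_mkcond _ (measurableTypeR R) R leb _ (EFin \o @bump R) m01).1 i01.
congr integrable; apply/funext => t; rewrite patchE.
case: ifPn => //; rewrite notin_setE/= in_itv/= => /negP.
rewrite negb_and -!ltNge => /orP h.
by rewrite bump_out//; case: h => h; [left|right]; exact: ltW.
Qed.

Definition step0 (x : R) : R := \int[lebesgue_measure]_(t in `]-oo, x]) bump t.

Lemma step0_derive (x : R) : is_derive x 1 step0 (bump x).
Proof.
have ib : leb.-integrable `]-oo, x + 1] (EFin \o @bump R).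
  by apply: integrableS integrable_bump => //; exact: measurable_itv.
have x1 : x < x + 1 by rewrite ltrDl.
have Nyx : (BInfty R true < BRight x)%E by exact: ltNyr.
have [d1 d2] := @continuous_FTC1 R bump (BInfty R true) x (x + 1) x1 ib Nyx
  (@smooth_continuous _ _ (@smooth_bump R) x).
by apply: DeriveDef; [exact: d1|rewrite -derive1E; exact: d2].
Qed.

Lemma step0_cont (a b : R) : {within `[a, b], continuous step0}.
Proof.
apply: continuous_subspaceT => x; apply: differentiable_continuous.
by apply/derivable1_diffP; have [] := step0_derive x.
Qed.

Lemma step0_le0 x : x <= 0 -> step0 x = 0.
Proof.
move=> x0; rewrite /step0 (@eq_Rintegral _ _ _ _ _ (fun=> 0)).
  by rewrite Rintegral_cst ?mul0r//; exact: measurable_itv.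
by move=> t; rewrite inE/= in_itv/= => tx; rewrite bump_out//; left; exact: le_trans x0.
Qed.

Lemma step0_nd x y : x <= y -> step0 x <= step0 y.
Proof.
move=> xy; have [z _ e] := MVT_segment xy (fun z _ => step0_derive z) (@step0_cont x y).
by rewrite -subr_ge0 e mulr_ge0 ?bump_ge0 ?subr_ge0.
Qed.

Lemma step0_ge1 x : 1 <= x -> step0 x = step0 1.
Proof.
move=> x1; have [z + e] := MVT_segment x1 (fun z _ => step0_derive z) (@step0_cont 1 x).
rewrite in_itv/= => /andP[z1 _]; apply/eqP; rewrite -subr_eq0 e bump_out ?mul0r//.
by right.
Qed.

Lemma step01_gt0 : 0 < step0 1.
Proof.
have [z + e] := MVT ltr01 (fun z _ => step0_derive z) (@step0_cont 0 1).
rewrite in_itv/= => z01.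
by rewrite -[step0 1]subr0 -[X in _ - X](step0_le0 (lexx 0)) e subr0 mulr1 bump_gt0.
Qed.

Definition step (x : R) : R := (step0 1)^-1 * step0 x.

Definition dstep (x : R) : R := (step0 1)^-1 * bump x.

Lemma step_derive (x : R) : is_derive x 1 step (dstep x).
Proof. exact: (is_deriveZ _ (step0_derive x)). Qed.

Lemma smooth_dstep : smooth dstep.
Proof. exact: (smoothM (@smooth_cst R (step0 1)^-1) (@smooth_bump R)). Qed.

Lemma smooth_stepf : smooth step.
Proof. exact: (smooth_prim smooth_dstep step_derive). Qed.

Lemma step_le0 x : x <= 0 -> step x = 0.
Proof. by move=> x0; rewrite /step (step0_le0 x0) mulr0. Qed.

Lemma step_ge1 x : 1 <= x -> step x = 1.
Proof. by move=> x1; rewrite /step (step0_ge1 x1) mulVf// gt_eqF// step01_gt0. Qed.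

Lemma step_nd x y : x <= y -> step x <= step y.
Proof.
by move=> xy; rewrite /step ler_wpM2l ?step0_nd// invr_ge0 ltW// step01_gt0.
Qed.

Lemma step_ge0 x : 0 <= step x.
Proof.
have [x0|/ltW x0] := leP x 0; first by rewrite step_le0.
by rewrite -(step_le0 (lexx 0)) step_nd.
Qed.

Lemma step_le1 x : step x <= 1.
Proof.
have [x1|/ltW x1] := leP 1 x; first by rewrite step_ge1.
by rewrite -(step_ge1 (lexx 1)) step_nd.
Qed.

Lemma dstep_ge0 x : 0 <= dstep x.
Proof. by rewrite mulr_ge0 ?bump_ge0// invr_ge0 ltW// step01_gt0. Qed.

Lemma dstep_bound x : dstep x <= (step0 1)^-1.
Proof. by rewrite /dstep ler_piMr ?bump_le1// invr_ge0 ltW// step01_gt0. Qed.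

Lemma dstep_out x : x <= 0 \/ 1 <= x -> dstep x = 0.
Proof. by move=> h; rewrite /dstep bump_out// mulr0. Qed.

(* Smooth approximation of the indicator of ]a, b], rising on [a, a + r] and
   falling on [b, b + r]. *)
Definition plateau (a b r s : R) : R :=
  step (r^-1 * s + - (r^-1 * a)) + -1 * step (r^-1 * s + - (r^-1 * b)).

Definition dplateau (a b r s : R) : R :=
  r^-1 * dstep (r^-1 * s - r^-1 * a) - r^-1 * dstep (r^-1 * s - r^-1 * b).

Lemma smooth_plateau a b r : smooth (plateau a b r).
Proof.
have h c := @smooth_affine _ _ r^-1 (- (r^-1 * c)) smooth_stepf.
exact: (smoothD (h a) (smoothM (@smooth_cst R (-1)) (h b))).
Qed.

Lemma plateauE a b r s : plateau a b r s =
  step (r^-1 * (s - a)) - step (r^-1 * (s - b)).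
Proof. by rewrite /plateau mulN1r !mulrBr. Qed.

Lemma plateau_derive (a b r s : R) : is_derive s 1 (plateau a b r) (dplateau a b r s).
Proof.
have daff (d : R) : is_derive s 1 (fun s => r^-1 * s + - (r^-1 * d)) r^-1.
  rewrite -[X in is_derive _ _ _ X]addr0; apply: is_deriveD.
  rewrite -[X in is_derive _ _ _ X]mulr1; exact: is_deriveZ.
have h d : is_derive s 1 (fun s => step (r^-1 * s + - (r^-1 * d)))
    (r^-1 * dstep (r^-1 * s - r^-1 * d)).
  rewrite [X in is_derive _ _ _ X]mulrC.
  exact: (@is_derive1_comp _ step _ s _ _ (step_derive _) (daff d)).
have := is_deriveD (h a) (is_deriveZ (-1) (h b)).
by rewrite /dplateau scaleN1r.
Qed.

Lemma plateau_le (a b r s : R) : `|plateau a b r s| <= 1.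
Proof.
rewrite plateauE ler_norml.
have := step_ge0 (r^-1 * (s - a)); have := step_le1 (r^-1 * (s - a)).
have := step_ge0 (r^-1 * (s - b)); have := step_le1 (r^-1 * (s - b)).
by move=> ? ? ? ?; apply/andP; split; lra.
Qed.

Lemma plateau_left (a b r s : R) : 0 < r -> a <= b -> s <= a -> plateau a b r s = 0.
Proof.
move=> r0 ab sa; rewrite plateauE !step_le0 ?subr0//.
  by rewrite pmulr_rle0 ?invr_gt0// subr_le0 (le_trans sa).
by rewrite pmulr_rle0 ?invr_gt0// subr_le0.
Qed.

Lemma plateau_right (a b r s : R) : 0 < r -> a <= b -> b + r <= s -> plateau a b r s = 0.
Proof.
move=> r0 ab bs; rewrite plateauE !step_ge1 ?subrr//.
  by rewrite mulrC ler_pdivlMr// mul1r; lra.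
by rewrite mulrC ler_pdivlMr// mul1r; lra.
Qed.

Lemma plateau_mid (a b r s : R) : 0 < r -> a + r <= s -> s <= b -> plateau a b r s = 1.
Proof.
move=> r0 as_ sb; rewrite plateauE step_ge1 ?step_le0 ?subr0//.
  by rewrite pmulr_rle0 ?invr_gt0// subr_le0.
by rewrite mulrC ler_pdivlMr// mul1r; lra.
Qed.

End smooth_step.

(** * Periodic extension of smooth functions supported inside a period *)

Section periodization.
Context {R : realType}.
Variable l : R.
Hypothesis l0 : 0 < l.

Definition per (f : R -> R) (s : R) : R := f (s - l * (Num.floor (s / l))%:~R).

Definition supp_in (a b : R) (f : R -> R) := forall s, s < a \/ b < s -> f s = 0.

Lemma per_id f s : 0 <= s < l -> per f s = f s.
Proof.
move=> /andP[s0 sl]; rewrite /per (@floor_def _ _ 0) ?mulr0 ?subr0//.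
by rewrite divr_ge0 ?(ltW l0)//= ltr_pdivrMr// mul1r.
Qed.

Lemma per_periodic f (s : R) : per f (s + l) = per f s.
Proof.
rewrite /per (_ : Num.floor ((s + l) / l) = Num.floor (s / l) + 1).
  by congr f; rewrite intrD; ring.
apply: floor_def; have /andP[h1 h2] := floor_itv (s / l).
rewrite mulrDl mulfV ?gt_eqF//; move: h2; rewrite !intrD => h2.
by apply/andP; split; lra.
Qed.

Lemma supp_in_derive (a b : R) f : supp_in a b f -> smooth f -> supp_in a b (derive1 f).
Proof.
move=> sf smf s h; apply: derive1E_is.
have d0 : is_derive s 1 (fun=> 0 : R) (0 : R) by exact: is_derive_cst.
apply: (is_derive1_near _ d0).
case: h => h.
  by near=> t; apply: sf; left; near: t; exact: lt_nbhsl.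
by near=> t; apply: sf; right; near: t; exact: lt_nbhsr.
Unshelve. all: by end_near. Qed.

(** Near a multiple of [l] the number of periods subtracted may jump, but the support stays at
    distance [Num.min a (l - b)] from these multiples, so both expressions vanish there. *)
Lemma per_near (a b : R) f (s : R) : 0 < a -> b < l -> supp_in a b f ->
  {near s, per f =1 (fun t => f (t - l * (Num.floor (s / l))%:~R))}.
Proof.
move=> a0 bl sf; set n := Num.floor (s / l).
have ns : n%:~R * l <= s < (n + 1)%:~R * l.
  by have := floor_itv (s / l); rewrite ler_pdivlMr// ltr_pdivrMr.
pose d := Num.min a (l - b).
have d0 : 0 < d by rewrite lt_min a0 subr_gt0.
near=> t; rewrite /per.
have td : `|s - t| < d by near: t; apply: cvgr_dist_lt => //; exact: cvg_id.
have : d <= a by rewrite ge_min lexx.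
have : d <= l - b by rewrite ge_min lexx orbT.
set m := Num.floor (t / l) => d1 d2.
have mt : m%:~R * l <= t < (m + 1)%:~R * l.
  by have := floor_itv (t / l); rewrite ler_pdivlMr// ltr_pdivrMr.
move: td; rewrite ltr_norml => /andP[td1 td2].
move: ns mt; rewrite !intrD !mulrDl !mul1r => /andP[n1 n2] /andP[m1 m2].
have [mn|nm|->//] := ltgtP m n.
  have : (m + 1)%:~R * l <= n%:~R * l by rewrite ler_pM2r// ler_int lezD1.
  rewrite intrD mulrDl mul1r => mn'.
  rewrite !sf//; [left|right]; rewrite mulrC; lra.
have : (n + 1)%:~R * l <= m%:~R * l by rewrite ler_pM2r// ler_int lezD1.
rewrite intrD mulrDl mul1r => nm'.
by rewrite !sf//; [right|left]; rewrite mulrC; lra.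
Unshelve. all: by end_near. Qed.

Lemma per_derive (a b : R) f (s : R) : 0 < a -> b < l -> supp_in a b f -> smooth f ->
  is_derive s 1 (per f) (per (derive1 f) s).
Proof.
move=> a0 bl sf smf; set c := - (l * (Num.floor (s / l))%:~R).
have d1 : is_derive s 1 (fun t => f (t + c)) (derive1 f (s + c)).
  rewrite -[X in is_derive _ _ _ X]mulr1.
  apply: (@is_derive1_comp _ f (fun t => t + c) s _ _ (smooth_is_derive _ smf)).
  rewrite -[X in is_derive _ _ _ X]addr0; apply: is_deriveD.
by apply: (is_derive1_near _ d1); exact: per_near a0 bl sf.
Qed.

Lemma smooth_per (a b : R) f : 0 < a -> b < l -> supp_in a b f -> smooth f -> smooth (per f).
Proof.
move=> a0 bl sf smf.
apply: (@smooth_class _ [set h | exists f, [/\ supp_in a b f, smooth f & h = per f]]); last first.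
  by exists f; split; [exact: sf|exact: smf|].
move=> _ [h [sh smh ->]]; exists (per (derive1 h)).
  by exists (derive1 h); split; [exact: supp_in_derive|exact: smooth_derive1|].
by move=> s; exact: per_derive a0 bl sh smh.
Qed.

End periodization.

(** * Primitives of functions of bounded variation *)

Section clamp.
Context {R : realType}.

Definition clamp (l s : R) : R := Num.max 0 (Num.min s l).

Lemma clamp_itv l s : 0 <= l -> 0 <= clamp l s <= l.
Proof.
by move=> l0; rewrite /clamp le_max lexx/= ge_max l0/= ge_min lexx orbT.
Qed.

Lemma clamp_id l s : 0 <= s <= l -> clamp l s = s.
Proof. by move=> /andP[s0 sl]; rewrite /clamp min_l// max_r. Qed.

Lemma clamp_le (l x y : R) : x <= y -> 0 <= clamp l y - clamp l x <= y - x.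
Proof. by rewrite /clamp => xy; rewrite !maxEle !minEle; do !case: ifP; lra. Qed.

End clamp.

Section lipschitz_density.
Context {R : realType}.
Notation leb := (@lebesgue_measure R).
Variables (c : R -> R) (l K : R).
Hypotheses (l0 : 0 < l) (K0 : 0 <= K).
Hypothesis cK : forall a b, 0 <= a -> a <= b -> b <= l -> `|c b - c a| <= K * (b - a).

(** Adding [K * s] makes a [K]-Lipschitz function nondecreasing, and clamping extends it to the
    line, so that it has a Lebesgue-Stieltjes measure. *)
Definition monotone_ext (x : R) : R := c (clamp l x) + K * clamp l x.

Let monotone_ext_le x y : x <= y ->
  0 <= monotone_ext y - monotone_ext x <= 2 * K * (y - x).
Proof.
move=> xy; have /andP[h1 h2] := clamp_le l xy.
have /andP[x0 xl] := clamp_itv x (ltW l0); have /andP[y0 yl] := clamp_itv y (ltW l0).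
have := @cK (clamp l x) (clamp l y) x0 _ yl; rewrite -subr_ge0 => /(_ h1).
rewrite ler_norml /monotone_ext => /andP[h3 h4].
have h5 : K * (clamp l y - clamp l x) <= K * (y - x) by rewrite ler_wpM2l.
by apply/andP; split; lra.
Qed.

Let monotone_ext_nd : {homo monotone_ext : x y / x <= y}.
Proof. by move=> x y /monotone_ext_le/andP[]; rewrite subr_ge0. Qed.

Let monotone_ext_rc : right_continuous monotone_ext.
Proof.
apply: right_continuousW => x; apply/cvgrPdist_le => e e0; near=> y.
have H a b : a <= b -> `|monotone_ext b - monotone_ext a| <= 2 * K * `|b - a|.
  move=> ab; have /andP[h1 h2] := monotone_ext_le ab.
  by rewrite ger0_norm// ger0_norm ?subr_ge0.
have {}H : `|monotone_ext x - monotone_ext y| <= 2 * K * `|x - y|.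
  have [xy|/ltW yx] := leP x y; last exact: H.
  by rewrite distrC (distrC x); exact: H.
rewrite (le_trans H)//.
have xy : `|x - y| <= e / (2 * K + 1).
  near: y; apply: cvgr_dist_le; first exact: cvg_id.
  by rewrite divr_gt0// ltr_wpDl// mulr_ge0.
have K20 : 0 <= 2 * K by rewrite mulr_ge0.
rewrite (le_trans (ler_wpM2l K20 xy))// mulrCA ger_pMr//.
by rewrite ler_pdivrMr ?mul1r ?lerDl// ltr_wpDl.
Unshelve. all: by end_near. Qed.

HB.instance Definition _ := isCumulative.Build R _ R monotone_ext
  monotone_ext_nd monotone_ext_rc.

Let nu := lebesgue_stieltjes_measure monotone_ext.

Let nu_itv a b : a <= b -> nu `]a, b]%classic = (monotone_ext b - monotone_ext a)%:E.
Proof.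
move=> ab; rewrite /nu/= /lebesgue_stieltjes_measure/=.
rewrite /measure_extension measurable_mu_extE/=; last exact: is_ocitv.
by rewrite wlength_itv_bnd.
Qed.

(** An interval []x, y]] has measure at most [2 * K * (y - x)], so a cover of small total length has
    small measure. The factor [2 * K + 1] remains positive when [K = 0]. *)
Let nu_null A : measurable A -> @lebesgue_measure R A = 0%E -> nu A = 0%E.
Proof.
move=> mA A0; apply/eqP; rewrite eq_le measure_ge0 andbT.
apply/lee_addgt0Pr => e e0; rewrite add0e.
have K10 : 0 < 2 * K + 1 by rewrite ltr_wpDl// mulr_ge0.
have : (@lebesgue_measure R A < (e / (2 * K + 1))%:E)%E.
  by rewrite A0 lte_fin divr_gt0.
move=> /ereal_inf_lt[_ [B AB <-]] Be.
apply: (@le_trans _ _ (\sum_(0 <= k <oo) wlength monotone_ext (B k))%E).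
  by apply: ereal_inf_lbound; exists B.
apply: (@le_trans _ _ (\sum_(0 <= k <oo) (2 * K + 1)%:E * wlength idfun (B k))%E).
  apply: lee_nneseries => k _.
    by move=> _; exact: measure_ge0.
  have [mB _] := AB; have /ocitvP [->|[[x y]/= xy ->]] := mB k.
    by rewrite !wlength0 mule0.
  rewrite !(wlength_itv_bnd _ _ _ (ltW xy))/= -EFinM lee_fin.
  have /andP[h1 h2] := monotone_ext_le (ltW xy).
  by rewrite (le_trans h2)// ler_wpM2r ?lerDl// subr_ge0 ltW.
rewrite nneseriesZl; last by move=> k _; exact: measure_ge0.
apply: (@le_trans _ _ ((2 * K + 1)%:E * (e / (2 * K + 1))%:E)%E).
  by apply: lee_wpmul2l; [rewrite lee_fin ltW|exact: ltW].
by rewrite -EFinM lee_fin mulrCA mulfV ?mulr1// gt_eqF.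
Qed.

Let m0l : measurable (`]0, l]%classic : set (measurableTypeR R)).
Proof. exact: measurable_itv. Qed.

Let nul := mrestr nu m0l.

Let nul_fin : fin_num_fun nul.
Proof.
move=> U mU; rewrite ge0_fin_numE; last exact: measure_ge0.
rewrite /nul /mrestr; apply: (@le_lt_trans _ _ (nu `]0, l]%classic)).
  by apply: le_measure; rewrite ?inE//; exact: measurableI.
by rewrite nu_itv ?ltW// ltry.
Qed.

HB.instance Definition _ := Measure.on nul.
HB.instance Definition _ := Measure_isFinite.Build _ _ _ nul nul_fin.

Let nul_dom : nul `<< @lebesgue_measure R.
Proof.
apply/null_content_dominatesP => A mA A0.
rewrite /nul /mrestr; apply/eqP; rewrite eq_le measure_ge0 andbT -(nu_null mA A0).
by apply: le_measure; rewrite ?inE//; exact: measurableI.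
Qed.

(** Absolute continuity and almost everywhere differentiability of Lipschitz functions: the
    Stieltjes measure of [monotone_ext] has a Radon-Nikodym density, and Lebesgue differentiation of
    its integral recovers the derivative. *)
Lemma lipschitz_density : exists g : R -> R,
  [/\ measurable_fun setT (g : measurableTypeR R -> R),
    leb.-integrable setT (EFin \o g),
    forall t, 0 <= t <= l -> c t = c 0 + \int[lebesgue_measure]_(s in `[0, t]) g s &
    {ae @lebesgue_measure R, forall x, 0 < x < l -> is_derive x 1 c (g x)}].
Proof.
have [h [h0 hfin hint hE]] := radon_nikodym_sigma_finite nul_dom.
have hmeas := measurable_int _ hint.
(* Subtracting [K] undoes the tilt of [monotone_ext]. *)
pose g t := (fine (h t) - K) * \1_(`]0, l]%classic) t.
have mg : measurable_fun setT (g : measurableTypeR R -> R).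
  apply: measurable_funM; last by apply: measurable_indic.
  apply: measurable_funB; last exact: measurable_cst.
  exact: measurableT_comp.
have ih : leb.-integrable `]0, l] (EFin \o (fine \o h)).
  apply: (@eq_integrable _ _ _ _ _ m0l h) => [t _|].
    by rewrite /= fineK.
  exact: integrableS hint.
have l0l : (@lebesgue_measure R `]0%R, l]%classic < +oo)%E.
  exact: lebesgue_itv_lty.
have iK : leb.-integrable `]0, l] (EFin \o (fun=> K)).
  exact: (@integrable_bnd _ _ _ _ _ `|K|).
have ihK : leb.-integrable `]0, l] (EFin \o (fun t => fine (h t) - K)).
  exact: (integrableB m0l ih iK).
have ig : leb.-integrable setT (EFin \o g).
  have := (@integrable_mkcond _ (measurableTypeR R) R leb _ (fun t => (fine (h t) - K)%:E) m0l).1 ihK.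
  congr integrable; apply/funext => t; rewrite patchE /g/= indicE.
  by case: ifPn => _; rewrite ?mulr1 ?mulr0.
have gE t : 0 <= t <= l -> c t = c 0 + \int[lebesgue_measure]_(s in `[0, t]) g s.
  move=> /andP[t0 tl].
  have m0t : measurable (`]0, t]%classic : set (measurableTypeR R)) by exact: measurable_itv.
  have st : `]0, t] `<=` (`]0, l] : set R).
    by move=> x /=; rewrite !in_itv/= => /andP[-> /le_trans]; apply.
  have e : nul `]0, t]%classic = (monotone_ext t - monotone_ext 0)%:E.
    by rewrite /nul /mrestr setIidl// nu_itv.
  have : ((monotone_ext t - monotone_ext 0)%:E = \int[leb]_(s in `]0%R, t]) h s)%E.
    by rewrite -e; exact: hE.
  rewrite /monotone_ext !clamp_id ?t0 ?tl ?lexx ?ltW// => ht.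
  rewrite -[X in _ + X](_ : \int[lebesgue_measure]_(s in `]0, t]) (fine (h s) - K) = _).
    rewrite RintegralB//; [|exact: integrableS ih|exact: integrableS iK].
    rewrite Rintegral_cst//.
    rewrite (_ : \int[lebesgue_measure]_(s in `]0, t]) fine (h s) = c t + K * t - (c 0 + K * 0)).
      rewrite (_ : fine _ = t); first by ring.
      by rewrite -[RHS]subr0; exact: fine_lebesgue_itv.
    rewrite /Rintegral -[RHS]/(fine (_%:E)) ht; congr fine.
    by apply: eq_integral => s _; rewrite fineK.
  rewrite Rintegral_itv_obnd_cbnd; last first.
    exact: integrableS ihK.
  apply: ae_Rintegral_eq; exists [set 0]; split => //; first exact: lebesgue_measure_set1.
  move=> x /= ne; apply: contrapT => x0; apply: ne; rewrite in_itv/= => /andP[x0' xt].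
  rewrite /g indicE mem_set ?mulr1//= in_itv/= (le_trans xt tl) andbT lt_neqAle x0' andbT.
  by rewrite eq_sym; apply/eqP.
exists g; split => //.
have locg : locally_integrable setT g.
  by apply: open_integrable_locally => //; exact: openT.
have iy y : leb.-integrable [set` Interval (BLeft 0) (BRight y)] (EFin \o g).
  by apply: integrableS ig => //; exact: measurable_itv.
have := @FTC1 R g (BLeft 0) iy locg.
move=> [N [mN N0 HN]]; exists N; split => // x /= ne; apply: HN => /= H.
apply: ne => /andP[x0 xl]; have [] := H; first by rewrite lte_fin.
move=> dF FE; suff d0 : is_derive x 1 (fun y => c 0 + \int[leb]_(t in `[0, y]) g t) (g x).
  apply: (is_derive1_near _ d0).
  near=> y; apply: gE; apply/andP; split; apply/ltW; near: y.
    exact: lt_nbhsr.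
  exact: lt_nbhsl.
rewrite -[X in is_derive _ _ _ X]add0r; apply: is_deriveD.
by apply: DeriveDef; [exact: dF|rewrite -derive1E; exact: FE].
Unshelve. all: by end_near. Qed.

End lipschitz_density.

(** * Euclidean geometry of space *)

Section euclid.
Context {R : realType}.
Implicit Types (u v w : 'rV[R]_3) (a b : R).

Lemma dotE u v : dot u v = u 0 0 * v 0 0 + u 0 1 * v 0 1 + u 0 2%:R * v 0 2%:R.
Proof.
rewrite /dot !big_ord_recl big_ord0 addr0 addrA; congr (_ + _ + _);
  by congr (_ * _); congr (fun_of_matrix _ _ _); exact/val_inj.
Qed.

Lemma dotC u v : dot u v = dot v u.
Proof. by apply: eq_bigr => k _; rewrite mulrC. Qed.

Lemma dotDl u v w : dot (u + v) w = dot u w + dot v w.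
Proof. by rewrite -big_split; apply: eq_bigr => k _; rewrite mxE mulrDl. Qed.

Lemma dotZl a u v : dot (a *: u) v = a * dot u v.
Proof. by rewrite /dot mulr_sumr; apply: eq_bigr => k _; rewrite mxE mulrA. Qed.

Lemma dotDr u v w : dot w (u + v) = dot w u + dot w v.
Proof. by rewrite dotC dotDl !(dotC w). Qed.

Lemma dotZr a u v : dot v (a *: u) = a * dot v u.
Proof. by rewrite dotC dotZl dotC. Qed.

Lemma dotNl u v : dot (- u) v = - dot u v.
Proof. by rewrite -scaleN1r dotZl mulN1r. Qed.

Lemma dotNr u v : dot u (- v) = - dot u v.
Proof. by rewrite dotC dotNl dotC. Qed.

Lemma dotBl u v w : dot (u - v) w = dot u w - dot v w.
Proof. by rewrite dotDl dotNl. Qed.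

Lemma dotBr u v w : dot w (u - v) = dot w u - dot w v.
Proof. by rewrite dotDr dotNr. Qed.

Lemma dot0l u : dot 0 u = 0.
Proof. by rewrite -(scale0r 0) dotZl mul0r. Qed.

Lemma dot_delta u k : dot u (delta_mx 0 k) = u 0 k.
Proof.
rewrite /dot (bigD1 k)//= mxE !eqxx mulr1 big1 ?addr0// => j jk.
by rewrite mxE eqxx (negbTE jk) mulr0.
Qed.

Lemma dot_ge0 u : 0 <= dot u u.
Proof. by apply: sumr_ge0 => k _; rewrite -expr2 sqr_ge0. Qed.

Lemma dot_eq0 u : dot u u = 0 -> u = 0.
Proof.
move=> h; apply/rowP => k; apply/eqP; rewrite mxE -sqrf_eq0 expr2; apply/eqP.
have h' : \sum_(k < 3) u 0 k * u 0 k = 0 by exact: h.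
by move/psumr_eq0P : h'; apply => // i _; rewrite -expr2 sqr_ge0.
Qed.

Lemma enorm_ge0 u : 0 <= enorm u. Proof. exact: sqrtr_ge0. Qed.

Lemma sqr_enorm u : enorm u ^+ 2 = dot u u.
Proof. by rewrite sqr_sqrtr// dot_ge0. Qed.

Lemma enorm0 : enorm (0 : 'rV[R]_3) = 0.
Proof. by rewrite /enorm dot0l sqrtr0. Qed.

Lemma enorm_gt0 u : u != 0 -> 0 < enorm u.
Proof.
move=> u0; rewrite lt_neqAle enorm_ge0 andbT eq_sym; apply: contraNN u0 => /eqP h.
by apply/eqP/dot_eq0; rewrite -sqr_enorm h expr0n.
Qed.

Lemma enormZ a u : enorm (a *: u) = `|a| * enorm u.
Proof. by rewrite /enorm dotZl dotZr mulrA -expr2 sqrtrM ?sqr_ge0// sqrtr_sqr. Qed.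

Lemma enormN u : enorm (- u) = enorm u.
Proof. by rewrite -scaleN1r enormZ normrN normr1 mul1r. Qed.

Lemma enormB u v : enorm (u - v) = enorm (v - u).
Proof. by rewrite -enormN opprB. Qed.

(** Lagrange's identity: the difference of the two sides is the squared norm of the cross
    product. *)
Lemma sqr_dot_le u v : dot u v ^+ 2 <= dot u u * dot v v.
Proof.
rewrite !dotE; set a := u 0 0; set b := u 0 1; set c := u 0 2%:R.
set d := v 0 0; set e := v 0 1; set f := v 0 2%:R.
rewrite -subr_ge0 [X in 0 <= X](_ : _ = (a * e - b * d) ^+ 2 + (a * f - c * d) ^+ 2
  + (b * f - c * e) ^+ 2); last by ring.
by rewrite !addr_ge0 ?sqr_ge0.
Qed.

Lemma cauchy_schwarz u v : `|dot u v| <= enorm u * enorm v.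
Proof.
rewrite -(@ler_pXn2r _ 2)// ?nnegrE ?mulr_ge0 ?enorm_ge0//.
by rewrite real_normK ?num_real// exprMn !sqr_enorm sqr_dot_le.
Qed.

Lemma dot_le u v : dot u v <= enorm u * enorm v.
Proof. exact: le_trans (ler_norm _) (cauchy_schwarz _ _). Qed.

Lemma enormD u v : enorm (u + v) <= enorm u + enorm v.
Proof.
rewrite -(@ler_pXn2r _ 2)// ?nnegrE ?addr_ge0 ?enorm_ge0//.
rewrite sqr_enorm sqrrD !sqr_enorm dotDl !dotDr (dotC v u).
have := dot_le u v; lra.
Qed.

Lemma enorm_dist u v : `|enorm u - enorm v| <= enorm (u - v).
Proof.
have h1 := enormD (u - v) v; have h2 := enormD (v - u) u.
rewrite subrK in h1; rewrite subrK enormB in h2.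
by rewrite ler_norml; apply/andP; split; lra.
Qed.

Lemma coord_le_enorm u k : `|u 0 k| <= enorm u.
Proof.
have h := cauchy_schwarz u (delta_mx 0 k); rewrite dot_delta in h.
apply: le_trans h _; rewrite /enorm [X in _ * Num.sqrt X]dot_delta.
by rewrite mxE !eqxx sqrtr1 mulr1.
Qed.

Lemma enorm_le_sum u : enorm u <= \sum_(k < 3) `|u 0 k|.
Proof.
rewrite -(@ler_pXn2r _ 2)// ?nnegrE ?enorm_ge0 ?sumr_ge0// sqr_enorm dotE.
rewrite !big_ord_recl big_ord0 addr0.
have -> : lift ord0 ord0 = 1 :> 'I_3 by exact/val_inj.
have -> : lift ord0 (lift ord0 ord0) = 2%:R :> 'I_3 by exact/val_inj.
rewrite -!expr2 -[u 0 0 ^+ 2]real_normK ?num_real// -[u 0 1 ^+ 2]real_normK ?num_real//.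
rewrite -[u 0 2%:R ^+ 2]real_normK ?num_real//.
have := normr_ge0 (u 0 0); have := normr_ge0 (u 0 1); have := normr_ge0 (u 0 2%:R).
nra.
Qed.

(* The norm is convex and its derivative at [d] in the direction [e] is
   [<e, d> / |d|], so it lies above its tangent. *)
Lemma enorm_tangent_le (d e : 'rV[R]_3) t : d != 0 -> enorm d + t * (dot e d / enorm d) <= enorm (d + t *: e).
Proof.
move=> d0; have n0 := enorm_gt0 d0.
rewrite -(ler_pM2r n0) mulrDl -expr2 sqr_enorm -!mulrA mulVf ?gt_eqF// mulr1.
by apply: le_trans (dot_le _ _); rewrite dotDl dotZl.
Qed.

End euclid.

Lemma indic_eq (T U : Type) (R : realType) (A : set T) (B : set U) x y :
  (A x <-> B y) -> \1_A x = \1_B y :> R.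
Proof.
move=> AB; rewrite !indicE; congr (nat_of_bool _)%:R.
by apply/idP/idP => /set_mem h; apply/mem_set/AB.
Qed.

Section integral_tools.
Context {R : realType}.
Notation leb := (@lebesgue_measure R).

Lemma Rdominated_cvg d (T : measurableType d) (mu : {measure set T -> \bar R}) D
    (f_ : nat -> T -> R) (f : T -> R) (K : R) :
  measurable D -> (mu D < +oo)%E ->
  (forall n, measurable_fun D (f_ n)) ->
  (forall n x, D x -> `|f_ n x| <= K) ->
  (forall x, D x -> f_ n x @[n --> \oo] --> f x) ->
  \int[mu]_(x in D) f_ n x @[n --> \oo] --> \int[mu]_(x in D) f x.
Proof.
move=> mD Dfin mf fK ff.
have mf' : measurable_fun D f by apply: measurable_fun_cvg ff.
have iK : mu.-integrable D (EFin \o (fun=> K)).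
  exact: (@integrable_bnd _ _ _ _ _ `|K|).
have h1 n : measurable_fun D (EFin \o f_ n) by exact/measurable_EFinP.
have h2 : measurable_fun D (EFin \o f) by exact/measurable_EFinP.
have h3 : {ae mu, forall x, D x -> (EFin \o f_ n) x @[n --> \oo] --> (EFin \o f) x}.
  apply: aeW => x Dx; apply/fine_cvgP; split; first by near=> n.
  exact: ff.
have h4 : {ae mu, forall x n, D x -> (`|(EFin \o f_ n) x| <= (EFin \o (fun=> K)) x)%E}.
  by apply: aeW => x n Dx; rewrite /= lee_fin fK.
have [i_f _ H] := dominated_convergence mD h1 h2 h3 iK h4.
have fin := integrable_fin_num mD i_f.
by move: H; rewrite -(fineK fin) => /fine_cvg.
Unshelve. all: by end_near. Qed.

Lemma Rint_derive (F f : R -> R) (a b : R) : a <= b ->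
  (forall x : R, is_derive x 1 F (f x)) -> continuous f ->
  \int[leb]_(x in `[a, b]) f x = F b - F a.
Proof.
rewrite le_eqVlt => /predU1P[<- _ _|ab dF cf].
  by rewrite subrr set_itv1 Rintegral_set1.
rewrite /Rintegral (@continuous_FTC2 _ f F a b ab) => //.
- exact: continuous_subspaceT.
- have cF : continuous F.
    move=> x; apply: differentiable_continuous; apply/derivable1_diffP.
    by have [] := dF x.
  split => [x _||].
  + by have [] := dF x.
  + exact: cvg_at_right_filter (cF a).
  + exact: cvg_at_left_filter (cF b).
- by move=> x _; exact: derive1E_is.
Qed.

Lemma continuous_itv_bounded (f : R -> R) (a b : R) : {within `[a, b], continuous f} ->
  exists K : R, forall x, a <= x <= b -> `|f x| <= K.
Proof.
move=> cf; have [ab|ba] := leP a b; last first.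
  by exists 0 => x /andP[ax xb]; have := le_trans ax xb; rewrite leNgt ba.
have [c1 _ h1] := EVT_max ab cf; have [c2 _ h2] := EVT_min ab cf.
exists (`|f c1| + `|f c2|) => x axb; rewrite ler_norml.
have xab : x \in `[a, b] by rewrite in_itv.
have := h1 x xab; have := h2 x xab => h3 h4.
have := ler_norm (f c1); have := ler_normlW (lexx `|- f c2|); rewrite normrN.
have := normr_ge0 (f c1); have := normr_ge0 (f c2) => ? ? ? ?.
by apply/andP; split; lra.
Qed.

End integral_tools.

(** * Distribution functions on an open interval *)

Section cumulative.
Context {R : realType}.
Notation leb := (@lebesgue_measure R).
Variables (m : {finite_measure set (MR R) -> \bar R}) (l : R).

(** Distribution function of the restriction of [m] to the open interval: atoms at 0 and [l] are
    left out, since the ends of an arc are treated separately. *)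
Definition cum (s : R) : R := fine (m (`]-oo, s]%classic `&` `]0, l[%classic)).

Let m0l : measurable (`]0, l[%classic : set (MR R)).
Proof. exact: measurable_itv. Qed.

Lemma cum_sub a b : 0 <= a -> a <= b -> b < l ->
  cum b - cum a = fine (m `]a, b]%classic).
Proof.
move=> a0 ab bl; have mS s : measurable (`]-oo, s]%classic `&` `]0, l[%classic : set (MR R)).
  by apply: measurableI => //; exact: measurable_itv.
have mab : measurable (`]a, b]%classic : set (MR R)) by exact: measurable_itv.
rewrite /cum (_ : `]-oo, b]%classic `&` `]0, l[%classic =
  (`]-oo, a]%classic `&` `]0, l[%classic) `|` `]a, b]%classic); last first.
  apply/seteqP; split => x /=; rewrite !in_itv/=.
    move=> [xb /andP[x0 xl]]; have [xa|ax] := leP x a; first by left; split => //; apply/andP.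
    by right.
  move=> [[xa /andP[x0 xl]]|/andP[ax xb]]; split.
  - exact: le_trans ab.
  - by apply/andP.
  - exact: xb.
  - by rewrite (le_lt_trans a0 ax) (le_lt_trans xb bl).
rewrite measureU//; last first.
  apply/seteqP; split => x //=; rewrite !in_itv/= => -[[xa _] /andP[ax _]].
  by move: ax; rewrite ltNge xa.
by rewrite fineD ?fin_num_measure// addrC addKr.
Qed.

Lemma cum_nd a b : a <= b -> cum a <= cum b.
Proof.
move=> ab; have mS s : measurable (`]-oo, s]%classic `&` `]0, l[%classic : set (MR R)).
  by apply: measurableI => //; exact: measurable_itv.
apply: fine_le; rewrite ?fin_num_measure//.
apply: le_measure; rewrite ?inE//; apply: setSI => x /=; rewrite !in_itv/=.
by move=> /le_trans; apply.
Qed.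

Lemma cum_bounds s : 0 <= cum s <= fine (m `]0, l[%classic).
Proof.
have mS : measurable (`]-oo, s]%classic `&` `]0, l[%classic : set (MR R)).
  by apply: measurableI => //; exact: measurable_itv.
rewrite fine_ge0//=; apply: fine_le; rewrite ?fin_num_measure//.
by apply: le_measure; rewrite ?inE//; exact: subIsetr.
Qed.

Lemma measurable_cum : measurable_fun setT (cum : MR R -> R).
Proof. exact: (@nondecreasing_measurable R setT cum measurableT (fun x y h => cum_nd h)). Qed.

(** The intervals []0, l / (n + 2)]] decrease to the empty set, so their masses tend to 0. *)
Lemma cum_right (e : R) : 0 < e -> 0 < l -> exists2 d : R, 0 < d < l & cum d <= e.
Proof.
move=> e0 l0.
pose F n := `]-oo, (l / n.+2%:R)]%classic `&` `]0, l[%classic : set (MR R).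
have mF n : measurable (F n) by apply: measurableI => //; exact: measurable_itv.
have F0 : \bigcap_n F n = set0.
  apply/seteqP; split => // x /= Fx.
  have [_] := Fx 0%N I; rewrite /= in_itv/= => /andP[x0 _].
  have [+ _] := Fx (Num.truncn (l / x)) I; rewrite /= in_itv/=.
  rewrite ler_pdivlMr ?ltr0n// leNgt => /negP; apply.
  have := truncnS_gt (l / x); rewrite ltr_pdivrMr// => /lt_trans; apply.
  by rewrite mulrC ltr_pM2l// ltr_nat.
have niF : nonincreasing_seq F.
  move=> n p np; apply/subsetPset; apply: setSI => x /=; rewrite !in_itv/= => /le_trans; apply.
  by rewrite ler_pM2l// lef_pV2 ?posrE ?ltr0n// ler_nat.
have := @nonincreasing_cvg_mu _ _ _ m F (finite_measure_lty m (mF 0%N)) mF.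
rewrite F0 measure0 => /(_ measurable0 niF) /fine_cvg /cvgrPdist_le /(_ _ e0)[n _ H].
have := H n (leqnn n); rewrite /= sub0r normrN => h.
exists (l / n.+2%:R).
  by rewrite divr_gt0 ?ltr0n//= ltr_pdivrMr ?ltr0n// ltr_pMr// ltr1n.
exact: le_trans (ler_norm _) h.
Qed.

(** The intervals []0, l - l / (n + 2)]] increase to []0, l[], so their masses exhaust it. *)
Lemma cum_left (e : R) : 0 < e -> 0 < l ->
  exists2 d : R, 0 < d < l & fine (m `]0, l[%classic) - e <= cum (l - d).
Proof.
move=> e0 l0.
pose F n := `]-oo, (l - l / n.+2%:R)]%classic `&` `]0, l[%classic : set (MR R).
have mF n : measurable (F n) by apply: measurableI => //; exact: measurable_itv.
have F0 : \bigcup_n F n = `]0, l[%classic.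
  apply/seteqP; split => [x [n _ []]//|x /= xl].
  move: (xl); rewrite in_itv/= => /andP[x0 xl'].
  exists (Num.truncn (l / (l - x))) => //; split => //; rewrite /= in_itv/=.
  have lx : 0 < l - x by rewrite subr_gt0.
  rewrite lerBrDl -lerBrDr ler_pdivrMr ?ltr0n//.
  have := truncnS_gt (l / (l - x)); rewrite ltr_pdivrMr// mulrC => /ltW/le_trans; apply.
  by rewrite ler_pM2l// ler_nat.
have ndF : nondecreasing_seq F.
  move=> n p np; apply/subsetPset; apply: setSI => x /=; rewrite !in_itv/= => /le_trans; apply.
  by rewrite lerD2l lerN2 ler_pM2l// lef_pV2 ?posrE ?ltr0n// ler_nat.
have mU : measurable (\bigcup_n F n) by exact: bigcupT_measurable.
have fm : m `]0, l[%classic = (fine (m `]0, l[%classic))%:E.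
  by rewrite fineK// fin_num_measure.
have c1 : m (F n) @[n --> \oo] --> (fine (m `]0, l[%classic))%:E.
  by rewrite -fm -F0; exact: nondecreasing_cvg_mu mF mU ndF.
have [n _ H] := (cvgrPdist_le _ _).1 (fine_cvg c1) _ e0.
have := H n (leqnn n); rewrite /= => h.
exists (l / n.+2%:R).
  by rewrite divr_gt0 ?ltr0n//= ltr_pdivrMr ?ltr0n// ltr_pMr// ltr1n.
by have := le_trans (ler_norm _) h; rewrite lerBlDr addrC -lerBlDr.
Qed.

(** Fubini's theorem for [psi s] times the indicator of [u <= s], with Lebesgue measure in [s] and
    [m] in [u]; integrating the indicator in [u] gives [cum m l s]. *)
Lemma fubini_cum (psi : R -> R) (K : R) : measurable_fun setT (psi : MR R -> R) ->
  (forall x, `|psi x| <= K) ->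
  \int[leb]_(s in `[0, l]) (psi s * cum s) =
  \int[m]_(u in `]0, l[) \int[leb]_(s in `[u, l]) psi s.
Proof.
move=> mpsi psiK.
have m0lc : measurable (`[0, l]%classic : set (MR R)) by exact: measurable_itv.
pose L : {finite_measure set (MR R) -> \bar R} := lebesgue_0 false l.
pose N : {finite_measure set (MR R) -> \bar R} := mrestr m m0l.
pose E : set (MR R * MR R)%type := [set z | z.2 <= z.1].
have mE : measurable E.
  rewrite (_ : E = (fun z : (MR R * MR R)%type => z.1 - z.2) @^-1` `[0, +oo[%classic).
    rewrite -[X in measurable X]setTI.
    have mf : measurable_fun setT (fun z : (MR R * MR R)%type => z.1 - z.2).
      by apply: measurable_funB; [exact: measurable_fst|exact: measurable_snd].
    by apply: mf => //; exact: measurable_itv.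
  by apply/seteqP; split => z; rewrite /E/= in_itv/= andbT subr_ge0.
pose f (z : (MR R * MR R)%type) : R := psi z.1 * \1_E z.
have Ef (s u : R) : f (s, u) = psi s * (u <= s)%R%:R.
  rewrite /f indicE; congr (_ * (nat_of_bool _)%:R).
  by apply/idP/idP => [/set_mem|h]//; exact/mem_set.
have mf : measurable_fun setT f.
  apply: measurable_funM; last exact: measurable_indic.
  by apply: (measurableT_comp mpsi); exact: measurable_fst.
have LN : ((L \x N) setT < +oo)%E.
  rewrite -setXTT product_measure1E//.
  have : (L setT * N setT)%E \is a fin_num by rewrite fin_numM// fin_num_measure.
  by rewrite ge0_fin_numE// mule_ge0.
have intf : (L \x N)%E.-integrable setT (EFin \o f).
  apply: (@integrable_bnd _ _ _ _ _ K) => // z _.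
  rewrite /f normrM indicE; case: (_ \in _); rewrite ?normr1 ?mulr1 ?normr0 ?mulr0//.
  exact: le_trans (normr_ge0 _) (psiK 0).
have := Fubini intf.
have -> : (\int[L]_s \int[N]_u (EFin \o f) (s, u) =
   \int[leb]_(s in `[0%R, l]) (psi s * cum s)%:E)%E.
  rewrite [LHS]integral_mrestr; apply: eq_integral => s _.
  have mS : measurable (`]-oo, s]%classic : set (MR R)) by exact: measurable_itv.
  under eq_integral do rewrite /= /f/= EFinM.
  rewrite integralZl//; last first.
    apply: (@integrable_fin_bnd _ _ _ _ _ 1) => //.
      rewrite (_ : (fun x => _) = \1_(`]-oo, s]%classic)).
        exact: measurable_indic.
      by apply/funext => u; apply: indic_eq; rewrite /E/= in_itv.
    by move=> u _; rewrite indicE; case: (_ \in _); rewrite ?normr1 ?normr0.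
  rewrite EFinM; congr (_ * _)%E.
  rewrite (_ : (fun x => _) = (EFin \o \1_(`]-oo, s]%classic))).
    rewrite integral_indic// setIT /cum fineK ?fin_num_measure//.
    exact: measurableI.
  by apply/funext => u /=; congr (_%:E); apply: indic_eq; rewrite /E/= in_itv.
have -> : (\int[N]_u \int[L]_s (EFin \o f) (s, u) =
   \int[m]_(u in `]0%R, l[) (\int[leb]_(s in `[u, l]) psi s)%:E)%E.
  rewrite [LHS]integral_mrestr; apply: eq_integral => u; rewrite inE/= in_itv/= => /andP[u0 ul].
  rewrite integral_mrestr [LHS]integral_mkcond.
  have mu : measurable (`[u, l]%classic : set (MR R)) by exact: measurable_itv.
  rewrite fineK; last first.
    apply: integrable_fin_num => //.
    apply: (@integrable_bnd _ _ _ _ _ K) => //; first exact: lebesgue_itv_lty.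
    exact: measurable_funTS.
  rewrite [RHS]integral_mkcond; apply: eq_integral => s _.
  rewrite !patchE Ef !mem_setE !in_itv/=.
  have [us|su] := leP u s; last by rewrite mulr0; case: ifP.
  by rewrite mulr1 (le_trans (ltW u0) us).
move=> h; exact: (congr1 fine h).
Qed.
End cumulative.

(** * Du Bois-Reymond's lemma *)

Section du_bois_reymond.
Context {R : realType}.
Notation leb := (@lebesgue_measure R).
Variables (g : R -> R) (l : R).
Hypotheses (mg : measurable_fun setT (g : MR R -> R))
  (ig : leb.-integrable setT (EFin \o g)) (l0 : 0 < l).

(** One half of a plateau's derivative: [dplateau a b r] is [mollifier a r] minus
    [mollifier b r]. *)
Definition mollifier (a r s : R) : R := r^-1 * dstep (r^-1 * s - r^-1 * a).

Lemma mollifier_ge0 a r s : 0 < r -> 0 <= mollifier a r s.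
Proof. by move=> r0; rewrite mulr_ge0 ?dstep_ge0// invr_ge0 ltW. Qed.

Lemma continuous_mollifier a r : continuous (mollifier a r).
Proof.
apply: smooth_continuous.
exact: (smoothM (@smooth_cst R r^-1) (@smooth_affine _ _ r^-1 (- (r^-1 * a)) smooth_dstep)).
Qed.

Lemma mollifier_out a r s : 0 < r -> s <= a \/ a + r <= s -> mollifier a r s = 0.
Proof.
move=> r0 h; rewrite /mollifier dstep_out ?mulr0// -mulrBr.
case: h => h; [left|right].
  by rewrite pmulr_rle0 ?invr_gt0// subr_le0.
by rewrite mulrC ler_pdivlMr// mul1r; lra.
Qed.

Lemma mollifier_le a r s : 0 < r -> mollifier a r s <= r^-1 * (step0 1)^-1.
Proof. by move=> r0; rewrite ler_wpM2l ?dstep_bound// invr_ge0 ltW. Qed.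

Lemma mollifier_int (a r : R) : 0 < r -> 0 < a -> a + r < l ->
  \int[leb]_(s in `[0, l]) mollifier a r s = 1.
Proof.
move=> r0 a0 arl.
have dS (s : R) : is_derive s 1 (fun s => step (r^-1 * s + - (r^-1 * a))) (mollifier a r s).
  rewrite /mollifier [X in is_derive _ _ _ X]mulrC.
  apply: (@is_derive1_comp _ step _ s _ _ (step_derive _)).
  rewrite -[X in is_derive _ _ _ X]addr0; apply: is_deriveD.
  rewrite -[X in is_derive _ _ _ X]mulr1; exact: is_deriveZ.
rewrite (Rint_derive (ltW l0) dS (@continuous_mollifier a r)).
rewrite step_ge1 ?step_le0 ?subr0//.
  by rewrite -mulrBr pmulr_rle0 ?invr_gt0// sub0r oppr_le0 ltW.
by rewrite -mulrBr mulrC ler_pdivlMr// mul1r; lra.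
Qed.

Lemma measurable_mollifier a r : measurable_fun setT (mollifier a r : MR R -> R).
Proof. apply: continuous_measurable_fun; exact: continuous_mollifier. Qed.

Let m0l : measurable (`[0, l]%classic : set (MR R)).
Proof. exact: measurable_itv. Qed.

Lemma integrable_mollifier a r (f : R -> R) : 0 < r ->
  leb.-integrable `[0, l] (EFin \o f) ->
  leb.-integrable `[0, l] (EFin \o (fun s => f s * mollifier a r s)).
Proof.
move=> r0 i_f.
have bm : [bounded mollifier a r x | x in (`[0, l]%classic : set (MR R))].
  exists (r^-1 * (step0 1)^-1); split; first exact: num_real.
  move=> x xK y _ /=; rewrite ger0_norm ?mollifier_ge0//.
  exact: le_trans (mollifier_le _ _ r0) (ltW xK).
have mm := measurable_funTS (measurable_mollifier a r) : measurable_fun (`[0, l]%classic : set (MR R)) _.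
have := integrableMl m0l i_f mm bm.
by congr integrable.
Qed.

(** The mollifier has integral 1, lives in the ball of radius [r n] about [a] and is bounded by a
    constant over the length of that ball. The error is thus at most [C] times the mean of
    [|g - g a|] over the ball, which tends to 0 at a Lebesgue point even though the kernel is
    one-sided. *)
Lemma mollifier_lebesgue_pt a (r : nat -> R) : 0 < a -> a < l ->
  lebesgue_pt g a -> (forall n, 0 < r n) -> (forall n, a + r n < l) ->
  r n @[n --> \oo] --> 0 ->
  \int[leb]_(s in `[0, l]) (g s * mollifier a (r n) s) @[n --> \oo] --> g a.
Proof.
move=> a0 al ga r0 arl rcvg.
(* Chosen so that the bound of the mollifier is [C / (2 * r n)], where [2 * r n] is the length of
   the ball. *)
pose C := 2 * (step0 1)^-1 : R.
have C0 : 0 < C by rewrite mulr_gt0 ?invr_gt0 ?step01_gt0.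
have ic (k : R) : leb.-integrable `[0, l] (EFin \o (fun=> k)).
  by apply: (@integrable_bnd _ _ _ _ _ `|k|) => //; exact: lebesgue_itv_lty.
have igl : leb.-integrable `[0, l] (EFin \o g) by exact: integrableS ig.
have H n : (`|\int[leb]_(s in `[0, l]) (g s * mollifier a (r n) s) - g a|%:E <=
    C%:E * davg g a (r n))%E.
  have rn0 := r0 n.
  have Cr0 : 0 < C / (r n *+ 2) by rewrite divr_gt0// pmulrn_lgt0.
  rewrite -[X in _ - X]mulr1 -(mollifier_int rn0 a0 (arl n)) -RintegralZl//; last first.
    have := integrable_mollifier a rn0 (ic 1).
    by congr integrable; apply/funext => s /=; rewrite mul1r.
  rewrite -RintegralB//; [|exact: integrable_mollifier..].
  have ik : leb.-integrable `[0, l] (EFin \o (fun s => (g s - g a) * mollifier a (r n) s)).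
    apply: integrable_mollifier => //.
    by have := integrableB m0l igl (ic (g a)); congr integrable.
  under eq_Rintegral do rewrite -mulrBl.
  apply: (@le_trans _ _ (\int[leb]_(s in `[0%R, l]) `|(g s - g a) * mollifier a (r n) s|%:E)%E).
    rewrite -[leRHS]fineK; last by apply: integrable_fin_num => //; exact: integrable_abse ik.
    rewrite lee_fin; exact: le_normr_Rintegral ik.
  have mB : measurable (ball a (r n) : set (MR R)) by exact: measurable_ball.
  have mh : measurable_fun setT (fun s : MR R => `|(center (g a) \o g) s|%:E).
    apply/measurable_EFinP; apply: measurableT_comp => //.
    exact: measurable_funB.
  rewrite /davg /iavg (lebesgue_measure_ball _ (ltW rn0)) inver mulrn_eq0/= (gt_eqF rn0).
  rewrite muleA -EFinM -ge0_integralZl//; last 2 first.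
    exact: measurable_funTS.
    by rewrite lee_fin ltW.
  rewrite [leLHS]integral_mkcond [leRHS]integral_mkcond.
  apply: ae_ge0_le_integralT => [s|s|].
  - by rewrite patchE; case: ifP => // _; rewrite lee_fin.
  - by rewrite patchE; case: ifP => // _; rewrite lee_fin mulr_ge0// (ltW Cr0).
  apply: aeW => s /=; rewrite !patchE.
  have [sB|sB] := boolP (s \in (ball a (r n) : set (MR R))).
    case: ifP => _; last first.
      by rewrite lee_fin mulr_ge0// (ltW Cr0).
    rewrite lee_fin normrM mulrC ler_wpM2r//.
    rewrite ger0_norm ?mollifier_ge0//; apply: le_trans (mollifier_le _ _ rn0) _.
    rewrite le_eqVlt; apply/orP; left; apply/eqP; rewrite /C.
    by field; rewrite (gt_eqF rn0) gt_eqF ?step01_gt0.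
  case: ifP => // _; rewrite mollifier_out ?mulr0 ?normr0//.
  have {sB} : ~ ball a (r n) s by move=> h; move/negP: sB; apply; exact/mem_set.
  rewrite /ball/= ltr_norml => /negP; rewrite negb_and -!leNgt.
  by case/orP => h; [right|left]; lra.
have dcvg : (C%:E * davg g a (r n))%E @[n --> \oo] --> (C%:E * 0)%E.
  apply: cvgeZl => //; apply: (@cvg_comp _ _ _ r (davg g a) _ 0^'+) => //.
  move=> A hA; have h : \forall n \near \oo, 0 < r n -> A (r n) by exact: rcvg _ hA.
  by change (\forall n \near \oo, A (r n)); apply: filterS h => n; apply; exact: r0.
pose I n := \int[leb]_(s in `[0, l]) (g s * mollifier a (r n) s).
have ncvg : `|I n - g a|%:E @[n --> \oo] --> 0%E.
  rewrite -(mule0 C%:E); apply: (@squeeze_cvge _ _ _ _ (fun=> (C%:E * 0)%E) _ _ _ _ _ dcvg).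
    by apply: nearW => n; rewrite H mule0 lee_fin normr_ge0.
  exact: cvg_cst.
have ncvg' : `|I n - g a| @[n --> \oo] --> (0 : R) by exact: fine_cvg ncvg.
exact: (subr_cvg0 _ _).1 (norm_cvg0 ncvg').
Qed.

(** At each fixed point the plateau eventually equals the indicator of []a, b]]; being bounded by 1,
    it passes to the limit under the integral. *)
Lemma plateau_cvg (m : {finite_measure set (MR R) -> \bar R}) (a b : R) (r : nat -> R) :
  0 < a -> a <= b -> b < l -> (forall n, 0 < r n) -> r n @[n --> \oo] --> 0 ->
  \int[m]_(s in `]0, l[) plateau a b (r n) s @[n --> \oo] --> cum m l b - cum m l a.
Proof.
move=> a0 ab bl r0 rcvg.
have mI : measurable (`]0, l[%classic : set (MR R)) by exact: measurable_itv.
have mab : measurable (`]a, b]%classic : set (MR R)) by exact: measurable_itv.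
have rsmall (e : R) : 0 < e -> \forall n \near \oo, r n <= e.
  move=> e0; have h : \forall n \near \oo, `|0 - r n| <= e.
    exact: (cvgrPdist_le _ _).1 rcvg _ e0.
  apply: filterS h => n.
  by rewrite sub0r normrN gtr0_norm.
have -> : cum m l b - cum m l a =
    \int[m]_(s in `]0, l[) (\1_(`]a, b]%classic : set (MR R)) s : R).
  rewrite (cum_sub _ (ltW a0) ab bl) /Rintegral integral_indic//.
  congr (fine (m _)); apply/esym/setIidl => x /=; rewrite !in_itv/= => /andP[ax xb].
  by rewrite (lt_trans a0 ax) (le_lt_trans xb bl).
apply: (@Rdominated_cvg _ _ _ m _ _ _ 1) => //.
- exact: finite_measure_lty.
- by move=> n; apply: measurable_funTS; exact: (measurable_smooth (@smooth_plateau _ a b (r n))).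
- by move=> n x _; exact: plateau_le.
move=> x; rewrite /= in_itv/= => /andP[x0 xl].
have ev (c : R) : \1_(`]a, b]%classic : set (MR R)) x = c ->
    (\forall n \near \oo, plateau a b (r n) x = c) ->
    plateau a b (r n) x @[n --> \oo] --> (\1_(`]a, b]%classic : set (MR R)) x : R).
  by move=> -> h; apply: cvg_near_cst; exact: h.
have [xa|ax] := leP x a.
  apply: (ev 0); last by apply: nearW => n; exact: plateau_left.
  by rewrite indicE memNset//= in_itv/= ltNge xa.
have [xb|bx] := leP x b.
  apply: (ev 1); first by rewrite indicE mem_set//= in_itv/= ax.
  have := rsmall (x - a); rewrite subr_gt0 => /(_ ax) rs; apply: filterS rs => n h.
  by apply: plateau_mid => //; rewrite addrC -lerBrDr.
apply: (ev 0).
  by rewrite indicE memNset//= in_itv/= [x <= b]leNgt bx andbF.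
have := rsmall (x - b); rewrite subr_gt0 => /(_ bx) rs; apply: filterS rs => n h.
by apply: plateau_right => //; rewrite addrC -lerBrDr.
Qed.

(** As the flanks of a plateau shrink, the left side tends to [g a - g b] at Lebesgue points and the
    right side to the opposite of the charge of []a, b]]. Hence [g - (cum m1 l - cum m2 l)] takes
    the same value at all Lebesgue points. *)
Lemma du_bois_reymond (m1 m2 : {finite_measure set (MR R) -> \bar R}) :
  (forall a b r : R, 0 < r -> 0 < a -> a <= b -> b + r < l ->
    \int[leb]_(s in `[0, l]) (g s * dplateau a b r s) =
    - (\int[m1]_(s in `]0, l[) plateau a b r s - \int[m2]_(s in `]0, l[) plateau a b r s)) ->
  exists c0 : R, {ae leb, forall s, 0 < s < l -> g s = c0 + (cum m1 l s - cum m2 l s)}.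
Proof.
move=> test.
have key (a b : R) : 0 < a -> a <= b -> b < l -> lebesgue_pt g a -> lebesgue_pt g b ->
    g b - (cum m1 l b - cum m2 l b) = g a - (cum m1 l a - cum m2 l a).
  (* Widths strictly below [l - b] keep both flanks inside the open interval. *)
  move=> a0 ab bl ga gb; pose r n : R := (l - b) / n.+2%:R.
  have lb : 0 < l - b by rewrite subr_gt0.
  have r0 n : 0 < r n by rewrite divr_gt0.
  have brl n : b + r n < l.
    by rewrite addrC -ltrBrDr ltr_pdivrMr// ltr_pMr// ltr1n.
  have arl n : a + r n < l by apply: le_lt_trans (brl n); rewrite lerD2r.
  have rcvg : r n @[n --> \oo] --> (0 : R).
    rewrite -[X in _ --> X](mulr0 (l - b)); apply: cvgMl_tmp.
    by have := @cvg_harmonic R; rewrite -cvg_shiftS.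
  have al : a < l by exact: le_lt_trans bl.
  have c1 := mollifier_lebesgue_pt a0 al ga r0 arl rcvg.
  have c2 := mollifier_lebesgue_pt (lt_le_trans a0 ab) bl gb r0 brl rcvg.
  have c3 := @cvgB _ _ _ _ eventually_filter _ _ _ _ (@plateau_cvg m1 a b r a0 ab bl r0 rcvg) (@plateau_cvg m2 a b r a0 ab bl r0 rcvg).
  have igl : leb.-integrable `[0, l] (EFin \o g) by exact: integrableS ig.
  have E : (fun n => \int[leb]_(s in `[0, l]) (g s * mollifier a (r n) s) -
      \int[leb]_(s in `[0, l]) (g s * mollifier b (r n) s)) =
      (fun n => - (\int[m1]_(s in `]0, l[) plateau a b (r n) s -
         \int[m2]_(s in `]0, l[) plateau a b (r n) s)).
    apply/funext => n; rewrite -test// -RintegralB//; try exact: integrable_mollifier.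
    by apply: eq_Rintegral => s _; rewrite /mollifier /dplateau; ring.
  have c4 := @cvgB _ _ _ _ eventually_filter _ _ _ _ c1 c2.
  have c5 := @cvgN _ _ _ _ eventually_filter _ _ c3.
  have c6 : (fun n => - (\int[m1]_(s in `]0, l[) plateau a b (r n) s -
         \int[m2]_(s in `]0, l[) plateau a b (r n) s)) @ \oo --> g a - g b.
    by rewrite -E; exact: c4.
  have := cvg_unique _ c6 c5 => /(_ (@norm_hausdorff _ _)) h.
  have h' : g a - g b = - (cum m1 l b - cum m1 l a - (cum m2 l b - cum m2 l a)) :> R.
    by apply: h; exact: fmap_proper_filter.
  by lra.
have lpt := lebesgue_differentiation (open_integrable_locally openT ig).
have [[a [a0 al ga]]|none] := pselect (exists a, [/\ 0 < a, a < l & lebesgue_pt g a]).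
  exists (g a - (cum m1 l a - cum m2 l a)).
  move: lpt => [N [mN N0 HN]]; exists N; split => // x /= nx; apply: HN => /= gx; apply: nx.
  move=> /andP[x0 xl]; apply/eqP; rewrite -subr_eq; apply/eqP.
  by have [ax|/ltW xa] := leP a x; [|symmetry]; apply: key.
(* Without a Lebesgue point in []0, l[] the property is void almost everywhere, and any constant
   will do. *)
exists 0; move: lpt => [N [mN N0 HN]]; exists N; split => // x /= nx; apply: HN => /= gx; apply: nx.
by move=> /andP[x0 xl]; exfalso; apply: none; exists x.
Qed.
End du_bois_reymond.

Section bv_density.
Context {R : realType}.
Notation leb := (@lebesgue_measure R).
Variables (c g : R -> R) (l c0 : R) (m1 m2 : {finite_measure set (MR R) -> \bar R}).
Hypotheses (mg : measurable_fun setT (g : MR R -> R))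
  (ig : leb.-integrable setT (EFin \o g)) (l0 : 0 < l)
  (cg : forall t : R, 0 <= t <= l -> c t = c 0 + \int[leb]_(s in `[0, t]) g s)
  (gG : {ae leb, forall s, 0 < s < l -> g s = c0 + (cum m1 l s - cum m2 l s)}).

Let G s := c0 + (cum m1 l s - cum m2 l s).

Let mG : measurable_fun setT (G : MR R -> R).
Proof. by apply: measurable_funD => //; apply: measurable_funB; exact: measurable_cum. Qed.

Let K := `|c0| + (fine (m1 `]0, l[%classic) + fine (m2 `]0, l[%classic)).

Let GK s : `|G s| <= K.
Proof.
apply: le_trans (ler_normD _ _) _; rewrite lerD2l.
apply: le_trans (ler_normB _ _) _.
have /andP[h1 h2] := cum_bounds m1 l s; have /andP[h3 h4] := cum_bounds m2 l s.
by rewrite !ger0_norm// lerD.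
Qed.

Let iG (a b : R) : leb.-integrable `[a, b] (EFin \o G).
Proof.
apply: (@integrable_bnd _ _ _ _ _ K) => //; first exact: lebesgue_itv_lty.
exact: measurable_funTS.
Qed.

Let ig_itv (a b : R) : leb.-integrable `[a, b] (EFin \o g).
Proof. by apply: integrableS ig => //; exact: measurable_itv. Qed.

Let Rintegral_oo (f : R -> R) (a b : R) : leb.-integrable `[a, b] (EFin \o f) ->
  \int[leb]_(s in `]a, b[) f s = \int[leb]_(s in `[a, b]) f s.
Proof.
move=> i_f; rewrite Rintegral_itv_bndo_bndc ?Rintegral_itv_obnd_cbnd//.
  by apply: integrableS i_f => //; exact: subset_itv_oc_cc.
by apply: integrableS i_f => //; exact: subset_itv_oo_cc.
Qed.

Lemma bv_increment_int (a b : R) : 0 <= a -> a <= b -> b <= l ->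
  c b - c a = \int[leb]_(s in `]a, b[) G s.
Proof.
move=> a0 ab bl.
have a0l : 0 <= a <= l by rewrite a0 (le_trans ab).
have b0l : 0 <= b <= l by rewrite (le_trans a0 ab).
have -> : c b - c a = \int[leb]_(s in `]a, b[) g s.
  rewrite (cg a0l) (cg b0l) opprD addrACA subrr add0r Rintegral_itvB//; last first.
  rewrite Rintegral_oo// Rintegral_itv_obnd_cbnd//.
  by apply: integrableS (ig_itv a b) => //; exact: subset_itv_oc_cc.
apply: ae_Rintegral_eq; move: gG => [N [mN N0 HN]]; exists N; split => // x /= nx.
apply: HN => /= h; apply: nx; rewrite in_itv/= => /andP[ax xb]; apply: h.
by rewrite (le_lt_trans a0 ax) (lt_le_trans xb bl).
Qed.

(** A mean of values within [e] of [v] is within [e] of [v]. It gives the one-sided derivatives at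
    the ends, and later the comparison of chords with tangents. *)
Lemma bv_increment (a b v e : R) : 0 <= a -> a <= b -> b <= l ->
  (forall s, a < s < b -> `|G s - v| <= e) -> `|c b - c a - (b - a) * v| <= e * (b - a).
Proof.
move=> a0 ab bl Gv; rewrite bv_increment_int//.
have mI : measurable (`]a, b[%classic : set (MR R)) by exact: measurable_itv.
have -> : (b - a) * v = \int[leb]_(s in `]a, b[) (fun=> v) s.
  by rewrite /= Rintegral_cst// fine_lebesgue_itv// mulrC.
rewrite -[X in _ * X](@fine_lebesgue_itv R false true)//.
apply: Rintegral_dist => //.
- exact: lebesgue_itv_lty.
- by apply: integrableS (iG a b) => //; exact: subset_itv_oo_cc.
- by apply: (@integrable_bnd _ _ _ _ _ `|v|) => //; exact: lebesgue_itv_lty.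
Qed.

(** By [fubini_cum], integrating [dphi] against [cum m l] amounts to integrating [phi l - phi u]
    against [m]. The boundary coefficients are the limits of the density at the ends: [c0] before
    any mass, and [c0] plus the whole charge of []0, l[]. *)
Lemma bv_by_parts (phi dphi : R -> R) :
  (forall x : R, is_derive x 1 phi (dphi x)) -> continuous dphi ->
  \int[leb]_(s in `[0, l]) (g s * dphi s) =
  (c0 + (fine (m1 `]0, l[%classic) - fine (m2 `]0, l[%classic))) * phi l - c0 * phi 0
  - (\int[m1]_(s in `]0, l[) phi s - \int[m2]_(s in `]0, l[) phi s).
Proof.
move=> dphiP cdphi.
have [Kp HKp] := @continuous_itv_bounded _ dphi 0 l (continuous_subspaceT cdphi).
have mI : measurable (`[0, l]%classic : set (MR R)) by exact: measurable_itv.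
have mO : measurable (`]0, l[%classic : set (MR R)) by exact: measurable_itv.
(* Truncating [dphi] to [[0, l]] makes it globally bounded, as [fubini_cum] requires. *)
pose psi (s : MR R) : R := dphi s * \1_(`[0, l]%classic : set (MR R)) s.
have mdphi : measurable_fun setT (dphi : MR R -> R) by exact: continuous_measurable_fun.
have mpsi : measurable_fun setT psi by apply: measurable_funM => //; exact: measurable_indic.
have psiE s : 0 <= s <= l -> psi s = dphi s.
  by move=> sl; rewrite /psi indicE mem_set//= ?in_itv// mulr1.
have psiK s : `|psi s| <= `|Kp|.
  have [sl|sl] := boolP (0 <= s <= l).
    by rewrite psiE// (le_trans (HKp _ sl)) ?ler_norm.
  by rewrite /psi indicE memNset ?mulr0 ?normr0//= in_itv; exact/negP.
have cphi : continuous phi.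
  move=> x; apply: differentiable_continuous; apply/derivable1_diffP.
  by have [] := dphiP x.
have [Kf HKf] := @continuous_itv_bounded _ phi 0 l (continuous_subspaceT cphi).
have mphi : measurable_fun setT (phi : MR R -> R) by exact: continuous_measurable_fun.
have ic (m : {finite_measure set (MR R) -> \bar R}) :
    \int[leb]_(s in `[0, l]) (psi s * cum m l s) =
    phi l * fine (m `]0, l[%classic) - \int[m]_(s in `]0, l[) phi s.
  rewrite (fubini_cum m l mpsi psiK) -(@Rintegral_cst _ _ _ m `]0, l[%classic mO).
  rewrite -RintegralB//; last 2 first.
  - by apply: (@integrable_fin_bnd _ _ _ _ _ `|phi l|).
  - apply: (@integrable_fin_bnd _ _ _ _ _ Kf) => //; first exact: measurable_funTS.
    by move=> x; rewrite /= in_itv/= => /andP[x0 xl]; rewrite HKf// !ltW.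
  apply: eq_Rintegral => u; rewrite inE/= in_itv/= => /andP[u0 ul].
  rewrite -(Rint_derive (ltW ul) dphiP cdphi); apply: eq_Rintegral => s.
  rewrite inE/= in_itv/= => /andP[us sl]; apply: psiE.
  by rewrite sl (le_trans (ltW u0)).
have iP (f : R -> R) (M : R) : measurable_fun setT (f : MR R -> R) -> (forall x, `|f x| <= M) ->
    leb.-integrable `[0, l] (EFin \o (fun s => psi s * f s)).
  move=> mf fM; apply: (@integrable_bnd _ _ _ _ _ (`|Kp| * M)) => //.
  - exact: lebesgue_itv_lty.
  - by apply: measurable_funTS; exact: measurable_funM.
  - by move=> x _; rewrite normrM ler_pM.
have cumK m s : `|cum m l s| <= fine (m `]0, l[%classic).
  by have /andP[h1 h2] := cum_bounds m l s; rewrite ger0_norm.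
have ne (a : R) : {ae leb, forall s, s <> a}.
  by exists [set a]; split; [|exact: lebesgue_measure_set1|move=> x /= /contrapT].
have im m : leb.-integrable `[0, l] (EFin \o (fun s => psi s * cum m l s)).
  apply: (iP _ (fine (m `]0, l[%classic))) => //; exact: measurable_cum.
transitivity (\int[leb]_(s in `[0, l]) (psi s * c0 + (psi s * cum m1 l s - psi s * cum m2 l s))).
  apply: ae_Rintegral_eq.
  apply: (@filterS3 _ _ (@ae_filter_ringOfSetsType _ _ _ leb) _ _ _ _ _ gG (ne 0) (ne l)) => x h /eqP x0 /eqP xl.
  rewrite /= in_itv/= => x0l; move: (x0l) => /andP[x0' xl'].
  by rewrite h ?psiE//; [ring|rewrite !lt_neqAle x0' xl' eq_sym x0 xl].
rewrite RintegralD//; last 2 first.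
- exact: (iP _ `|c0|).
- by have := integrableB mI (im m1) (im m2); congr integrable.
rewrite RintegralB//.
have -> : \int[leb]_(s in `[0, l]) (psi s * c0) = c0 * (phi l - phi 0).
  rewrite -(Rint_derive (ltW l0) dphiP cdphi) -RintegralZl//; last first.
    apply: (@integrable_bnd _ _ _ _ _ Kp) => //; first exact: lebesgue_itv_lty.
      exact: measurable_funTS.
  by apply: eq_Rintegral => s; rewrite inE/= in_itv/= => sl; rewrite psiE// mulrC.
by rewrite !ic; ring.
Qed.

(** Both distribution functions tend to 0 at the left end, so the density tends to [c0] there. *)
Lemma bv_right : t^-1 * (c t - c 0) @[t --> 0^'+] --> c0.
Proof.
apply/cvgrPdist_le => e e0.
have e2 : 0 < e / 2 by rewrite divr_gt0.
have [d1 /andP[d10 d1l] h1] := cum_right m1 e2 l0.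
have [d2 /andP[d20 d2l] h2] := cum_right m2 e2 l0.
near=> t.
have t0 : 0 < t by near: t; exact: nbhs_right_gt.
have td1 : t < d1 by near: t; exact: nbhs_right_lt.
have td2 : t < d2 by near: t; exact: nbhs_right_lt.
have H : `|c t - c 0 - (t - 0) * c0| <= e * (t - 0).
  apply: bv_increment => //; first exact: ltW (lt_trans td1 d1l).
  move=> s /andP[s0 st]; rewrite addrC /G addKr.
  have /andP[c1 _] := cum_bounds m1 l s; have /andP[c2 _] := cum_bounds m2 l s.
  have := cum_nd m1 l (ltW (lt_trans st td1)); have := cum_nd m2 l (ltW (lt_trans st td2)).
  by move=> c3 c4; rewrite ler_norml; apply/andP; split; lra.
move: H; rewrite subr0 => H.
rewrite distrC -(ler_pM2l t0) -[X in X * _]gtr0_norm// -normrM mulrBr mulrA divff ?gt_eqF// mul1r.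
by rewrite [leRHS]mulrC.
Unshelve. all: by end_near. Qed.

(** Near [l] the whole mass of the open interval has been accumulated; the sign comes from the
    increment being taken inward. *)
Lemma bv_left : t^-1 * (c (l - t) - c l) @[t --> 0^'+] -->
  - (c0 + (fine (m1 `]0, l[%classic) - fine (m2 `]0, l[%classic))).
Proof.
set v := c0 + _.
apply/cvgrPdist_le => e e0.
have e2 : 0 < e / 2 by rewrite divr_gt0.
have [d1 /andP[d10 d1l] h1] := cum_left m1 e2 l0.
have [d2 /andP[d20 d2l] h2] := cum_left m2 e2 l0.
near=> t.
have t0 : 0 < t by near: t; exact: nbhs_right_gt.
have td1 : t < d1 by near: t; exact: nbhs_right_lt.
have td2 : t < d2 by near: t; exact: nbhs_right_lt.
have tl : t < l by exact: lt_trans d1l.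
have H : `|c l - c (l - t) - (l - (l - t)) * v| <= e * (l - (l - t)).
  apply: bv_increment => //; [by rewrite subr_ge0 ltW|by rewrite gerBl ltW|].
  move=> s /andP[s0 st]; rewrite /G /v opprD addrACA subrr add0r.
  have /andP[_ c1] := cum_bounds m1 l s; have /andP[_ c2] := cum_bounds m2 l s.
  have s1 : l - d1 <= s by apply: le_trans (ltW s0); rewrite lerD2l lerN2 ltW.
  have s2 : l - d2 <= s by apply: le_trans (ltW s0); rewrite lerD2l lerN2 ltW.
  have := cum_nd m1 l s1; have := cum_nd m2 l s2.
  by move=> c3 c4; rewrite ler_norml; apply/andP; split; lra.
move: H; rewrite subKr => H.
rewrite -(ler_pM2l t0) -[X in X * _]gtr0_norm// -normrM mulrBr mulrA divff ?gt_eqF// mul1r.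
by rewrite [t * e]mulrC; apply: le_trans H; rewrite le_eqVlt; apply/orP; left; apply/eqP; congr `|_|; ring.
Unshelve. all: by end_near. Qed.

End bv_density.

(** * Tangents and curvature force *)

Section arclength_link.
Context {R : realType}.
Local Notation leb := (@lebesgue_measure R).
Variables (L : glink R).
Hypothesis hL : arclength_parametrized L.
Implicit Types (i : 'I_(ncomp L)) (k : 'I_3).

Lemma chord_le i (a b : R) : 0 <= a -> a <= b -> b <= clen i ->
  enorm (curve i b - curve i a) <= b - a.
Proof.
move=> a0 ab bl; move: (ab); rewrite le_eqVlt => /predU1P[->|ltab].
  by rewrite !subrr enorm0.
rewrite -lee_fin -(hL a0 ab bl); apply: ereal_sup_ubound.
exists [:: b]; first exact: itv_partition1.
by rewrite /edges/= big_seq1.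
Qed.

Lemma curve_lipschitz i k (a b : R) : 0 <= a -> a <= b -> b <= clen i ->
  `|curve i b 0 k - curve i a 0 k| <= 1 * (b - a).
Proof.
move=> a0 ab bl; rewrite mul1r; apply: le_trans (chord_le a0 ab bl).
by apply: le_trans (coord_le_enorm _ k); rewrite !mxE.
Qed.

(** Arclength makes every coordinate 1-Lipschitz, so each has a density. The three null sets are
    merged, and elsewhere the vector derivative exists because its coordinates have derivatives. *)
Lemma tangent_density i : exists g : 'I_3 -> R -> R,
  (forall k, [/\ measurable_fun setT (g k : measurableTypeR R -> R),
    leb.-integrable setT (EFin \o g k) &
    forall t, 0 <= t <= clen i ->
      curve i t 0 k = curve i 0 0 k + \int[leb]_(s in `[0, t]) g k s]) /\
  {ae leb, forall s, 0 < s < clen i -> forall k, tangent i s 0 k = g k s}.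
Proof.
have H k : exists g : R -> R,
  [/\ measurable_fun setT (g : measurableTypeR R -> R),
    leb.-integrable setT (EFin \o g),
    forall t, 0 <= t <= clen i ->
      curve i t 0 k = curve i 0 0 k + \int[leb]_(s in `[0, t]) g s &
    {ae leb, forall x : R, 0 < x < clen i -> is_derive x 1 (fun s => curve i s 0 k) (g x)}].
  exact: (lipschitz_density (clen_gt0 i) ler01 (@curve_lipschitz i k)).
have [g gP] := choice H.
exists g; split=> [k|]; first by have [] := gP k.
have A : {ae leb, forall s k, 0 < s < clen i -> is_derive s 1 (fun s => curve i s 0 k) (g k s)}.
  apply: (@filter_forall _ _ (fun k s => 0 < s < clen i -> is_derive s 1 (fun s => curve i s 0 k) (g k s)) _
    (@ae_filter_ringOfSetsType _ _ _ leb)) => k.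
  by have [_ _ _] := gP k.
apply: (@filterS _ _ (@ae_filter_ringOfSetsType _ _ _ leb) _ _ _ A) => s h sl k.
have dc : derivable (curve i) s 1.
  apply/derivable_mxP => a b; rewrite ord1; by have [] := h b sl.
rewrite /tangent derive1E derive_mx// mxE.
by have [_] := h k sl.
Qed.

End arclength_link.

Lemma charge_jordan d (T : measurableType d) (R : realType) (nu : {charge set T -> \bar R}) :
  exists m1 m2 : {finite_measure set T -> \bar R},
    forall A, measurable A -> (nu A = m1 A - m2 A)%E.
Proof.
have [P [N PN]] := Hahn_decomposition nu.
exists (jordan_pos PN), (jordan_neg PN) => A mA.
rewrite (jordan_decomp PN mA) /cadd/= /cscale/= EFinN mulN1e.
by [].
Qed.

Lemma ae_itv_cc (R : realType) (l : R) (P : R -> Prop) :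
  {ae @lebesgue_measure R, forall s, 0 < s < l -> P s} ->
  {ae @lebesgue_measure R, forall s, 0 <= s <= l -> P s}.
Proof.
move=> h.
have ne (a : R) : {ae @lebesgue_measure R, forall s, s <> a}.
  by exists [set a]; split; [|exact: lebesgue_measure_set1|move=> x /= /contrapT].
apply: (@filterS3 _ _ (@ae_filter_ringOfSetsType _ _ _ _) _ _ _ _ _ h (ne 0) (ne l)).
move=> x Px /eqP x0 /eqP xl /andP[x0' xl']; apply: Px.
by rewrite !lt_neqAle x0' xl' eq_sym x0 xl.
Qed.

Section curvature_link.
Context {R : realType}.
Local Notation leb := (@lebesgue_measure R).
Variables (L : glink R).
Hypothesis hL : arclength_parametrized L.
Implicit Types (i : 'I_(ncomp L)) (k : 'I_3).

(** What is kept from the identity [T = c0 + cum m1 - cum m2], valid almost everywhere in coordinate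
    [k], once the density is forgotten: increments, integration by parts and the two one-sided
    derivatives. *)
Record bv_tangent i k (m1 m2 : {finite_measure set (MR R) -> \bar R}) (c0 : R) : Prop := {
  bvt_increment : forall a b v e : R, 0 <= a -> a <= b -> b <= clen i ->
    (forall s, a < s < b -> `|c0 + (cum m1 (clen i) s - cum m2 (clen i) s) - v| <= e) ->
    `|curve i b 0 k - curve i a 0 k - (b - a) * v| <= e * (b - a);
  bvt_by_parts : forall phi dphi : R -> R,
    (forall x : R, is_derive x 1 phi (dphi x)) -> continuous dphi ->
    \int[leb]_(s in `[0, clen i]) (tangent i s 0 k * dphi s) =
    (c0 + (fine (m1 `]0, clen i[%classic) - fine (m2 `]0, clen i[%classic))) * phi (clen i)
    - c0 * phi 0
    - (\int[m1]_(s in `]0, clen i[) phi s - \int[m2]_(s in `]0, clen i[) phi s);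
  bvt_right : t^-1 * (curve i t 0 k - curve i 0 0 k) @[t --> 0^'+] --> c0;
  bvt_left : t^-1 * (curve i (clen i - t) 0 k - curve i (clen i) 0 k) @[t --> 0^'+] -->
    - (c0 + (fine (m1 `]0, clen i[%classic) - fine (m2 `]0, clen i[%classic))) }.

Lemma curvature_bv_tangent i k (m1 m2 : {finite_measure set (MR R) -> \bar R}) :
  (forall a b r : R, 0 < r -> 0 < a -> a <= b -> b + r < clen i ->
    \int[leb]_(s in `[0, clen i]) (tangent i s 0 k * dplateau a b r s) =
    - (\int[m1]_(s in `]0, clen i[) plateau a b r s
       - \int[m2]_(s in `]0, clen i[) plateau a b r s)) ->
  exists c0, bv_tangent i k m1 m2 c0.
Proof.
move=> test; have [g [gP gT]] := tangent_density hL i; have [mg ig cg] := gP k.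
have gT' : forall f : R -> R, \int[leb]_(s in `[0, clen i]) (tangent i s 0 k * f s) =
    \int[leb]_(s in `[0, clen i]) (g k s * f s).
  move=> f; apply: ae_Rintegral_eq.
  apply: (@filterS _ _ (@ae_filter_ringOfSetsType _ _ _ leb) _ _ _ (ae_itv_cc gT)) => s h.
  by rewrite /= in_itv/= => /h ->.
have [] := @du_bois_reymond R (g k) (clen i) mg ig (clen_gt0 i) m1 m2.
  by move=> a b r *; rewrite -gT' test.
move=> c0 gG; exists c0; split.
- move=> a b v e a0 ab bl; exact: (bv_increment ig cg gG a0 ab bl).
- by move=> phi dphi dP cd; rewrite gT'; exact: (bv_by_parts (clen_gt0 i) gG dP cd).
- exact: (bv_right ig (clen_gt0 i) cg gG).
- exact: (bv_left ig (clen_gt0 i) cg gG).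
Qed.

End curvature_link.

(** * Angles and turning of inscribed polygons *)

Section angle_bounds.
Context {R : realType}.
Implicit Types (u v w : 'rV[R]_3).

Lemma dot_ratio_itv u v : -1 <= dot u v / (enorm u * enorm v) <= 1.
Proof.
rewrite -ler_norml normrM normfV [X in _ / X]ger0_norm ?mulr_ge0 ?enorm_ge0//.
have := mulr_ge0 (enorm_ge0 u) (enorm_ge0 v); rewrite le_eqVlt => /predU1P[<-|n0].
  by rewrite invr0 mulr0.
by rewrite ler_pdivrMr// mul1r cauchy_schwarz.
Qed.

Lemma angle_ge0 u v : 0 <= angle u v.
Proof. by rewrite acos_ge0// dot_ratio_itv. Qed.

Lemma angle_lepi u v : angle u v <= pi.
Proof. by rewrite acos_lepi// dot_ratio_itv. Qed.

Lemma cos_angle u v : cos (angle u v) = dot u v / (enorm u * enorm v).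
Proof. by rewrite acosK// in_itv/= dot_ratio_itv. Qed.

Lemma angleZ (a b : R) u v : 0 < a -> 0 < b -> angle (a *: u) (b *: v) = angle u v.
Proof.
move=> a0 b0; rewrite /angle dotZl dotZr !enormZ !gtr0_norm//.
by rewrite mulrACA mulrA -mulf_div divff ?mul1r// mulf_neq0// gt_eqF.
Qed.

(** If [cos t <= 1 / 2], then [1 - cos t >= 1 / 2] and the term with [pi ^+ 2] suffices. Otherwise
    the mean value theorem gives [sin t >= t / 2], and [sin t ^+ 2 <= 2 * (1 - cos t)] yields the
    constant 8. *)
Lemma sqr_le_cos (t : R) : 0 <= t <= pi -> t ^+ 2 <= (8 + 2 * pi ^+ 2) * (1 - cos t).
Proof.
move=> /andP[t0 tpi]; have c1 : 0 <= 1 - cos t by rewrite subr_ge0 cos_le1.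
have p0 : 0 <= (pi : R) ^+ 2 by rewrite sqr_ge0.
have [c2|c2] := leP (cos t) (1 / 2).
  have : t ^+ 2 <= pi ^+ 2 by rewrite lerXn2r ?nnegrE// (le_trans t0).
  by nra.
have [z + e] : exists2 z, z \in `[0, t] & sin t - sin 0 = cos z * (t - 0).
  apply: MVT_segment => //; apply: continuous_subspaceT; exact: continuous_sin.
rewrite in_itv/= => /andP[z0 zt].
have cz : 1 / 2 <= cos z.
  apply: le_trans (ltW c2) _; rewrite le_eqVlt.
  move: zt; rewrite le_eqVlt => /predU1P[->|zt]; first by rewrite eqxx.
  by rewrite ltr_cos ?zt ?orbT// in_itv/= ?z0 ?t0 ?tpi// (le_trans (ltW zt)).
rewrite sin0 !subr0 in e.
have h1 : t / 2 <= sin t by rewrite e; nra.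
have h2 := sin2cos2 t; have h3 := cos_le1 t.
have h4 : (t / 2) ^+ 2 <= sin t ^+ 2.
  by rewrite lerXn2r ?nnegrE ?divr_ge0// (le_trans _ h1) ?divr_ge0.
nra.
Qed.

(** For [e >= 1 / 4] the bound exceeds [pi]. Otherwise [u / a] and [v / b] have norms at least
    [1 / 2] and lie within [2 * e] of each other, so the cosine of their angle is at least
    [1 - 8 * e ^+ 2], and [sqr_le_cos] applies with [8 * (8 + 2 * pi ^+ 2) <= (8 + 4 * pi) ^+ 2]. *)
Lemma angle_le u v w (a b e : R) : 0 < a -> 0 < b -> 0 <= e ->
  enorm (u - a *: w) <= e * a -> enorm (v - b *: w) <= e * b -> 1 <= enorm w + e ->
  angle u v <= (8 + 4 * pi) * e.
Proof.
move=> a0 b0 e0 uw vw we; have p0 := pi_ge0 R.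
have [e4|e4] := leP (1 / 4) e; first by have := angle_lepi u v; nra.
pose x := a^-1 *: u; pose y := b^-1 *: v.
have xw : enorm (x - w) <= e.
  rewrite -(ler_pM2l a0) mulrC [leRHS]mulrC; apply: le_trans uw.
  by rewrite -[X in _ * X]gtr0_norm// mulrC -enormZ scalerBr scalerA divff ?scale1r// gt_eqF.
have yw : enorm (y - w) <= e.
  rewrite -(ler_pM2l b0) mulrC [leRHS]mulrC; apply: le_trans vw.
  by rewrite -[X in _ * X]gtr0_norm// mulrC -enormZ scalerBr scalerA divff ?scale1r// gt_eqF.
have -> : angle u v = angle x y.
  by rewrite angleZ ?invr_gt0.
have x2 : 1 / 2 <= enorm x.
  have := enorm_dist x w; rewrite ler_norml => /andP[h _].
  lra.
have y2 : 1 / 2 <= enorm y.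
  have := enorm_dist y w; rewrite ler_norml => /andP[h _].
  lra.
have xy : enorm (x - y) <= 2 * e.
  have -> : x - y = (x - w) + (w - y) by rewrite addrA subrK.
  by apply: le_trans (enormD _ _) _; rewrite (enormB w); lra.
have xy2 : enorm x ^+ 2 + enorm y ^+ 2 - 2 * dot x y <= (2 * e) ^+ 2.
  have : enorm (x - y) ^+ 2 <= (2 * e) ^+ 2 by rewrite lerXn2r ?nnegrE ?enorm_ge0//; lra.
  by rewrite sqr_enorm dotBl !dotBr (dotC y x) -!sqr_enorm; lra.
have t0 := angle_ge0 x y; have tpi := angle_lepi x y.
have h := @sqr_le_cos (angle x y); rewrite t0 tpi cos_angle in h; have {}h := h isT.
have nn : 1 / 4 <= enorm x * enorm y by nra.
have n0 : 0 < enorm x * enorm y by lra.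
have c8 : 1 - dot x y / (enorm x * enorm y) <= 8 * e ^+ 2.
  rewrite -(ler_pM2r n0) mulrBl mul1r mulrVK ?unitfE ?gt_eqF//.
  have : 0 <= (enorm x - enorm y) ^+ 2 by exact: sqr_ge0.
  by nra.
rewrite -(@ler_pXn2r _ 2)// ?nnegrE//; last by nra.
apply: le_trans h _.
have : 0 <= 8 + 2 * (pi : R) ^+ 2 by nra.
nra.
Qed.

End angle_bounds.

Lemma zip_rcons_behead (T : Type) (x y : T) s :
  zip (x :: s) (rcons s y) = rcons (zip (x :: s) s) (last x s, y).
Proof. by elim: s x => //= z s IH x; rewrite IH. Qed.

Lemma zip_rcons_trunc (T U : Type) (s : seq T) (t : seq U) x : (size t <= size s)%N ->
  zip (rcons s x) t = zip s t.
Proof. by elim: s t => [|z s IH] [|w t]//= st; rewrite IH. Qed.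

Lemma consecutive_true (T : Type) (x : T) s :
  consecutive true (x :: s) = rcons (consecutive false (x :: s)) (last x s, x).
Proof. by rewrite /consecutive rot1_cons zip_rcons_behead. Qed.

Lemma consecutive_rcons (T : Type) (x y : T) s :
  consecutive false (rcons (x :: s) y) = rcons (consecutive false (x :: s)) (last x s, y).
Proof.
by rewrite /consecutive/= -rcons_cons -zip_rcons_behead zip_rcons_trunc// size_rcons.
Qed.

Section total_curvature_bound.
Context {R : realType}.
Variables (L : glink R) (hL : arclength_parametrized L) (i : 'I_(ncomp L)).
Variables (m1 m2 : 'I_3 -> {finite_measure set (MR R) -> \bar R}) (c0 : 'I_3 -> R).
Hypothesis bvT : forall k, bv_tangent i k (m1 k) (m2 k) (c0 k).
Local Notation l := (clen i).
Local Notation c := (curve i).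

(** [G] is the representative of the tangent given by its distribution functions, and the increments
    of the nondecreasing function [W] bound its oscillation. *)
Let W (s : R) := \sum_(k < 3) (cum (m1 k) l s + cum (m2 k) l s).
Let G (s : R) : 'rV[R]_3 := \row_k (c0 k + (cum (m1 k) l s - cum (m2 k) l s)).

Let W_nd (s t : R) : s <= t -> W s <= W t.
Proof. by move=> st; apply: ler_sum => k _; rewrite lerD// cum_nd. Qed.

Let W_ge0 s : 0 <= W s.
Proof.
apply: sumr_ge0 => k _; have /andP[h1 _] := cum_bounds (m1 k) l s.
by have /andP[h2 _] := cum_bounds (m2 k) l s; rewrite addr_ge0.
Qed.

Let chord_bv (p q a b t : R) : 0 <= p -> q <= l -> p <= a -> a <= b -> b <= q -> p <= t <= q ->
  enorm (c b - c a - (b - a) *: G t) <= (W q - W p) * (b - a).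
Proof.
move=> p0 ql pa ab bq /andP[pt tq]; apply: le_trans (enorm_le_sum _) _.
rewrite -sumrB mulr_suml; apply: ler_sum => k _; rewrite !mxE.
apply: (bvt_increment (bvT k)) => //; [exact: le_trans pa|exact: le_trans ql|].
move=> s /andP[s1 s2].
have ps : p <= s by rewrite (le_trans pa)// ltW.
have sq : s <= q by rewrite (le_trans _ bq)// ltW.
have := cum_nd (m1 k) l ps; have := cum_nd (m1 k) l sq.
have := cum_nd (m1 k) l pt; have := cum_nd (m1 k) l tq.
have := cum_nd (m2 k) l ps; have := cum_nd (m2 k) l sq.
have := cum_nd (m2 k) l pt; have := cum_nd (m2 k) l tq.
by move=> *; rewrite ler_norml; apply/andP; split; lra.
Qed.

Let sum_edges (M a b : R) s : itv_partition a b s ->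
  (forall x y, a <= x -> x <= y -> y <= b -> enorm (c y - c x) <= M * (y - x)) ->
  \sum_(e <- edges false (map c (a :: s))) enorm e <= M * (b - a).
Proof.
elim: s a => [a /itv_partition_nil-> _|x s IH a hs H].
  by rewrite /edges big_nil subrr mulr0.
rewrite [edges _ _](_ : _ = (c x - c a) :: edges false (map c (x :: s)))// big_cons.
have hs' := itv_partition_cons hs.
have ax : a <= x by case: hs => /= /andP[/ltW].
have xb : x <= b by exact: itv_partition_le hs'.
have -> : M * (b - a) = M * (x - a) + M * (b - x) by ring.
apply: lerD; first exact: H.
by apply: IH => // y z xy; apply: H; exact: le_trans xy.
Qed.

(** By [chord_bv] every chord inside [[p, q]] is at most [enorm (G t) + (W q - W p)] times its
    parameter length. Summing over inscribed polygons bounds the length [q - p] of the subarc: this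
    is where arclength forces [G] to be almost unitary. *)
Let G_lower (p q t : R) : 0 <= p -> q <= l -> p < q -> p <= t <= q ->
  1 <= enorm (G t) + (W q - W p).
Proof.
move=> p0 ql pq pt; have qp : 0 < q - p by rewrite subr_gt0.
rewrite -(ler_pM2r qp) mul1r -lee_fin -(hL p0 (ltW pq) ql).
apply: ub_ereal_sup => _ [s hs <-]; rewrite lee_fin; apply: sum_edges hs _ => x y px xy yq.
have := chord_bv p0 ql px xy yq pt.
set D := c y - c x; set E := (y - x) *: G t => h.
have -> : D = E + (D - E) by rewrite addrC subrK.
apply: le_trans (enormD _ _) _; rewrite mulrDl lerD//.
by rewrite /E enormZ ger0_norm ?subr_ge0// mulrC.
Qed.

(** Both chords are compared with [G y], where [y] is the vertex that they share. *)
Let angle_bv (x y z : R) : 0 <= x -> x < y -> y < z -> z <= l ->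
  angle (c y - c x) (c z - c y) <= (8 + 4 * pi) * (W z - W x).
Proof.
move=> x0 xy yz zl; have xz := lt_trans xy yz.
have yxz : x <= y <= z by rewrite !ltW.
apply: (@angle_le _ _ _ (G y) (y - x) (z - y)); rewrite ?subr_gt0//.
- by rewrite subr_ge0 W_nd// ltW.
- by apply: chord_bv => //; rewrite ltW.
- by apply: chord_bv => //; rewrite ltW.
- exact: G_lower.
Qed.

Let C : R := 8 + 4 * pi.

(** Each angle costs an increment of [W] over two consecutive edges, so the sum telescopes twice;
    the form [2 * W l - W x - W y] is the one preserved by induction. *)
Let turning_open (x y : R) s : 0 <= x -> path <%R x (y :: s) ->
  (forall t, t \in y :: s -> t <= l) ->
  turning false (map c (x :: y :: s)) <= C * (2 * W l - W x - W y).
Proof.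
have C0 : 0 <= C by have := @pi_ge0 R; rewrite /C; lra.
elim: s x y => [|z s IH] x y x0 xys sl.
  rewrite /turning big_nil mulr_ge0//.
  have yl : y <= l by apply: sl; rewrite mem_head.
  have xy : x <= y by case/andP: xys => /ltW.
  by have := W_nd yl; have := W_nd (le_trans xy yl); lra.
have [xy yzs] := andP xys; have [yz _] := andP yzs.
have zl : z <= l by apply: sl; rewrite !inE eqxx orbT.
have y0 : 0 <= y by rewrite (le_trans x0)// ltW.
rewrite [turning _ _](_ : _ = angle (c y - c x) (c z - c y) +
  turning false (map c (y :: z :: s))); last by rewrite /turning [edges _ _]/= big_cons.
have h1 := angle_bv x0 xy yz zl; rewrite -/C in h1.
have h2 := IH y z y0 yzs (fun t ht => sl t (@mem_behead _ [:: y, z & s] _ ht)).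
nra.
Qed.

(** Closing a polygon adds two angles, each at most [pi]. *)
Let turning_wrap (u v : 'rV[R]_3) es :
  \sum_(q <- consecutive true (rcons (u :: es) v)) angle q.1 q.2 <=
  \sum_(q <- consecutive false (u :: es)) angle q.1 q.2 + 2 * pi.
Proof.
rewrite rcons_cons consecutive_true -rcons_cons consecutive_rcons.
rewrite !big_rcons/=; have := @angle_lepi R; move=> h.
rewrite !mulr_natl mulr2n.
have := h (last u (rcons es v)) u; have := h (last u es) v; lra.
Qed.

Lemma turning_bound : exists M : R, forall s, inscribed i s -> turning (circ i) (map c s) <= M.
Proof.
have C0 : 0 <= C by have := @pi_ge0 R; rewrite /C; lra.
have p0 := @pi_ge0 R.
have D0 : 0 <= C * (2 * W l) by have := W_ge0 l; nra.
exists (C * (2 * W l) + 2 * pi) => s [srt dom _].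
have dl t : t \in s -> 0 <= t <= l.
  move/dom; rewrite /pdom /param_dom; case: (circ i); rewrite /= in_itv/= => /andP[-> h] //=.
  exact: ltW.
case: s srt dom dl => [|x [|y s]] srt _ dl.
- by rewrite /turning /edges /consecutive; case: (circ i); rewrite big_nil addr_ge0 ?mulr_ge0.
(* A closed polygon with one vertex still has one degenerate edge and one angle, covered by the
   summand [2 * pi]. *)
- rewrite /turning /edges /consecutive; case: (circ i) => /=.
    by rewrite big_seq1/=; have := angle_lepi (c x - c x) (c x - c x); lra.
  by rewrite big_nil addr_ge0 ?mulr_ge0.
have x0 : 0 <= x by have /andP[] := dl x (mem_head _ _).
have h : turning false (map c (x :: y :: s)) <= C * (2 * W l).
  apply: le_trans (turning_open x0 srt _) _.
    by move=> t ht; have /andP[] := dl t (@mem_behead _ [:: x, y & s] _ ht).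
  by have := W_ge0 x; have := W_ge0 y; nra.
case: (circ i); last by apply: le_trans h _; rewrite lerDl; nra.
rewrite /turning [edges true _](_ : _ = rcons (edges false (map c (x :: y :: s)))
  (c x - c (last y s))); last first.
  by rewrite /edges [map c _]/= consecutive_true map_rcons/= last_map.
rewrite [edges false _](_ : _ = (c y - c x) :: edges false (map c (y :: s)))//.
by apply: le_trans (turning_wrap _ _ _) _; rewrite lerD2r.
Qed.

End total_curvature_bound.

Section end_atoms.
Context {R : realType}.

Lemma Rintegral_ends (m : {finite_measure set (MR R) -> \bar R}) (l M : R) (f : R -> R) :
  0 < l -> measurable_fun `[0, l]%classic (f : MR R -> R) -> (forall x, 0 <= x <= l -> `|f x| <= M) ->
  \int[m]_(x in `[0, l]) f x =
  f 0 * fine (m [set (0 : R)]) + \int[m]_(x in `]0, l[) f x + f l * fine (m [set l]).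
Proof.
move=> l0 mf fM.
have m1 (a : R) : measurable ([set a] : set (MR R)) by exact: measurable_set1.
have mO : measurable (`]0, l[%classic : set (MR R)) by exact: measurable_itv.
have i1 : m.-integrable (`[0, l]%classic : set (MR R)) (EFin \o f).
  apply: (@integrable_fin_bnd _ _ _ _ _ M) => //; exact: measurable_itv.
have s1 (a : R) : \int[m]_(x in [set a]) f x = f a * fine (m [set a]).
  rewrite (@eq_Rintegral _ _ _ _ _ (fun=> f a)); first exact: Rintegral_cst.
  by move=> x; rewrite inE/= => ->.
have e1 : `[0, l]%classic = [set (0 : R)] `|` (`]0, l[%classic `|` [set l]).
  apply/seteqP; split => x /=; rewrite !in_itv/=.
    move=> /andP[]; rewrite !le_eqVlt => /predU1P[<-|x0]; first by left.
    by move=> /predU1P[->|xl]; [right; right|right; left; rewrite x0].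
  by case=> [->|[/andP[x0 xl]|->]]; rewrite ?lexx ?ltW.
rewrite e1 Rintegral_setU ?Rintegral_setU ?s1 ?addrA//.
- apply: integrableS i1 => //; first exact: measurableU.
  by rewrite e1; exact: subsetUr.
- apply/disj_setPS => x /= [] /=; rewrite in_itv/= => /andP[_ xl] xE.
  by rewrite xE ltxx in xl.
- exact: measurableU.
- by rewrite -e1.
- apply/disj_setPS => x /= [->]; rewrite in_itv/= ltxx/=.
  by case=> // l0'; rewrite l0' ltxx in l0.
Qed.

Lemma Rintegral_supp (m : {finite_measure set (MR R) -> \bar R}) (A B : set (MR R)) (f : R -> R) :
  A `<=` B -> (forall x, B x -> ~ A x -> f x = 0) ->
  \int[m]_(x in B) f x = \int[m]_(x in A) f x.
Proof.
move=> AB f0; rewrite /Rintegral [in LHS]integral_mkcond [in RHS]integral_mkcond.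
congr fine; apply: eq_integral => x _; rewrite !patchE.
have [xA|xA] := pselect (A x); first by rewrite !mem_set//; exact: AB.
rewrite [in RHS]memNset//; case: ifPn => // /set_mem xB.
by rewrite f0.
Qed.

End end_atoms.

Section curvature_force.
Context {R : realType}.
Local Notation leb := (@lebesgue_measure R).
Variables (L : glink R).
Hypothesis hL : arclength_parametrized L.
Implicit Types (i : 'I_(ncomp L)) (k : 'I_3).

Lemma measurable_pdom i : measurable (pdom i : set (MR R)).
Proof. by rewrite /pdom /param_dom; case: (circ i); exact: measurable_itv. Qed.

Lemma subset_pdom i : `]0, clen i[%classic `<=` pdom i.
Proof.
rewrite /pdom /param_dom => x; case: (circ i); rewrite /= !in_itv/= => /andP[x0 xl];
  by rewrite ?xl ?ltW.
Qed.

Lemma pdom_subset i s : pdom i s -> 0 <= s <= clen i.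
Proof.
rewrite /pdom /param_dom; case: (circ i); rewrite /= in_itv/= => /andP[-> h] //=.
exact: ltW.
Qed.

(** Plateaus supported in []0, clen i[] are test functions, after periodization on a circle, and are
    unaffected by charge at the ends. Du Bois-Reymond's lemma then applies to the open arc, a circle
    being cut at parameter 0. *)
Lemma curvature_test_bv i k (nu : {charge set (MR R) -> \bar R}) :
  (forall phi, test_function i phi ->
     \int[leb]_(s in `[0, clen i]) (tangent i s 0 k * derive1 (phi : R -> R^o) s)
     = - charge_integral nu (pdom i) phi) ->
  exists m1 m2 : {finite_measure set (MR R) -> \bar R}, exists c0 : R,
    (forall A, measurable A -> (nu A = m1 A - m2 A)%E) /\ bv_tangent i k m1 m2 c0.
Proof.
move=> test; have [m1 [m2 nuE]] := charge_jordan nu.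
suff [c0 H] : exists c0, bv_tangent i k m1 m2 c0 by exists m1, m2, c0.
apply: curvature_bv_tangent => // a b r r0 a0 ab brl.
have smp := @smooth_plateau R a b r.
have supp : supp_in a (b + r) (plateau a b r).
  move=> s [sa|bs]; first by rewrite plateau_left// ltW.
  by rewrite plateau_right// ltW.
have l0 := clen_gt0 i.
have supp' (s : R) : ~ (0 < s < clen i) -> plateau a b r s = 0.
  move=> h; apply: supp; have [sa|as_] := ltP s a; [by left|right].
  rewrite ltNge; apply/negP => sb; apply: h.
  by rewrite (lt_le_trans a0 as_) (le_lt_trans sb brl).
pose phi := if circ i then per (clen i) (plateau a b r) else plateau a b r.
have phiE (s : R) : 0 < s < clen i -> phi s = plateau a b r s.
  by rewrite /phi => /andP[s0 sl]; case: (circ i) => //; rewrite per_id// ltW.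
have phiT : test_function i phi.
  rewrite /test_function /phi; case: (circ i); split.
  - exact: (smooth_per l0 a0 brl).
  - by move=> s; exact: per_periodic.
  - exact: smp.
  - by exists a, (b + r); split.
have phipdom s : pdom i s -> phi s = plateau a b r s.
  rewrite /phi /pdom /param_dom; case: (circ i) => //; rewrite /= in_itv/= => h.
  exact: per_id.
have phid (s : R) : 0 < s < clen i -> derive1 (phi : R -> R^o) s = dplateau a b r s.
  move=> s0l; apply: derive1E_is.
  have dp := plateau_derive a b r s.
  rewrite /phi; case: (circ i) => //.
  rewrite -(derive1E_is dp) -[derive1 _ s](@per_id _ _ l0 (derive1 (plateau a b r))).
    exact: (per_derive l0 s a0 brl supp smp).
  by case/andP: s0l => s0 sl; rewrite ltW.
transitivity (\int[leb]_(s in `[0, clen i]) (tangent i s 0 k * derive1 (phi : R -> R^o) s)).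
  apply: ae_Rintegral_eq.
  have : {ae leb, forall s : R, 0 < s < clen i -> tangent i s 0 k * dplateau a b r s =
      tangent i s 0 k * derive1 (phi : R -> R^o) s}.
    by apply: aeW => s h; rewrite phid.
  move=> /ae_itv_cc h.
  apply: (@filterS _ _ (@ae_filter_ringOfSetsType _ _ _ leb) _ _ _ h) => s hs.
  by rewrite /= in_itv.
rewrite test//; congr (- _).
rewrite (@charge_integral_sub _ _ _ nu m1 m2 (pdom i) phi 1)//; last 3 first.
- exact: measurable_pdom.
- by apply: measurable_funTS; apply: measurable_smooth; case: phiT.
- by move=> s /phipdom ->; exact: plateau_le.
have E (m : {finite_measure set (MR R) -> \bar R}) :
    \int[m]_(x in pdom i) phi x = \int[m]_(x in `]0, clen i[) plateau a b r x.
  rewrite -(@Rintegral_supp _ m _ (pdom i) (plateau a b r)) //.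
  - by apply: eq_Rintegral => s; rewrite inE => /phipdom.
  - exact: subset_pdom.
  - by move=> x _; rewrite /= in_itv/=; exact: supp'.
by rewrite !E.
Qed.

End curvature_force.

(** * First variation of length and the curvature force *)

Section first_variation_length.
Context {R : realType}.
Local Notation leb := (@lebesgue_measure R).
Variables (L : glink R).
Hypothesis hL : arclength_parametrized L.
Implicit Types (i : 'I_(ncomp L)) (k : 'I_3).

Lemma smooth_field_derive (xi : vfield L) i k s : smooth_field xi ->
  derive1 (xi i) s 0 k = derive1 (fun s => xi i s 0 k) s.
Proof.
move=> sxi; have dx : derivable (xi i) s 1.
  apply/derivable_mxP => a b; rewrite ord1.
  by have [/(_ b) sb _] := sxi i; have [] := smooth_is_derive s sb.
by rewrite !derive1E derive_mx// mxE.
Qed.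

Lemma tangent_integrable i : exists g : 'I_3 -> R -> R,
  (forall k (f : R -> R), continuous f ->
     leb.-integrable `[0, clen i] (EFin \o (fun s => g k s * f s))) /\
  {ae leb, forall s, `[0, clen i]%classic s -> forall k, tangent i s 0 k = g k s}.
Proof.
have [g [gP gT]] := tangent_density hL i; exists g; split=> [k f cf|]; last first.
  apply: (@filterS _ _ (@ae_filter_ringOfSetsType _ _ _ leb) _ _ _ (ae_itv_cc gT)) => s h.
  by rewrite /= in_itv.
have mI : measurable (`[0, clen i]%classic : set (MR R)) by exact: measurable_itv.
have [_ ig _] := gP k.
have [K HK] := continuous_itv_bounded (continuous_subspaceT cf : {within `[0, clen i], continuous _}).
have bm : [bounded f x | x in (`[0, clen i]%classic : set (MR R))].
  exists K; split; first exact: num_real.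
  by move=> x xK y /=; rewrite in_itv/= => yl; exact: le_trans (HK _ yl) (ltW xK).
have mm : measurable_fun (`[0, clen i]%classic : set (MR R)) f.
  by apply: measurable_funTS; exact: continuous_measurable_fun cf.
have ig' : leb.-integrable `[0, clen i] (EFin \o g k) by apply: integrableS ig.
by have := integrableMl mI ig' mm bm; congr integrable.
Qed.

Lemma tangent_integral_lin i k (a : R) (f h : R -> R) : continuous f -> continuous h ->
  \int[leb]_(s in `[0, clen i]) (tangent i s 0 k * (a * f s + h s)) =
  a * \int[leb]_(s in `[0, clen i]) (tangent i s 0 k * f s) +
  \int[leb]_(s in `[0, clen i]) (tangent i s 0 k * h s).
Proof.
move=> cf ch; have [g [ig gT]] := tangent_integrable i.
have mI : measurable (`[0, clen i]%classic : set (MR R)) by exact: measurable_itv.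
have gE (u : R -> R) : \int[leb]_(s in `[0, clen i]) (tangent i s 0 k * u s) =
    \int[leb]_(s in `[0, clen i]) (g k s * u s).
  apply: ae_Rintegral_eq.
  by apply: (@filterS _ _ (@ae_filter_ringOfSetsType _ _ _ leb) _ _ _ gT) => s gs /gs ->.
rewrite !gE -RintegralZl//; last exact: ig.
rewrite -RintegralD//; last 2 first.
- by have := integrableZl mI a (ig k f cf); congr integrable.
- exact: ig.
by apply: eq_Rintegral => s _; rewrite mulrDr mulrCA.
Qed.

Lemma dLenE (xi : vfield L) : smooth_field xi ->
  dLen xi = \sum_(i < ncomp L) \sum_(k < 3)
    \int[leb]_(s in `[0, clen i]) (tangent i s 0 k * derive1 (fun s => xi i s 0 k) s).
Proof.
move=> sxi; apply: eq_bigr => i _; have [g [ig gT]] := tangent_integrable i.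
have mI : measurable (`[0, clen i]%classic : set (MR R)) by exact: measurable_itv.
pose h k s := g k s * derive1 (fun s => xi i s 0 k) s.
transitivity (\int[leb]_(s in `[0, clen i]) (\sum_(k < 3) h k s)).
  apply: ae_Rintegral_eq.
  apply: (@filterS _ _ (@ae_filter_ringOfSetsType _ _ _ leb) _ _ _ gT) => s gs sl.
  by apply: eq_bigr => k _; rewrite gs// smooth_field_derive.
rewrite Rintegral_sum//; last first.
  move=> k; have [/(_ k) sk _] := sxi i; apply: ig.
  exact: smooth_continuous (smooth_derive1 sk).
apply: eq_bigr => k _; apply: ae_Rintegral_eq.
apply: (@filterS _ _ (@ae_filter_ringOfSetsType _ _ _ leb) _ _ _ gT) => s gs sl.
by rewrite /h gs.
Qed.

Lemma charge_atom (nu : {charge set (MR R) -> \bar R})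
    (m1 m2 : {finite_measure set (MR R) -> \bar R}) (a : R) :
  (forall A, measurable A -> (nu A = m1 A - m2 A)%E) ->
  fine (nu [set a]) = fine (m1 [set a]) - fine (m2 [set a]).
Proof.
have ma : measurable ([set a] : set (MR R)) by exact: measurable_set1.
by move=> ->//; rewrite fineB ?fin_num_measure.
Qed.

Lemma charge_integral_ends (nu : {charge set (MR R) -> \bar R}) (l M : R) (f : R -> R) :
  0 < l -> measurable_fun `[0, l]%classic (f : MR R -> R) ->
  (forall x, 0 <= x <= l -> `|f x| <= M) ->
  charge_integral nu `[0, l] f = f 0 * fine (nu [set (0 : R)]) +
   charge_integral nu `]0, l[ f + f l * fine (nu [set l]).
Proof.
move=> l0 mf fM; have [m1 [m2 nuE]] := charge_jordan nu.
have mO : measurable (`]0, l[%classic : set (MR R)) by exact: measurable_itv.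
have mI : measurable (`[0, l]%classic : set (MR R)) by exact: measurable_itv.
rewrite (@charge_integral_sub _ _ _ nu m1 m2 _ f M nuE mI mf); last first.
  by move=> x; rewrite /= in_itv/=; exact: fM.
rewrite (@charge_integral_sub _ _ _ nu m1 m2 _ f M nuE mO); last 2 first.
- by apply: measurable_funS mf => //; exact: subset_itv_oo_cc.
- by move=> x; rewrite /= in_itv/= => /andP[x0 xl]; apply: fM; rewrite !ltW.
rewrite (Rintegral_ends m1 l0 mf fM) (Rintegral_ends m2 l0 mf fM).
by rewrite !(charge_atom _ nuE); ring.
Qed.

(** Test functions vanish near the ends of an interval, while [phi] does not. The extra boundary
    terms of [bvt_by_parts] are the one-sided tangents, which the definition of the curvature force
    prescribes as end atoms, so they are absorbed in the integral over the closed interval. *)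
Lemma curvature_by_parts (K : force L) i k (phi : R -> R) : is_curvature_force K ->
  smooth phi -> (circ i -> forall s, phi (s + clen i) = phi s) ->
  \int[leb]_(s in `[0, clen i]) (tangent i s 0 k * derive1 (phi : R -> R^o) s) =
  - charge_integral (K i k) (pdom i) phi.
Proof.
move=> [Ktest Katoms] sphi per; have [ci|nci] := boolP (circ i).
  by apply: Ktest; split=> //; rewrite ci; exact: per.
have [m1 [m2 [c0 [nuE bvT]]]] := curvature_test_bv hL (Ktest i k).
have [c1 c2] := Katoms i nci.
have atom (f : R -> 'rV[R]_3) (x y : R) : f t @[t --> 0^'+] --> force_atom K i x ->
    f t 0 k @[t --> 0^'+] --> y -> fine (K i k [set x]) = y.
  move=> fx fy; have fx' : f t 0 k @[t --> 0^'+] --> force_atom K i x 0 k.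
    apply: (@cvg_comp _ _ _ f (fun M : 'rV[R]_3 => M 0 k) _ _ _ fx).
    exact: coord_continuous.
  have := cvg_unique _ fx' fy; rewrite mxE; apply; exact: norm_hausdorff.
have a0 : fine (K i k [set (0 : R)]) = c0.
  by apply: atom c1 _; under eq_fun do rewrite !mxE; exact: bvt_right bvT.
have al : fine (K i k [set clen i]) =
    - (c0 + (fine (m1 `]0, clen i[%classic) - fine (m2 `]0, clen i[%classic))).
  by apply: atom c2 _; under eq_fun do rewrite !mxE; exact: bvt_left bvT.
rewrite (bvt_by_parts bvT (fun x => smooth_is_derive x sphi) (smooth_continuous (smooth_derive1 sphi))).
have cphi := smooth_continuous sphi.
have [M HM] := continuous_itv_bounded (continuous_subspaceT cphi : {within `[0, clen i], continuous _}).
rewrite /pdom /param_dom (negbTE nci).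
have mO : measurable (`]0, clen i[%classic : set (MR R)) by exact: measurable_itv.
have mphi : forall D, measurable_fun D (phi : MR R -> R).
  by move=> D; apply: measurable_funTS; exact: measurable_smooth.
rewrite (charge_integral_ends _ (clen_gt0 i) (mphi _) HM) a0 al.
rewrite (@charge_integral_sub _ _ _ _ m1 m2 _ phi M nuE mO (mphi _)); last first.
  by move=> x; rewrite /= in_itv/= => /andP[x0 xl]; apply: HM; rewrite !ltW.
by ring.
Qed.

Lemma dLen_force_pair (K : force L) (xi : vfield L) : is_curvature_force K ->
  smooth_field xi -> dLen xi = - force_pair K xi.
Proof.
move=> cK sxi; rewrite dLenE// /force_pair -sumrN; apply: eq_bigr => i _.
rewrite -sumrN; apply: eq_bigr => k _; have [sk pk] := sxi i.
by apply: (curvature_by_parts _ cK) => // ci s; rewrite pk.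
Qed.

Lemma curvature_test_finite (K : force L) :
  (forall i k phi, test_function i phi ->
     \int[leb]_(s in `[0, clen i]) (tangent i s 0 k * derive1 (phi : R -> R^o) s)
     = - charge_integral (K i k) (pdom i) phi) ->
  finite_total_curvature L.
Proof.
move=> Ktest; apply: lte_sum_pinfty => i _.
have [mc mcP] := choice (fun k => curvature_test_bv hL (Ktest i k)).
have [mc2 mc2P] := choice mcP; have [c0 bvT] := choice mc2P.
have [M HM] := turning_bound hL (fun k => (bvT k).2).
apply: le_lt_trans (ltry M); apply: ub_ereal_sup => _ [s hs <-].
by rewrite lee_fin HM.
Qed.

End first_variation_length.

(** * Balance of forces *)

Section finite_measure_add.
Context d (T : measurableType d) (R : realType) (m1 m2 : {finite_measure set T -> \bar R}).

Definition finite_add : set T -> \bar R := measure_add m1 m2.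

HB.instance Definition _ := Measure.on finite_add.

Let finite_add_fin : fin_num_fun finite_add.
Proof.
by move=> U mU; rewrite /finite_add measure_addE fin_numD !fin_num_measure.
Qed.

HB.instance Definition _ := Measure_isFinite.Build _ _ _ finite_add finite_add_fin.

End finite_measure_add.

Section measures_from_tests.
Context {R : realType}.
Variables (m1 m2 : {finite_measure set (MR R) -> \bar R}) (l : R).
Hypotheses (l0 : 0 < l)
  (test : forall a b r : R, 0 < r -> 0 < a -> a <= b -> b + r < l ->
    \int[m1]_(s in `]0, l[) plateau a b r s = \int[m2]_(s in `]0, l[) plateau a b r s).

Let cum_diff (a b : R) : 0 < a -> a <= b -> b < l ->
  cum m1 l b - cum m1 l a = cum m2 l b - cum m2 l a.
Proof.
move=> a0 ab bl; pose r n : R := (l - b) / n.+2%:R.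
have lb : 0 < l - b by rewrite subr_gt0.
have r0 n : 0 < r n by rewrite divr_gt0.
have brl n : b + r n < l by rewrite addrC -ltrBrDr ltr_pdivrMr// ltr_pMr// ltr1n.
have rcvg : r n @[n --> \oo] --> (0 : R).
  rewrite -[X in _ --> X](mulr0 (l - b)); apply: cvgMl_tmp.
  by have := @cvg_harmonic R; rewrite -cvg_shiftS.
have c1 := @plateau_cvg _ l m1 a b r a0 ab bl r0 rcvg.
have c2 := @plateau_cvg _ l m2 a b r a0 ab bl r0 rcvg.
have E : (fun n => \int[m1]_(s in `]0, l[) plateau a b (r n) s) =
    (fun n => \int[m2]_(s in `]0, l[) plateau a b (r n) s).
  by apply/funext => n; exact: test.
rewrite E in c1; exact: (cvg_unique (@norm_hausdorff _ _) c1 c2).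
Qed.

Let cum_small (m : {finite_measure set (MR R) -> \bar R}) (a : R) : a <= 0 -> cum m l a = 0.
Proof.
move=> a0; rewrite /cum (_ : _ `&` _ = set0) ?measure0//.
apply/seteqP; split => x //= []; rewrite !in_itv/= => xa /andP[x0 _].
by have := lt_le_trans x0 (le_trans xa a0); rewrite ltxx.
Qed.

Let cum_large (m : {finite_measure set (MR R) -> \bar R}) (a : R) : l <= a ->
  cum m l a = fine (m `]0, l[%classic).
Proof.
move=> la; rewrite /cum; congr (fine (m _)); apply/setIidr => x /=.
by rewrite !in_itv/= => /andP[_ /ltW xl]; exact: le_trans la.
Qed.

Let cum_eq_in (b : R) : 0 < b < l -> cum m1 l b = cum m2 l b.
Proof.
move=> /andP[b0 bl]; apply/eqP; rewrite -subr_eq0 -normr_le0; apply/ler_addgt0Pl => e e0.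
rewrite addr0; have e2 : 0 < e / 2 by rewrite divr_gt0.
have [d1 /andP[d10 _] h1] := cum_right m1 e2 l0.
have [d2 /andP[d20 _] h2] := cum_right m2 e2 l0.
pose a := Num.min b (Num.min d1 d2).
have a0 : 0 < a by rewrite !lt_min b0 d10.
have ab : a <= b by rewrite ge_min lexx.
have ad1 : a <= d1 by rewrite !ge_min lexx orbT.
have ad2 : a <= d2 by rewrite !ge_min lexx !orbT.
have h := cum_diff a0 ab bl.
have := cum_nd m1 l ad1; have := cum_nd m2 l ad2.
have /andP[c1 _] := cum_bounds m1 l a; have /andP[c2 _] := cum_bounds m2 l a.
by move=> *; rewrite ler_norml; apply/andP; split; lra.
Qed.

Let cum_eq (b : R) : cum m1 l b = cum m2 l b.
Proof.
have [b0|b0] := leP b 0; first by rewrite !cum_small.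
have [lb|bl] := leP l b; last by apply: cum_eq_in; rewrite b0.
rewrite !cum_large//; apply/eqP; rewrite -subr_eq0 -normr_le0; apply/ler_addgt0Pl => e e0.
rewrite addr0; have [d1 /andP[d10 d1l] h1] := cum_left m1 e0 l0.
have [d2 /andP[d20 d2l] h2] := cum_left m2 e0 l0.
pose a := Num.min d1 d2.
have a0 : 0 < a by rewrite lt_min d10.
have al : a < l by rewrite gt_min d1l.
have ad1 : l - d1 <= l - a by rewrite lerD2l lerN2 ge_min lexx.
have ad2 : l - d2 <= l - a by rewrite lerD2l lerN2 ge_min lexx orbT.
have h : cum m1 l (l - a) = cum m2 l (l - a).
  by apply: cum_eq_in; rewrite subr_gt0 al gtrBl a0.
have := cum_nd m1 l ad1; have := cum_nd m2 l ad2.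
have /andP[_ c1] := cum_bounds m1 l (l - a); have /andP[_ c2] := cum_bounds m2 l (l - a).
by move=> *; rewrite ler_norml; apply/andP; split; lra.
Qed.

(** Narrow plateaus give equal masses to all []a, b]] inside the interval. Letting [a] tend to 0 and
    [b] to [l] equates the distribution functions, and half-open intervals form a system stable
    under intersection that generates the Borel sets. *)
Lemma measures_from_tests (B : set (MR R)) : measurable B -> B `<=` `]0, l[%classic ->
  m1 B = m2 B.
Proof.
move=> mB Bl; have mO : measurable (`]0, l[%classic : set (MR R)) by exact: measurable_itv.
have -> : m1 B = mrestr m1 mO B by rewrite /mrestr setIidl.
have -> : m2 B = mrestr m2 mO B by rewrite /mrestr setIidl.
have mrE (m : {finite_measure set (MR R) -> \bar R}) (a b : R) : a <= b ->
    mrestr m mO `]a, b]%classic = (cum m l b - cum m l a)%:E.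
  move=> ab; have mS (s : R) : measurable (`]-oo, s]%classic `&` `]0, l[%classic : set (MR R)).
    by apply: measurableI => //; exact: measurable_itv.
  have mab : measurable (`]a, b]%classic `&` `]0, l[%classic : set (MR R)).
    by apply: measurableI => //; exact: measurable_itv.
  rewrite /mrestr -[LHS]fineK ?fin_num_measure//; congr (_%:E); rewrite /cum.
  have -> : `]-oo, b]%classic `&` `]0, l[%classic = (`]-oo, a]%classic `&` `]0, l[%classic)
      `|` (`]a, b]%classic `&` `]0, l[%classic) :> set R.
    rewrite -setIUl; congr (_ `&` _); apply/seteqP; split => x /=; rewrite !in_itv/=.
      by move=> xb; have [xa|ax] := leP x a; [left|right].
    by case=> [xa|/andP[_ //]]; exact: le_trans ab.
  rewrite measureU//; first by rewrite fineD ?fin_num_measure// addrC addKr.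
  apply/seteqP; split => x //= [[]]; rewrite !in_itv/= => xa _ [/andP[ax _] _].
  by rewrite ltNge xa in ax.
pose n1 : {measure set (MR R) -> \bar R} := mrestr m1 mO.
pose n2 : {measure set (MR R) -> \bar R} := mrestr m2 mO.
apply: (@measure_unique _ R (MR R) (@ocitv R) (fun n => `](- n%:R), n%:R]%classic) _ _ _ _ n1 n2) => //.
- exact: ocitvI.
- by move=> n; exact: is_ocitv.
- apply/seteqP; split => // x _; exists (Num.truncn `|x|).+1 => //.
  have := truncnS_gt `|x|; rewrite ltr_norml => /andP[h1 h2].
  by rewrite /= in_itv/= h1 ltW.
- move=> X /ocitvP[->|[[a b] /= ab ->]]; first by rewrite !measure0.
  by rewrite !mrE ?ltW// !cum_eq.
- move=> n; have n0 : - n%:R <= n%:R :> R by rewrite lerNl (le_trans _ (ler0n R n))// oppr_le0.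
  by rewrite [X in (X < _)%E](mrE m1 _ _ n0) ltry.
Qed.

End measures_from_tests.

Section balance.
Context {R : realType}.
Variables (L : glink R).
Implicit Types (i : 'I_(ncomp L)) (k : 'I_3) (K F : force L).

Lemma charge_integral_opp (nu1 nu2 : {charge set (MR R) -> \bar R}) D (M : R) (f : R -> R) :
  measurable D -> measurable_fun D (f : MR R -> R) -> (forall x, D x -> `|f x| <= M) ->
  (forall B, measurable B -> B `<=` D -> (- nu1 B)%E = nu2 B) ->
  - charge_integral nu1 D f = charge_integral nu2 D f.
Proof.
move=> mD mf fM nu12.
have [a1 [a2 aE]] := charge_jordan nu1; have [b1 [b2 bE]] := charge_jordan nu2.
rewrite (@charge_integral_sub _ _ _ nu1 a1 a2 D f M)//.
rewrite (@charge_integral_sub _ _ _ nu2 b1 b2 D f M)//.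
suff : \int[measure_add a1 b1]_(x in D) f x = \int[measure_add a2 b2]_(x in D) f x.
  rewrite !(@Rintegral_measure_add _ _ _ _ _ D M f)//.
  by lra.
congr fine; apply: eq_measure_integral => B mB BD.
transitivity (a1 B + b1 B)%E; first exact: measure_addE.
transitivity (a2 B + b2 B)%E; last by symmetry; exact: measure_addE.
have := nu12 B mB BD; rewrite aE// bE//.
rewrite -[a1 B]fineK ?fin_num_measure// -[a2 B]fineK ?fin_num_measure//.
rewrite -[b1 B]fineK ?fin_num_measure// -[b2 B]fineK ?fin_num_measure//.
rewrite -!EFinB -EFinN -!EFinD => -[h]; congr (_%:E); lra.
Qed.

Lemma VF_component (xi : vfield L) i k : VF xi ->
  {within `[0, clen i], continuous (fun s => xi i s 0 k)}.
Proof.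
move=> vxi s; have [/(_ s) h _] := vxi i.
apply: (@cvg_comp _ _ _ (xi i) (fun M : 'rV[R]_3 => M 0 k) _ _ _ h).
exact: coord_continuous.
Qed.

Lemma VF_component_bnd (xi : vfield L) i k : VF xi ->
  exists M : R, forall s, 0 <= s <= clen i -> `|xi i s 0 k| <= M.
Proof. by move=> vxi; exact: continuous_itv_bounded (@VF_component xi i k vxi). Qed.

Lemma VF_component_meas (xi : vfield L) i k : VF xi ->
  measurable_fun `[0, clen i]%classic ((fun s => xi i s 0 k) : MR R -> R).
Proof.
move=> vxi; apply: subspace_continuous_measurable_fun; first exact: measurable_itv.
exact: VF_component.
Qed.

(** On an interval each coordinate integral splits into two end atoms and an open part, and the open
    parts cancel. On a circle the hypothesis covers every Borel set of parameters, so that nothing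
    remains. *)
Lemma force_pair_diff K F (xi : vfield L) : VF xi ->
  (forall i k (B : set (MR R)), measurable B -> B `<=` pdom i ->
     (~~ circ i -> forall b, ~ B (epar i b)) -> (- K i k B)%E = F i k B) ->
  - force_pair K xi - force_pair F xi =
  \sum_(i < ncomp L | ~~ circ i) \sum_(b : bool)
    dot (xi i (epar i b)) (- force_atom K i (epar i b) - force_atom F i (epar i b)).
Proof.
move=> vxi KF; rewrite /force_pair -!sumrN -big_split/= [RHS]big_mkcond/=.
apply: eq_bigr => i _; rewrite -!sumrN -big_split/=; case: ifPn => ci.
  rewrite exchange_big/= [RHS](_ : _ = \sum_(k < 3) \sum_(b : bool) xi i (epar i b) 0 k *
     (- force_atom K i (epar i b) - force_atom F i (epar i b)) 0 k); last by rewrite exchange_big.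
  apply: eq_bigr => k _; have [M HM] := VF_component_bnd i k vxi.
  have mf := @VF_component_meas xi i k vxi.
  have mO : measurable (`]0, clen i[%classic : set (MR R)) by exact: measurable_itv.
  rewrite /pdom /param_dom (negbTE ci).
  rewrite !(charge_integral_ends _ (clen_gt0 i) mf HM).
  have h : - charge_integral (K i k) `]0, clen i[ (fun s => xi i s 0 k) =
      charge_integral (F i k) `]0, clen i[ (fun s => xi i s 0 k).
    apply: (@charge_integral_opp _ _ _ M) => //.
    - by apply: measurable_funS mf => //; exact: subset_itv_oo_cc.
    - by move=> x; rewrite /= in_itv/= => /andP[x0 xl]; apply: HM; rewrite !ltW.
    - move=> B mB Bl; apply: KF => //.
        by apply: subset_trans Bl _; exact: subset_pdom.
      by move=> _ b /Bl; rewrite /epar /end_param; case: b; rewrite /= in_itv/= ltxx ?andbF.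
  by rewrite big_bool/= /epar/= !mxE -h; ring.
rewrite big1// => k _; apply/eqP; rewrite subr_eq0; apply/eqP.
have [M HM] := VF_component_bnd i k vxi.
apply: (@charge_integral_opp _ _ _ M) => //.
- exact: measurable_pdom.
- apply: measurable_funS (@VF_component_meas xi i k vxi); first exact: measurable_itv.
  by move=> s /pdom_subset; rewrite /= in_itv.
- by move=> s /pdom_subset; exact: HM.
- by move=> B mB Bl; apply: KF => // h; rewrite h in ci.
Qed.

Lemma smooth_field_VF (xi : vfield L) : smooth_field xi -> VF xi.
Proof.
move=> sxi i; have [sk pk] := sxi i; split; last by move=> ci; rewrite -[clen i]add0r pk.
apply: continuous_subspaceT => s; apply: differentiable_continuous; apply/derivable1_diffP.
apply/derivable_mxP => a k; rewrite ord1.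
by have [] := smooth_is_derive s (sk k).
Qed.

Definition localized i (phi : R -> R) (v : 'rV[R]_3) : vfield L :=
  fun j s => if j == i then phi s *: v else 0.

Lemma localized_VF i phi v : continuous phi -> (circ i -> phi (clen i) = phi 0) ->
  VF (localized i phi v).
Proof.
move=> cphi perphi j; rewrite /localized; split; last by case: eqP => // -> /perphi ->.
case: eqP => _; last by apply: continuous_subspaceT => s; exact: cst_continuous.
by apply: continuous_subspaceT => s; apply: cvgZr_tmp; exact: cphi.
Qed.

Lemma localized_coord i phi v j k :
  (fun s => localized i phi v j s 0 k) = (fun s => (if j == i then v 0 k else 0) * phi s).
Proof.
by apply/funext => s; rewrite /localized; case: eqP => _; rewrite mxE ?mul0r// mulrC.
Qed.

Lemma localized_smooth i phi v : smooth phi -> (circ i -> forall s, phi (s + clen i) = phi s) ->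
  smooth_field (localized i phi v).
Proof.
move=> sphi pphi j; split=> [k|cj s].
  by rewrite localized_coord; apply: smoothM sphi; exact: smooth_cst.
by rewrite /localized; case: eqP => // ji; rewrite ji in cj *; rewrite pphi.
Qed.

Lemma force_pair_localized F i phi v : continuous phi ->
  force_pair F (localized i phi v) =
  \sum_(k < 3) v 0 k * charge_integral (F i k) (pdom i) phi.
Proof.
move=> cphi; rewrite /force_pair (bigD1 i)//= [X in _ + X]big1 ?addr0; last first.
  move=> j ji; rewrite big1// => k _.
  rewrite (_ : (fun s => _) = (fun=> 0)); last first.
    by apply/funext => s; rewrite /localized (negbTE ji) mxE.
  by rewrite /charge_integral !(Rintegral_cst _ (measurable_pdom j)) !mul0r subrr.
apply: eq_bigr => k _; rewrite /localized eqxx.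
have mP := measurable_pdom i.
have [M HM] := continuous_itv_bounded (continuous_subspaceT cphi : {within `[0, clen i], continuous phi}).
have mphi : measurable_fun (pdom i : set (MR R)) (phi : MR R -> R).
  by apply: measurable_funTS; exact: continuous_measurable_fun.
have bphi s : pdom i s -> `|phi s| <= M by move/pdom_subset; exact: HM.
have [m1 [m2 mE]] := charge_jordan (F i k).
rewrite (@charge_integral_sub _ _ _ _ m1 m2 _ phi M mE)//.
have eZ (m : {finite_measure set (MR R) -> \bar R}) :
    \int[m]_(s in pdom i) (phi s *: v) 0 k = v 0 k * \int[m]_(s in pdom i) phi s.
  rewrite -RintegralZl//; last exact: (@integrable_fin_bnd _ _ _ _ _ M).
  by apply: eq_Rintegral => s _; rewrite mxE mulrC.
rewrite (@charge_integral_sub _ _ _ _ m1 m2 _ _ (M * `|v 0 k|) mE)//.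
- by rewrite !eZ mulrBr.
- under eq_fun do rewrite mxE; exact: measurable_funM.
- by move=> s /bphi h; rewrite mxE normrM ler_wpM2r.
Qed.

Lemma force_pair_coord F i k phi : continuous phi ->
  force_pair F (localized i phi (delta_mx 0 k)) = charge_integral (F i k) (pdom i) phi.
Proof.
move=> cphi; rewrite force_pair_localized// (bigD1 k)//= mxE !eqxx mul1r big1 ?addr0//.
by move=> j jk; rewrite mxE eqxx (negbTE jk) mul0r.
Qed.

(** With Jordan decompositions [k1 - k2] of [K] and [f1 - f2] of [F], the claim becomes equality of
    the positive measures [k1 + f1] and [k2 + f2]. Plateaus vanish at the ends, so the fields they
    localize are compatible whatever the constraints. *)
Lemma balanced_interior K F i k (B : set (MR R)) : balanced_on_VFc K F ->
  measurable B -> B `<=` pdom i -> (~~ circ i -> forall b, ~ B (epar i b)) ->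
  (- K i k B)%E = F i k B.
Proof.
move=> bal mB Bp Bend; have l0 := clen_gt0 i.
have [k1 [k2 kE]] := charge_jordan (K i k); have [f1 [f2 fE]] := charge_jordan (F i k).
have mO : measurable (`]0, clen i[%classic : set (MR R)) by exact: measurable_itv.
have mP := measurable_pdom i.
pose n1 : {finite_measure set (MR R) -> \bar R} := finite_add k1 f1.
pose n2 : {finite_measure set (MR R) -> \bar R} := finite_add k2 f2.
have n1E A : n1 A = (k1 A + f1 A)%E by exact: measure_addE.
have n2E A : n2 A = (k2 A + f2 A)%E by exact: measure_addE.
have tst (phi : R -> R) : continuous phi -> (circ i -> phi (clen i) = phi 0) ->
    (~~ circ i -> phi 0 = 0 /\ phi (clen i) = 0) ->
    \int[n1]_(s in pdom i) phi s = \int[n2]_(s in pdom i) phi s.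
  move=> cphi pphi zphi.
  have [M HM] := continuous_itv_bounded (continuous_subspaceT cphi : {within `[0, clen i], continuous phi}).
  have mphi : measurable_fun (pdom i : set (MR R)) (phi : MR R -> R).
    by apply: measurable_funTS; exact: continuous_measurable_fun.
  have bphi s : pdom i s -> `|phi s| <= M by move/pdom_subset; exact: HM.
  have -> : \int[n1]_(s in pdom i) phi s = \int[k1]_(s in pdom i) phi s + \int[f1]_(s in pdom i) phi s.
    exact: (Rintegral_measure_add k1 f1 mP mphi bphi).
  have -> : \int[n2]_(s in pdom i) phi s = \int[k2]_(s in pdom i) phi s + \int[f2]_(s in pdom i) phi s.
    exact: (Rintegral_measure_add k2 f2 mP mphi bphi).
  have := bal (localized i phi (delta_mx 0 k)).
  rewrite !force_pair_coord//.
  rewrite (@charge_integral_sub _ _ _ _ k1 k2 _ phi M kE)//.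
  rewrite (@charge_integral_sub _ _ _ _ f1 f2 _ phi M fE)//.
  move=> h; suff : VFc (localized i phi (delta_mx 0 k)) by move/h; lra.
  split; first exact: localized_VF.
  move=> j b cj; rewrite /localized; case: eqP => [ji|_]; last exact: mem0v.
  rewrite ji in b cj *; have [z1 z2] := zphi cj.
  by rewrite /epar /end_param; case: b; rewrite ?z1 ?z2 scale0r mem0v.
have inner (C : set (MR R)) : measurable C -> C `<=` `]0, clen i[%classic ->
    n1 C = n2 C.
  apply: (@measures_from_tests _ n1 n2 _ l0) => // a b r r0 a0 ab brl.
  have smp := @smooth_plateau R a b r; have cp := smooth_continuous smp.
  have p0 : plateau a b r 0 = 0 by rewrite plateau_left// ltW.
  have pl : plateau a b r (clen i) = 0 by rewrite plateau_right// ltW.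
  have := tst (plateau a b r) cp (fun _ => etrans pl (esym p0)) (fun _ => conj p0 pl).
  have E (m : {finite_measure set (MR R) -> \bar R}) :
      \int[m]_(x in pdom i) plateau a b r x = \int[m]_(x in `]0, clen i[) plateau a b r x.
    apply: Rintegral_supp => [|x /pdom_subset /andP[x0 xl] nx]; first exact: subset_pdom.
    have [xl'|lx] := ltP x (clen i); last first.
      by rewrite plateau_right// (le_trans _ lx)// ltW.
    move: x0; rewrite le_eqVlt => /predU1P[<-//|x0].
    by exfalso; apply: nx; rewrite /= in_itv/= x0.
  by rewrite !E.
suff : n1 B = n2 B.
  rewrite n1E n2E kE// fE//.
  rewrite -[k1 B]fineK ?fin_num_measure// -[k2 B]fineK ?fin_num_measure//.
  rewrite -[f1 B]fineK ?fin_num_measure// -[f2 B]fineK ?fin_num_measure//.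
  rewrite -!EFinB -EFinN -!EFinD => -[h]; congr (_%:E); lra.
have [ci|nci] := boolP (circ i); last first.
  apply: inner => // s Bs; have /andP[s0 sl] := pdom_subset (Bp _ Bs).
  rewrite /= in_itv/= !lt_neqAle s0 sl !andbT; apply/andP; split; apply/eqP => e.
    by apply: (Bend nci false); rewrite /epar/= e.
  by apply: (Bend nci true); rewrite /epar/= -e.
have m0 : measurable ([set 0] : set (MR R)) by exact: measurable_set1.
have pE : pdom i = [set 0] `|` `]0, clen i[%classic.
  rewrite /pdom /param_dom ci; apply/seteqP; split => x /=; rewrite !in_itv/=.
    by move=> /andP[]; rewrite le_eqVlt => /predU1P[<-|->]; [left|right].
  by case=> [->|/andP[/ltW -> ->]//]; rewrite lexx.
have dj (A : set R) : A `<=` [set 0] -> A `&` `]0, clen i[%classic = set0.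
  move=> A0; apply/seteqP; split => x //= [/A0 ->]; rewrite /= in_itv/= ltxx//.
(* Plateaus miss the cut point of a circle. The constant field is admissible there and compares
   total masses, hence the atoms at 0. *)
have atom0 : n1 [set 0] = n2 [set 0].
  have nci : ~~ circ i -> (1 : R) = 0 /\ (1 : R) = 0 by rewrite ci.
  have := tst (fun=> 1) (fun s => @cst_continuous _ _ _ s) (fun _ => erefl) nci.
  rewrite !Rintegral_cst// !mul1r.
  have hU (m : {finite_measure set (MR R) -> \bar R}) :
      fine (m (pdom i)) = fine (m [set 0]) + fine (m `]0, clen i[%classic).
    by rewrite pE measureU// ?dj// fineD ?fin_num_measure.
  rewrite (hU n1) (hU n2) (inner _ mO (@subset_refl _ _)) => /addIr h.
  by rewrite -[LHS]fineK ?fin_num_measure// h fineK// fin_num_measure.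
have mB0 : measurable (B `&` [set 0]) by exact: measurableI.
have mBO : measurable (B `&` `]0, clen i[%classic) by exact: measurableI.
have dB : (B `&` [set 0]) `&` (B `&` `]0, clen i[%classic) = set0.
  by rewrite setIACA setIid dj// setI0.
rewrite -(setIidl Bp) pE setIUr !measureU//; congr (_ + _)%E.
  have [B0|nB0] := pselect (B 0).
    suff -> : B `&` [set 0] = [set 0] by exact: atom0.
    by apply/setIidr => x ->.
  suff -> : B `&` [set 0] = set0 by rewrite !measure0.
  by apply/seteqP; split => x //= [Bx x0]; apply: nB0; rewrite -x0.
by apply: inner => //; exact: subIsetr.
Qed.

(** A smooth field equal to [v] at the chosen end, 0 at the other end and along every other
    component isolates the required term in [force_pair_diff]. Balance is assumed on smooth fields
    only, as that is what criticality provides. *)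
Lemma balanced_normal K F i b (v : 'rV[R]_3) :
  (forall i k (B : set (MR R)), measurable B -> B `<=` pdom i ->
     (~~ circ i -> forall b, ~ B (epar i b)) -> (- K i k B)%E = F i k B) ->
  (forall xi : vfield L, smooth_field xi -> compatible xi -> - force_pair K xi = force_pair F xi) ->
  ~~ circ i -> v \in adir i b -> dot v (- force_atom K i (epar i b) - force_atom F i (epar i b)) = 0.
Proof.
move=> inner bal ci vb; have l0 := clen_gt0 i.
(* A step spread over the whole arc, rising towards the end [clen i] or falling from the end 0. *)
pose phi (s : R) : R := if b then step ((clen i)^-1 * s + 0) else step (- (clen i)^-1 * s + 1).
have sphi : smooth phi.
  by rewrite /phi; case: b {vb phi}; exact: smooth_affine smooth_stepf.
have cphi := smooth_continuous sphi.
have phib : phi (epar i b) = 1.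
  rewrite /phi /epar; case: b {vb phi sphi cphi} => /=; rewrite step_ge1//.
    by rewrite mulVf ?addr0// gt_eqF.
  by rewrite mulr0 add0r.
have phinb : phi (epar i (~~ b)) = 0.
  rewrite /phi /epar; case: b {vb phi sphi cphi phib} => /=; rewrite step_le0//.
    by rewrite mulr0 addr0.
  by rewrite mulNr mulVf ?gt_eqF// addNr.
have lVF : VF (localized i phi v) by apply: localized_VF => //; rewrite (negbTE ci).
have lVFc : compatible (localized i phi v).
  move=> j b' cj; rewrite /localized; case: eqP => [ji|_]; last exact: mem0v.
  rewrite ji in b' cj *; have [->|bb'] := eqVneq b' b; first by rewrite phib scale1r.
  by rewrite [b'](_ : _ = ~~ b) ?phinb ?scale0r ?mem0v//; case: b' b bb' {vb phi sphi cphi phib phinb lVF} => [] [].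
have := force_pair_diff lVF inner.
rewrite bal//; last by apply: (localized_smooth v sphi); rewrite (negbTE ci).
rewrite subrr (bigD1 i)//= [X in _ + X]big1 ?addr0; last first.
  by move=> j /andP[_ ji]; rewrite big1// => b' _; rewrite /localized (negbTE ji) dot0l.
rewrite (bigD1 b)//= [X in _ + X]big1 ?addr0; last first.
  move=> b' bb'; rewrite /localized eqxx [b'](_ : _ = ~~ b) ?phinb ?scale0r ?dot0l//.
  by case: b' b bb' {vb phi sphi cphi phib phinb lVF lVFc} => [] [].
by rewrite /localized eqxx phib scale1r.
Qed.

(** The converse uses that a compatible field takes its end values in [adir], where the remaining
    atoms of [force_pair_diff] are invisible. *)
Lemma balanced_atoms K F : balanced_on_VFc K F <-> balanced_upto_normal_atoms K F.
Proof.
split=> [bal|[inner atoms] xi [vxi cxi]].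
    have inner i k B := @balanced_interior K F i k B bal.
  split=> [//|i b ci v]; apply: balanced_normal => // xi sxi cxi.
  by apply: bal; split=> //; exact: smooth_field_VF.
apply/eqP; rewrite -subr_eq0 (force_pair_diff vxi)//.
by rewrite big1// => i ci; rewrite big1// => b _; apply: atoms => //; exact: cxi.
Qed.

End balance.

(** * First variation of the thickness *)

Section clamp_continuity.
Context {R : realType}.

Lemma continuous_clamp (l : R) : continuous (clamp l).
Proof.
move=> s; apply: (@continuous_max R R (fun=> 0) (fun s => Num.min s l)).
  exact: cst_continuous.
apply: (@continuous_min R R id (fun=> l)); last exact: cst_continuous.
exact: cvg_id.
Qed.

Lemma continuous_comp_clamp (T : topologicalType) (l : R) (f : R -> T) : 0 <= l ->
  {within `[0, l], continuous f} -> continuous (f \o clamp l).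
Proof.
move=> l0 /subspace_continuousP cf s.
have cl : `[0, l]%classic (clamp l s) by rewrite /= in_itv/= clamp_itv.
apply: cvg_comp (cf _ cl) => A hA.
have h : \forall t \near s, `[0, l]%classic (clamp l t) -> A (clamp l t).
  exact: @continuous_clamp l s _ hA.
change (\forall t \near s, A (clamp l t)).
by apply: filterS h => t; apply; rewrite /= in_itv/= clamp_itv.
Qed.

Record uc1 (f : R -> R) : Prop := Uc1 {
  uc1_bnd : exists K : R, forall s, `|f s| <= K;
  uc1_meas : measurable_fun setT (f : MR R -> R);
  uc1_cont : forall e : R, 0 < e -> exists2 d : R, 0 < d &
    forall s s', `|s - s'| < d -> `|f s - f s'| < e }.

Lemma clamp_dist l (s t : R) : `|clamp l s - clamp l t| <= `|s - t|.
Proof.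
have h1 := ler_norm (s - t); have h2 := ler_norm (t - s); rewrite distrC in h2.
rewrite ler_norml /clamp; case: (leP s l) => ?; case: (leP t l) => ?;
  case: (leP 0 s) => ?; case: (leP 0 t) => ?; case: (leP 0 l) => ?; apply/andP; split; lra.
Qed.

(** Heine-Cantor on the segment; clamping does not increase distances and carries the modulus to the
    whole line. *)
Lemma uc1_clamp (l : R) (f : R -> R) : 0 < l -> {within `[0, l], continuous f} ->
  uc1 (f \o clamp l).
Proof.
move=> l0 cf; have cg := continuous_comp_clamp (ltW l0) cf; split.
- have [K HK] := continuous_itv_bounded cf.
  by exists K => s; apply: HK; exact: clamp_itv (ltW l0).
- exact: continuous_measurable_fun.
move=> e e0; have e2 : 0 < e / 2 by rewrite divr_gt0.
pose g := f \o clamp l.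
pose P (d s : R) := forall t, `|s - t| < d -> `|g s - g t| < e.
have cov := (compact_near_coveringP _).1 (@segment_compact R 0 l).
have : \forall d \near 0^'+, `[0, l]%classic `<=` P d.
  apply: cov => x _.
  have : \forall t \near x, `|g x - g t| < e / 2 by move: (cg x) => /cvgrPdist_lt; exact.
  move=> /nbhs_ballP[r /= r0 gr].
  have r2 : 0 < r / 2 by rewrite divr_gt0.
  exists (ball x (r / 2), [set d | d < r / 2]) => /=.
    by split; [exact: nbhsx_ballx|exact: nbhs_right_lt].
  move=> [y d] /= [xy dr] t yt.
  have h1 : `|g x - g y| < e / 2 by apply: gr; rewrite /ball/= (lt_trans xy)//; lra.
  have h2 : `|g x - g t| < e / 2.
    apply: gr; rewrite /ball/=; apply: le_lt_trans (ler_distD y _ _) _.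
    by rewrite /ball/= in xy; lra.
  by apply: le_lt_trans (ler_distD (g x) _ _) _; rewrite (distrC (g y)); lra.
move=> H; near (at_right (0 : R)) => d.
have d0 : 0 < d by near: d; exact: nbhs_right_gt.
have Pd : `[0, l]%classic `<=` P d by near: d.
exists d => // s t st.
have := Pd (clamp l s) _ (clamp l t).
rewrite /g/= !(@clamp_id _ _ (clamp l _)) ?clamp_itv ?(ltW l0)//; apply.
  by rewrite in_itv/= clamp_itv ?ltW.
exact: le_lt_trans (clamp_dist _ _ _) st.
Unshelve. all: by end_near. Qed.

End clamp_continuity.

Section uniformly_continuous_pairs.
Context {R : realType}.
Implicit Types f g : R * R -> R.

Lemma uc_fst (f : R -> R) : uc1 f -> uc (fun z => f z.1).
Proof.
move=> [[K fK] mf cf]; split.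
- by exists K => z.
- exact: measurableT_comp mf measurable_fst.
- by move=> e /cf[d d0 fd]; exists d => // z z' h _; exact: fd.
Qed.

Lemma uc_snd (f : R -> R) : uc1 f -> uc (fun z => f z.2).
Proof.
move=> [[K fK] mf cf]; split.
- by exists K => z.
- exact: measurableT_comp mf measurable_snd.
- by move=> e /cf[d d0 fd]; exists d => // z z' _; exact: fd.
Qed.

Lemma ucc (c : R) : uc (fun=> c).
Proof.
split; first by exists `|c|.
  exact: measurable_cst.
by move=> e e0; exists 1 => // *; rewrite subrr normr0.
Qed.

Lemma ucD f g : uc f -> uc g -> uc (fun z => f z + g z).
Proof.
move=> [[K fK] mf cf] [[M gM] mg cg]; split.
- by exists (K + M) => z; apply: le_trans (ler_normD _ _) _; rewrite lerD.
- exact: measurable_funD.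
move=> e e0; have e2 : 0 < e / 2 by rewrite divr_gt0.
have [d d0 fd] := cf _ e2; have [d' d'0 gd] := cg _ e2.
exists (Num.min d d'); first by rewrite lt_min d0.
move=> z z'; rewrite !lt_min => /andP[a1 a2] /andP[b1 b2].
have h1 := fd _ _ a1 b1; have h2 := gd _ _ a2 b2.
rewrite (_ : _ - _ = (f z - f z') + (g z - g z')); last by ring.
by apply: le_lt_trans (ler_normD _ _) _; lra.
Qed.

Lemma ucM f g : uc f -> uc g -> uc (fun z => f z * g z).
Proof.
move=> [[K fK] mf cf] [[M gM] mg cg]; split.
- by exists (K * M) => z; rewrite normrM ler_pM.
- exact: measurable_funM.
have K0 : 0 <= K := le_trans (normr_ge0 _) (fK 0).
have M0 : 0 <= M := le_trans (normr_ge0 _) (gM 0).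
move=> e e0; have C0 : 0 < K + M + 1 by lra.
have e2 : 0 < e / (K + M + 1) by rewrite divr_gt0.
have [d d0 fd] := cf _ e2; have [d' d'0 gd] := cg _ e2.
exists (Num.min d d'); first by rewrite lt_min d0.
move=> z z'; rewrite !lt_min => /andP[a1 a2] /andP[b1 b2].
have h1 := ltW (fd _ _ a1 b1); have h2 := ltW (gd _ _ a2 b2).
rewrite (_ : _ - _ = f z * (g z - g z') + (f z - f z') * g z'); last by ring.
apply: le_lt_trans (ler_normD _ _) _; rewrite !normrM.
apply: (@le_lt_trans _ _ (K * (e / (K + M + 1)) + (e / (K + M + 1)) * M)).
  by rewrite lerD// ler_pM.
rewrite [ltRHS](_ : e = (K + M + 1) * (e / (K + M + 1))); last first.
  by rewrite mulrCA divff ?mulr1// gt_eqF.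
set u := e / (K + M + 1) in e2 *.
by nra.
Qed.

Lemma ucN f : uc f -> uc (fun z => - f z).
Proof. by move=> uf; under eq_fun do rewrite -mulN1r; apply: ucM => //; exact: ucc. Qed.

Lemma uc_max f g : uc f -> uc g -> uc (fun z => Num.max (f z) (g z)).
Proof.
move=> [[K fK] mf cf] [[M gM] mg cg]; split.
- exists (K + M) => z; have := fK z; have := gM z.
  have := normr_ge0 (f z); have := normr_ge0 (g z).
  by case: (leP (f z) (g z)) => *; lra.
- exact: measurable_maxr.
move=> e e0; have [d d0 fd] := cf _ e0; have [d' d'0 gd] := cg _ e0.
exists (Num.min d d'); first by rewrite lt_min d0.
move=> z z'; rewrite !lt_min => /andP[a1 a2] /andP[b1 b2].
have := fd _ _ a1 b1; have := gd _ _ a2 b2; rewrite !ltr_norml => /andP[h1 h2] /andP[h3 h4].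
by case: (leP (f z) (g z)) => ?; case: (leP (f z') (g z')) => ?; apply/andP; split; lra.
Qed.

Lemma uc_sum (I : Type) (r : seq I) (F : I -> R * R -> R) :
  (forall i, uc (F i)) -> uc (fun z => \sum_(i <- r) F i z).
Proof.
move=> ucF; elim: r => [|i r IH].
  by under eq_fun do rewrite big_nil; exact: ucc.
by under eq_fun do rewrite big_cons; exact: ucD.
Qed.

Lemma uc_dot (u v : R * R -> 'rV[R]_3) :
  (forall k, uc (fun z => u z 0 k)) -> (forall k, uc (fun z => v z 0 k)) ->
  uc (fun z => dot (u z) (v z)).
Proof. by move=> ucu ucv; apply: uc_sum => k; exact: ucM. Qed.

Lemma uc_enorm (u : R * R -> 'rV[R]_3) : (forall k, uc (fun z => u z 0 k)) ->
  uc (fun z => enorm (u z)).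
Proof.
move=> ucu; split.
- have [K HK] := choice (fun k => uc_bnd (ucu k)).
  exists (\sum_(k < 3) K k) => z; rewrite ger0_norm ?enorm_ge0//.
  by apply: le_trans (enorm_le_sum _) _; exact: ler_sum.
- apply: measurableT_comp; last exact: uc_meas (uc_dot ucu ucu).
  by apply: continuous_measurable_fun => s; exact: sqrt_continuous.
move=> e e0; have e3 : 0 < e / 4 by rewrite divr_gt0.
have [d0 d00 h0] := uc_cont (ucu 0) e3; have [d1 d10 h1] := uc_cont (ucu 1) e3.
have [d2 d20 h2] := uc_cont (ucu 2%:R) e3.
exists (Num.min d0 (Num.min d1 d2)); first by rewrite !lt_min d00 d10.
move=> z z'; rewrite !lt_min => /and3P[a0 a1 a2] /and3P[b0 b1 b2].
apply: le_lt_trans (enorm_dist _ _) _; apply: le_lt_trans (enorm_le_sum _) _.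
rewrite !big_ord_recl big_ord0 addr0.
have -> : lift ord0 ord0 = 1 :> 'I_3 by exact/val_inj.
have -> : lift ord0 (lift ord0 ord0) = 2%:R :> 'I_3 by exact/val_inj.
have := h0 _ _ a0 b0; have := h1 _ _ a1 b1; have := h2 _ _ a2 b2.
by rewrite !mxE; lra.
Qed.

(** For fixed [s] the minimum in [t] is attained, at [T s] say. The minimal value is continuous in
    [s], because [f] is uniformly continuous, and is minimized in turn. *)
Lemma uc_min_attained (l l' : R) f : 0 <= l -> 0 <= l' -> uc f ->
  exists s t, [/\ 0 <= s <= l, 0 <= t <= l' &
    forall s' t', 0 <= s' <= l -> 0 <= t' <= l' -> f (s, t) <= f (s', t')].
Proof.
move=> l0 l'0 ucf.
have cont1 (g : R -> R) : (forall e, 0 < e -> exists2 d : R, 0 < d &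
    forall s s', `|s - s'| < d -> `|g s - g s'| < e) -> continuous g.
  move=> H s; apply/cvgrPdist_lt => e e0; have [d d0 hd] := H e e0.
  by near=> t; apply: hd; near: t; apply: cvgr_dist_lt => //; exact: cvg_id.
have H1 s : exists t, 0 <= t <= l' /\ forall t', 0 <= t' <= l' -> f (s, t) <= f (s, t').
  have cs : continuous (fun t => f (s, t)).
    apply: cont1 => e e0; have [d d0 hd] := uc_cont ucf e0.
    by exists d => // t t' tt'; apply: hd; rewrite //= subrr normr0.
  have [t + ht] := EVT_min l'0 (continuous_subspaceT cs : {within `[0, l'], continuous _}).
  by rewrite in_itv/= => tl; exists t; split=> // t' t'l; apply: ht; rewrite in_itv.
have [T HT] := choice H1.
have cv : continuous (fun s => f (s, T s)).
  apply: cont1 => e e0; have [d d0 hd] := uc_cont ucf e0.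
  exists d => // s s' ss'.
  have ss's : `|s' - s| < d by rewrite distrC.
  have z0 (t : R) : `|t - t| < d by rewrite subrr normr0.
  have := hd (s, T s') (s', T s') ss' (z0 _); have := hd (s, T s) (s', T s) ss' (z0 _).
  have [Ts hs] := HT s; have [Ts' hs'] := HT s'.
  have := hs _ Ts'; have := hs' _ Ts.
  by rewrite !ltr_norml => ? ? /andP[? ?] /andP[? ?]; apply/andP; split; lra.
have [s + hs] := EVT_min l0 (continuous_subspaceT cv : {within `[0, l], continuous _}).
rewrite in_itv/= => sl; have [Ts hT] := HT s.
exists s, (T s); split=> // s' t' s'l t'l.
apply: le_trans (hs s' _) _; first by rewrite in_itv.
by have [_] := HT s'; apply.
Unshelve. all: by end_near. Qed.

End uniformly_continuous_pairs.

Section wrap.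
Context {R : realType}.
Variables (L : glink R).
Implicit Types (i j : 'I_(ncomp L)) (xi : vfield L).

(* The parameter in [pdom i] of the point of parameter [s] in [0, clen i]. *)
Definition wrap i (s : R) : R := if circ i && (s == clen i) then 0 else s.

Lemma wrap_pdom i s : 0 <= s <= clen i -> pdom i (wrap i s).
Proof.
move=> /andP[s0 sl]; rewrite /wrap /pdom /param_dom; case: (circ i) => /=.
  case: eqP => [_|/eqP sl']; rewrite in_itv/=; first by rewrite lexx clen_gt0.
  by rewrite s0 lt_neqAle sl' sl.
by rewrite in_itv/= s0.
Qed.

Lemma curve_wrap i s : curve i (wrap i s) = curve i s.
Proof. by rewrite /wrap; case: ifP => // /andP[/curve_circ<- /eqP->]. Qed.

Lemma VF_wrap xi i s : VF xi -> xi i (wrap i s) = xi i s.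
Proof.
by move=> /(_ i)[_ h]; rewrite /wrap; case: ifP => // /andP[/h<- /eqP->].
Qed.

End wrap.

(** From [2 * enorm d * x <= x ^+ 2 + enorm d ^+ 2] at [x = enorm (d + t *: e)]: the upper
    counterpart of [enorm_tangent_le], with a quadratic remainder. *)
Lemma enorm_second_le (R : realType) (d e : 'rV[R]_3) t : d != 0 ->
  enorm (d + t *: e) <= enorm d + t * (dot e d / enorm d) + t ^+ 2 * dot e e / (2 * enorm d).
Proof.
move=> d0; have n0 := enorm_gt0 d0.
have : 0 <= (enorm (d + t *: e) - enorm d) ^+ 2 by exact: sqr_ge0.
rewrite sqrrB !sqr_enorm dotDl !dotDr !dotZl !dotZr (dotC d e) -sqr_enorm => h.
rewrite -(ler_pM2r (_ : 0 < 2 * enorm d)); last by rewrite mulr_gt0.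
rewrite [leRHS](_ : _ = 2 * enorm d ^+ 2 + 2 * t * dot e d + t ^+ 2 * dot e e); last first.
  by field; rewrite gt_eqF.
move: h; rewrite expr2; lra.
Qed.

Section danskin.
Context {R : realType}.
Variables (L : glink R).
Implicit Types (i j : 'I_(ncomp L)) (xi : vfield L).

(** Clamping extends the difference of two components to the whole plane, where the calculus of [uc]
    applies. *)
Definition gap (c : vfield L) i j (z : R * R) : 'rV[R]_3 :=
  c j (clamp (clen j) z.2) - c i (clamp (clen i) z.1).

Lemma curve_VF : VF (@curve R L).
Proof. by move=> i; split; [exact: curve_continuous|exact: curve_circ]. Qed.

Lemma uc_gap (c : vfield L) i j k : VF c -> uc (fun z => gap c i j z 0 k).
Proof.
move=> vc; under eq_fun do rewrite /gap !mxE.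
apply: ucD; last apply: ucN.
  exact: uc_snd (uc1_clamp (clen_gt0 j) (@VF_component _ L c j k vc)).
exact: uc_fst (uc1_clamp (clen_gt0 i) (@VF_component _ L c i k vc)).
Qed.

Lemma gap_wrap (c : vfield L) i j (z : R * R) : VF c ->
  0 <= z.1 <= clen i -> 0 <= z.2 <= clen j ->
  gap c i j z = c j (wrap j z.2) - c i (wrap i z.1).
Proof. by move=> vc z1 z2; rewrite /gap !clamp_id// !VF_wrap. Qed.

Lemma gap_pdom (c : vfield L) i j (z : R * R) : pdom i z.1 -> pdom j z.2 ->
  gap c i j z = c j z.2 - c i z.1.
Proof. by move=> /pdom_subset z1 /pdom_subset z2; rewrite /gap !clamp_id. Qed.

Lemma LThi_lb i j s t : i != j -> pdom i s -> pdom j t ->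
  (LThi L <= (enorm (curve j t - curve i s))%:E)%E.
Proof. by move=> ij si tj; apply: ereal_inf_lbound; exists i, j, s, t. Qed.

(** The distance is minimized on the closed rectangle of each pair of components, then over the
    finitely many pairs. [wrap] brings the parameters back to the half-open domains of circles, and
    the minimizing pair is reordered if necessary. *)
Lemma strut_exists : (1 < ncomp L)%N -> exists i j z, strut i j z.
Proof.
move=> n1.
have H (p : 'I_(ncomp L) * 'I_(ncomp L)) : exists z : R * R, [/\ 0 <= z.1 <= clen p.1, 0 <= z.2 <= clen p.2 &
    forall z', 0 <= z'.1 <= clen p.1 -> 0 <= z'.2 <= clen p.2 ->
    enorm (gap (@curve R L) p.1 p.2 z) <= enorm (gap (@curve R L) p.1 p.2 z')].
  have ucg := uc_enorm (fun k => @uc_gap _ p.1 p.2 k curve_VF).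
  have [s [t [s0 t0 h]]] := uc_min_attained (ltW (clen_gt0 p.1)) (ltW (clen_gt0 p.2)) ucg.
  by exists (s, t); split => // -[s' t'] /=; exact: h.
have [Z HZ] := choice H.
pose i0 : 'I_(ncomp L) := Ordinal (ltnW n1); pose i1 : 'I_(ncomp L) := Ordinal n1.
pose v p := enorm (gap (@curve R L) p.1 p.2 (Z p)).
have p01 : (i0, i1).1 != (i0, i1).2 by [].
have [[i j] /= ij hmin] := @Order.TotalTheory.arg_minP _ _ _ (i0, i1) (fun p => p.1 != p.2) v p01.
have [/= z1 z2 _] := HZ (i, j).
have hT : LThi L = (v (i, j))%:E.
  apply/le_anti/andP; split.
    rewrite /v /= gap_wrap//; last exact: curve_VF.
    by apply: LThi_lb => //; exact: wrap_pdom.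
  apply: le_ereal_inf_tmp => _ [i' [j' [s [t [ij' si tj ->]]]]]; rewrite lee_fin.
  apply: le_trans (hmin (i', j') ij') _; have [_ _ /(_ (s, t))] := HZ (i', j').
  by move=> /(_ (pdom_subset si) (pdom_subset tj)); rewrite [X in _ <= enorm X]gap_pdom.
have vE : v (i, j) = enorm (curve j (wrap j (Z (i, j)).2) - curve i (wrap i (Z (i, j)).1)).
  by rewrite /v /= gap_wrap//; exact: curve_VF.
have [lij|lji|eij] := ltngtP i j.
- exists i, j, (wrap i (Z (i, j)).1, wrap j (Z (i, j)).2).
  by split=> //=; [exact: wrap_pdom|exact: wrap_pdom|rewrite hT vE].
- exists j, i, (wrap j (Z (i, j)).2, wrap i (Z (i, j)).1).
  by split=> //=; [exact: wrap_pdom|exact: wrap_pdom|rewrite hT vE enormB].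
- by move/eqP: ij; case; exact: val_inj.
Qed.

Lemma strut_gt0 i j z : strut i j z -> 0 < fine (LThi L) /\
  LThi L = (fine (LThi L))%:E.
Proof.
move=> [ij z1 z2 <-]/=; split=> //; apply: enorm_gt0; rewrite subr_eq0; apply/eqP => e.
have ji : j != i by rewrite neq_ltn ij orbT.
exact: (curve_disjoint ji z2 z1 e).
Qed.

Section derivative.
Variables (xi : vfield L) (vxi : VF xi).

Let T := fine (LThi L).

Let slope i j z := dot (xi j z.2 - xi i z.1) (curve j z.2 - curve i z.1)
  / enorm (curve j z.2 - curve i z.1).

Lemma displace_gap i j s t (h : R) : displace xi h j t - displace xi h i s =
  (curve j t - curve i s) + h *: (xi j t - xi i s).
Proof. by rewrite /displace scalerBr opprD addrACA. Qed.

Lemma slope_sym i j (z : R * R) : slope j i (z.2, z.1) = slope i j z.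
Proof.
rewrite /slope/= enormB; congr (_ / _).
by rewrite -[X in dot X _]opprB -[X in dot _ X]opprB dotNl dotNr opprK.
Qed.

(** Where the distance is [T] the pair is a strut and the slope exceeds [m - eta]; elsewhere the
    distance exceeds [T]. By compactness one of the two holds with a uniform margin [rho]. In the
    first case convexity of the norm suffices; in the second, a displacement of order [h] cannot use
    up the margin. *)
Lemma thickness_lower (m eta : R) : (1 < ncomp L)%N -> 0 < eta ->
  (forall i j z, strut i j z -> m <= AS xi i j z) ->
  \forall h \near 0^'+, ((T + h * (m - eta))%:E <= thickness (displace xi h))%E.
Proof.
move=> n1 eta0 mAS.
have [i0 [j0 [z0 st0]]] := strut_exists n1; have [T0 TE] := strut_gt0 st0.
have mslope i j (z : R * R) : i != j -> pdom i z.1 -> pdom j z.2 ->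
    enorm (curve j z.2 - curve i z.1) = T -> m <= slope i j z.
  move=> ij z1 z2 zT; have [lij|lji|eij] := ltngtP i j.
  - by apply: mAS; split => //; rewrite zT -TE.
  - rewrite -slope_sym; apply: (mAS j i (z.2, z.1)); split => //=.
    by rewrite enormB zT -TE.
  - by move/eqP: ij; case; exact: val_inj.
have pair (p : 'I_(ncomp L) * 'I_(ncomp L)) : \forall h \near 0^'+, p.1 != p.2 ->
    forall s t, pdom p.1 s -> pdom p.2 t ->
    T + h * (m - eta) <= enorm (displace xi h p.2 t - displace xi h p.1 s).
  have [ij|_] := boolP (p.1 != p.2); last by near=> h.
  set i := p.1; set j := p.2.
  pose d z := gap (@curve R L) i j z; pose e z := gap xi i j z.
  have ucd : uc (fun z => enorm (d z)) := uc_enorm (fun k => @uc_gap _ i j k curve_VF).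
  have uce : uc (fun z => enorm (e z)) := uc_enorm (fun k => @uc_gap _ i j k vxi).
  have ucde : uc (fun z => dot (e z) (d z)).
    by apply: uc_dot => k; apply: uc_gap => //; exact: curve_VF.
  (* Positivity of [psi] is the alternative just described; the slope condition is multiplied by the
     distance to avoid a quotient. *)
  pose psi z := Num.max (enorm (d z) + - T) (dot (e z) (d z) + - ((m - eta) * enorm (d z))).
  have ucpsi : uc psi.
    apply: uc_max; first by apply: ucD => //; exact: ucc.
    by apply: ucD => //; apply: ucN; apply: ucM => //; exact: ucc.
  have [s [t [si tj hmin]]] := uc_min_attained (ltW (clen_gt0 i)) (ltW (clen_gt0 j)) ucpsi.
  have dE (z : R * R) : 0 <= z.1 <= clen i -> 0 <= z.2 <= clen j ->
    d z = curve j (wrap j z.2) - curve i (wrap i z.1).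
    by move=> z1 z2; rewrite /d gap_wrap//; exact: curve_VF.
  have eE (z : R * R) : 0 <= z.1 <= clen i -> 0 <= z.2 <= clen j ->
    e z = xi j (wrap j z.2) - xi i (wrap i z.1).
    by move=> z1 z2; rewrite /e gap_wrap.
  have Tle s' t' : pdom i s' -> pdom j t' -> T <= enorm (curve j t' - curve i s').
    by move=> si' tj'; rewrite -lee_fin -TE; exact: LThi_lb.
  have rho0 : 0 < psi (s, t).
    rewrite /psi lt_max dE// eE//; have wi := wrap_pdom si; have wj := wrap_pdom tj.
    have := Tle _ _ wi wj; rewrite le_eqVlt => /predU1P[eT|ltT]; last by rewrite subr_gt0 ltT.
    apply/orP; right; rewrite subr_gt0.
    have := mslope i j (wrap i s, wrap j t) ij wi wj (esym eT).
    by rewrite /slope/= ler_pdivlMr -?eT// => h; apply: lt_le_trans h; rewrite ltr_pM2r//; lra.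
  have [B HB] := uc_bnd uce; have B0 : 0 <= B := le_trans (normr_ge0 _) (HB 0).
  set rho := psi (s, t) in rho0 hmin.
  near=> h => _ s' t' si' tj'.
  have h0 : 0 < h by near: h; exact: nbhs_right_gt.
  (* Then [h * B] for the displacement and [h * (m - eta)] for the target both fit into [rho]. *)
  have hr : h < rho / (B + `|m - eta| + 1).
    by near: h; apply: nbhs_right_lt; rewrite divr_gt0// ltr_wpDl// addr_ge0.
  have hr' : h * (B + `|m - eta| + 1) < rho by rewrite -ltr_pdivlMr// ltr_wpDl// addr_ge0.
  rewrite displace_gap.
  have := hmin s' t' (pdom_subset si') (pdom_subset tj').
  rewrite /psi le_max; have -> : d (s', t') = curve j t' - curve i s' by exact: gap_pdom.
  have eE' : e (s', t') = xi j t' - xi i s' by exact: gap_pdom.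
  have := HB (s', t'); rewrite ger0_norm ?enorm_ge0// eE'.
  set D := curve j t' - curve i s'; set E := xi j t' - xi i s' => EB.
  have DT : T <= enorm D by exact: Tle.
  have mn := ler_norm (m - eta).
  case/orP => hD.
    have := enorm_dist (D + h *: E) D; rewrite [D + _ - D]addrC addKr enormZ (gtr0_norm h0) ler_norml.
    by move=> /andP[h1 _]; nra.
  have D0 : D != 0 by apply: contraTneq DT => ->; rewrite enorm0 -ltNge.
  apply: le_trans (enorm_tangent_le _ _ D0); rewrite lerD// ler_pM2l//.
  by rewrite ler_pdivlMr ?enorm_gt0//; lra.
have : \forall h \near 0^'+, forall p : 'I_(ncomp L) * 'I_(ncomp L), p.1 != p.2 ->
    forall s t, pdom p.1 s -> pdom p.2 t ->
    T + h * (m - eta) <= enorm (displace xi h p.2 t - displace xi h p.1 s).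
  by apply: filter_forall => p; exact: pair.
apply: filterS => h H; apply: le_ereal_inf_tmp => _ [i [j [s [t [ij si tj ->]]]]].
by rewrite lee_fin; exact: (H (i, j)).
Unshelve. all: by end_near. Qed.

(** A single strut bounds the thickness of the displaced link from above, by the second-order
    estimate for the norm. *)
Lemma thickness_upper i j z (eta : R) : 0 < eta -> strut i j z ->
  \forall h \near 0^'+, (thickness (displace xi h) <= (T + h * (AS xi i j z + eta))%:E)%E.
Proof.
move=> eta0 st; have [T0 TE] := strut_gt0 st; have [ij z1 z2 zT] := st.
have {}zT : enorm (curve j z.2 - curve i z.1) = T by rewrite /T -zT.
have ij' : i != j by rewrite neq_ltn ij.
set D := curve j z.2 - curve i z.1 in zT; set E := xi j z.2 - xi i z.1.
have E0 := dot_ge0 E.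
(* Below this threshold the quadratic remainder [h ^+ 2 * dot E E / (2 * T)] is at most
   [h * eta]. *)
have r0 : 0 < 2 * T * eta / (dot E E + 1).
  by rewrite divr_gt0 ?ltr_wpDl// mulr_gt0// mulr_gt0.
near=> h.
have h0 : 0 < h by near: h; exact: nbhs_right_gt.
have hr : h < 2 * T * eta / (dot E E + 1) by near: h; exact: nbhs_right_lt.
have hr' : h * (dot E E + 1) < 2 * T * eta by rewrite -ltr_pdivlMr// ltr_wpDl.
apply: (@le_trans _ _ (enorm (displace xi h j z.2 - displace xi h i z.1))%:E).
  by apply: ereal_inf_lbound; exists i, j, z.1, z.2.
rewrite lee_fin displace_gap -/D -/E.
have D0 : D != 0 by apply: contraTneq T0 => De; rewrite -/T -zT De enorm0 ltxx.
apply: le_trans (enorm_second_le _ _ D0) _; rewrite /AS -/D -/E zT mulrDr addrA lerD2l.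
rewrite expr2 -!mulrA ler_pM2l// mulrA ler_pdivrMr ?mulr_gt0//; nra.
Unshelve. all: by end_near. Qed.

Lemma AS_bounded : exists B : R, forall i j z, strut i j z -> `|AS xi i j z| <= B.
Proof.
have H (p : 'I_(ncomp L) * 'I_(ncomp L)) : exists B : R, forall z, enorm (gap xi p.1 p.2 z) <= B.
  have [B HB] := uc_bnd (uc_enorm (fun k => @uc_gap _ p.1 p.2 k vxi)).
  by exists B => z; have := HB z; rewrite ger0_norm ?enorm_ge0.
have [B HB] := choice H.
have B0 p : 0 <= B p := le_trans (enorm_ge0 _) (HB p 0).
exists (\sum_p B p) => i j z st; have [ij z1 z2 _] := st; have [T0 TE] := strut_gt0 st.
have [_ _ _ zT] := st; rewrite TE in zT; case: zT => zT.
rewrite /AS zT normrM normfV [X in _ / X]gtr0_norm// ler_pdivrMr//.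
apply: le_trans (cauchy_schwarz _ _) _; rewrite zT ler_pM2r//.
rewrite -(gap_pdom xi z1 z2); apply: le_trans (HB (i, j) z) _.
by rewrite (bigD1 (i, j))//= lerDl sumr_ge0.
Qed.

(** For every [e] the difference quotient eventually lies between [m - e], by [thickness_lower], and
    the rate of an almost minimal strut plus [e / 2], by [thickness_upper]; so it converges to the
    infimum [m]. *)
Lemma danskin : (1 < ncomp L)%N -> exists m : R, [/\ dLThi xi = m%:E,
  forall i j z, strut i j z -> m <= AS xi i j z &
  forall m' : R, (forall i j z, strut i j z -> m' <= AS xi i j z) -> m' <= m].
Proof.
move=> n1; have [i0 [j0 [z0 st0]]] := strut_exists n1; have [T0 TE] := strut_gt0 st0.
pose S := [set x : R | exists i j z, strut i j z /\ x = AS xi i j z].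
have S0 : S !=set0 by exists (AS xi i0 j0 z0), i0, j0, z0.
have [B HB] := AS_bounded.
have hS : has_inf S.
  by split=> //; exists (- B) => _ [i [j [z [st ->]]]]; have := HB _ _ _ st; rewrite ler_norml => /andP[].
pose m := inf S.
have mS i j z : strut i j z -> m <= AS xi i j z.
  by move=> st; apply: ge_inf; [case: hS|exists i, j, z].
exists m; split=> //; last first.
  by move=> m' hm'; apply: lb_le_inf => // _ [i [j [z [st ->]]]]; exact: hm'.
rewrite /dLThi n1; apply/cvg_lim => //; apply/fine_cvgP.
have quot (e : R) : 0 < e -> \forall h \near 0^'+, exists2 q : R,
    ((thickness (displace xi h) - LThi L) * (h^-1)%:E)%E = q%:E & `|m - q| <= e.
  move=> e0; have e2 : 0 < e / 2 by rewrite divr_gt0.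
  have [_ [i [j [z [st ->]]]] hz] := inf_adherent e2 hS.
  near=> h.
  have h0 : 0 < h by near: h; exact: nbhs_right_gt.
  have h1 : ((T + h * (m - e))%:E <= thickness (displace xi h))%E.
    by near: h; exact: thickness_lower.
  have h2 : (thickness (displace xi h) <= (T + h * (AS xi i j z + e / 2))%:E)%E.
    by near: h; exact: thickness_upper.
  move: h1 h2; case: (thickness _) => [x||]//; rewrite !lee_fin => h1 h2.
  exists ((x - T) * h^-1); first by rewrite TE.
  have a1 : m - e <= (x - T) * h^-1 by rewrite ler_pdivlMr//; lra.
  have a2 : (x - T) * h^-1 <= AS xi i j z + e / 2 by rewrite ler_pdivrMr//; lra.
  have hz' : AS xi i j z < m + e / 2 by exact: hz.
  by rewrite ler_norml; apply/andP; split; lra.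
split.
  by apply: filterS (quot 1 ltr01) => h [q -> _].
apply/cvgrPdist_le => e e0; apply: filterS (quot e e0) => h [q /= -> //].
Unshelve. all: by end_near. Qed.

End derivative.

End danskin.

(** The negative part of [f] is at most [e]. If the positive part has infinite integral, [fine]
    returns 0, which is still above the bound; so [f] and [D] may be arbitrary. *)
Lemma Rintegral_lower d (T : measurableType d) (R : realType)
    (m : {finite_measure set T -> \bar R}) (D : set T) (f : T -> R) (e : R) :
  0 <= e -> (forall x, D x -> - e <= f x) ->
  - (e * fine (m setT)) <= \int[m]_(x in D) f x.
Proof.
move=> e0 fe; rewrite /Rintegral integralE.
have M0 : 0 <= e * fine (m setT) by rewrite mulr_ge0// fine_ge0.
have h : (\int[m]_(x in D) ((EFin \o f)^\- x) <= (e * fine (m setT))%:E)%E.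
  rewrite EFinM fineK ?fin_num_measure// -integral_cst// [leLHS]integral_mkcond.
  apply: ae_ge0_le_integralT => [x|x|].
  - by rewrite patchE; case: ifP => // _; exact: funeneg_ge0.
  - by rewrite lee_fin.
  - apply: aeW => x /=; rewrite patchE; case: ifPn => [/set_mem Dx|_]; last by rewrite lee_fin.
    by rewrite funenegE/= -EFin_max lee_fin ge_max e0 andbT lerNl fe.
have h0 : (0 <= \int[m]_(x in D) ((EFin \o f)^\- x))%E by apply: integral_ge0 => x _; exact: funeneg_ge0.
have p0 : (0 <= \int[m]_(x in D) ((EFin \o f)^\+ x))%E by apply: integral_ge0 => x _; exact: funepos_ge0.
case: (integral _ _ ((EFin \o f)^\-)%E) h h0 => [y|//|//]; rewrite !lee_fin => h h0.
case: (integral _ _ ((EFin \o f)^\+)%E) p0 => [x|_|//] /=; last by rewrite oppr_le0.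
by rewrite lee_fin; lra.
Qed.

(** * Balance of forces implies strong criticality *)

Section sufficiency.
Context {R : realType}.
Variables (L : glink R) (hL : arclength_parametrized L).

Lemma balance_strongly_critical (K : force L) (mu : contact_measure L) (F : force L) :
  is_curvature_force K -> is_adjoint_force mu F -> balanced_on_VFc K F ->
  strongly_critical L.
Proof.
move=> cK adj bal.
pose M := (\sum_(i < ncomp L) \sum_(j < ncomp L) fine (mu_strut mu i j setT)) +
  \sum_(i < ncomp L) \sum_(j < nobs i) fine (mu_wall mu j setT).
have M0 : 0 <= M.
  by rewrite addr_ge0//; apply: sumr_ge0 => i _; apply: sumr_ge0 => j _; rewrite fine_ge0.
have M1 : 0 < M + 1 by rewrite ltr_wpDl.
(* Rates all at least [- (M + 1)^-1] would give an integral at least [- M / (M + 1)], which exceeds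
   -1. *)
exists (M + 1)^-1; first by rewrite invr_gt0.
move=> xi sxi cxi lxi; set eps := (M + 1)^-1.
have e0 : 0 <= eps by rewrite invr_ge0 ltW.
have vxi := smooth_field_VF sxi.
rewrite leNgt; apply/negP; rewrite lt_min => /andP[hT hO].
have hAS i j z : strut i j z -> - eps <= AS xi i j z.
  move=> st; have [ij _ _ _] := st.
  have n1 : (1 < ncomp L)%N by apply: leq_ltn_trans (ltn_ord j); exact: leq_ltn_trans (leq0n i) ij.
  have [m [Tm mAS _]] := danskin vxi n1.
  by move: hT; rewrite Tm lte_fin => /ltW h; exact: le_trans h (mAS _ _ _ st).
have hAW i (j : 'I_(nobs i)) s : wall j s -> - eps <= AW xi j s.
  move=> ws; rewrite -lee_fin; apply: le_trans (ltW hO) _.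
  by apply: ereal_inf_lbound; exists i, j, s.
have : - (eps * M) <= contact_integral mu xi.
  rewrite /contact_integral /M mulrDr opprD lerD// mulr_sumr -sumrN;
    apply: ler_sum => i _; rewrite mulr_sumr -sumrN; apply: ler_sum => j _.
  - by apply: Rintegral_lower => // z; exact: hAS.
  - by apply: Rintegral_lower => // s; exact: hAW.
rewrite -adj// -bal// -(dLen_force_pair hL cK sxi) lxi lerN2 /eps.
by rewrite mulrC ler_pdivlMr// mul1r; lra.
Qed.

End sufficiency.

Section measure_lemmas.
Context d (T : measurableType d) (R : realType).
Implicit Types m : {finite_measure set T -> \bar R}.

Definition charge_diff m1 m2 : {charge set T -> \bar R} :=
  cadd (charge_of_finite_measure m1) (cscale (-1) (charge_of_finite_measure m2)).

Lemma charge_diffE m1 m2 A : charge_diff m1 m2 A = (m1 A - m2 A)%E.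
Proof. by rewrite /charge_diff/= /cadd/= /cscale/= EFinN mulN1e. Qed.

Lemma Rintegral_null_compl m D (f : T -> R) : measurable D -> m (~` D) = 0%E ->
  \int[m]_x f x = \int[m]_(x in D) f x.
Proof. by move=> mD D0; congr fine; exact: integral_null_compl. Qed.

Lemma Rintegral_eq0_null m (h : T -> R) (K : R) : measurable_fun setT h ->
  (forall x, 0 <= h x <= K) -> \int[m]_x h x = 0 -> m [set x | h x != 0] = 0%E.
Proof.
move=> mh h0K h0.
have ih : m.-integrable setT (EFin \o h).
  apply: (@integrable_fin_bnd _ _ _ _ _ K) => // x _.
  by have /andP[h1 h2] := h0K x; rewrite ger0_norm.
have mE : measurable [set x | h x != 0].
  rewrite (_ : [set x | h x != 0] = h @^-1` (~` [set 0])).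
    by rewrite -[X in measurable X]setTI; apply: mh => //; apply: measurableC; exact: measurable_set1.
  by apply/seteqP; split => x /= => [/eqP|] // ?; exact/eqP.
have e0 : (\int[m]_x (EFin \o h) x = 0)%E.
  by rewrite -[LHS]fineK ?(integrable_fin_num _ ih)// -[fine _]/(\int[m]_x h x) h0.
have : (\int[m]_x `|(EFin \o h) x| = 0)%E.
  rewrite -[RHS]e0; apply: eq_integral => x _ /=.
  by have /andP[h1 _] := h0K x; rewrite ger0_norm.
have mEh : measurable_fun setT (EFin \o h) by exact/measurable_EFinP.
move=> /(ae_eq_integral_abs m measurableT mEh)[N [mN N0 HN]].
apply: subset_measure0 N0 => // x /= hx; apply: HN => /= H.
by have := H I => -[hx0]; rewrite hx0 eqxx in hx.
Qed.

End measure_lemmas.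

(** * Contact measures and adjoint forces *)

Section weighted_riesz.
Context {R : realType} (X : Type) (Lam : (X -> R) -> R).
Hypothesis LamP : posfun Lam.
Variables (w : X -> R) (u : bool -> X -> R) (L : bool -> R).
Hypotheses (bw : bnd w) (w0 : forall x, 0 <= w x).
Hypotheses (L0 : forall b, 0 <= L b) (u0L : forall b x, 0 <= u b x <= L b).

(** A nonnegative weight preserves positivity; the weights used are indicators of contact classes
    and the positive and negative parts of contact forces. *)
Lemma weighted_posfun : posfun (fun f => Lam (fun x => w x * f x)).
Proof.
split=> [f g bf bg|a f bf|f bf f0].
- rewrite -(posfunD LamP); [|exact: bndM..].
  by congr Lam; apply/funext => x; rewrite mulrDr.
- rewrite -(posfunZ LamP); last exact: bndM.
  by congr Lam; apply/funext => x; rewrite mulrCA.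
- by apply: (posfun_ge0 LamP); [exact: bndM|move=> x; rewrite mulr_ge0].
Qed.

Lemma weighted_riesz : exists m : {finite_measure set (MR R * MR R)%type -> \bar R},
  m (~` [set z | 0 <= z.1 <= L false /\ 0 <= z.2 <= L true]) = 0%E /\
  forall f, uc f -> Lam (fun x => w x * f (u false x, u true x)) = \int[m]_z f z.
Proof. exact: (riesz_markov weighted_posfun L0 u0L). Qed.

End weighted_riesz.

Section link_riesz.
Context {R : realType} (L : glink R) (X : Type) (Lam : (X -> R) -> R).
Hypothesis LamP : posfun Lam.
Implicit Types (i j : 'I_(ncomp L)).

Lemma measurable_wrap i : measurable_fun setT (wrap i : MR R -> MR R).
Proof.
have -> : wrap i = (fun s => s - s * \1_[set s | circ i && (s == clen i)] s) :> (MR R -> R).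
  apply/funext => s; rewrite /wrap indicE; case: ifPn => h.
    by rewrite mem_set// mulr1 subrr.
  by rewrite memNset ?mulr0 ?subr0//=; exact/negP.
apply: measurable_funB; first exact: measurable_id.
apply: measurable_funM; first exact: measurable_id.
apply: measurable_indic.
case: (circ i); last by rewrite (_ : [set _ | _] = set0)//; apply/seteqP; split.
rewrite (_ : [set _ | _] = [set clen i]); first exact: measurable_set1.
by apply/seteqP; split => s /= => [/eqP|->].
Qed.

Lemma measurable_rect (a b : R) : measurable
  ([set z | 0 <= z.1 <= a /\ 0 <= z.2 <= b] : set (MR R * MR R)%type).
Proof.
rewrite (_ : [set _ | _] = `[0, a]%classic `*` `[0, b]%classic).
  by apply: measurableX; exact: measurable_itv.
by apply/seteqP; split => z; rewrite /= !in_itv.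
Qed.

Definition wrap_invariant i j (f : R * R -> R) := forall z,
  0 <= z.1 <= clen i -> 0 <= z.2 <= clen j -> f (wrap i z.1, wrap j z.2) = f z.

(** The coordinates only confine the measure to a closed rectangle. Its image under [wrap] lives on
    the half-open domains of circles, and integrals of functions that respect the identification of
    ends are unchanged. *)
Lemma plane_measure i j (w : X -> R) (u v : X -> R) : bnd w -> (forall x, 0 <= w x) ->
  (forall x, 0 <= u x <= clen i) -> (forall x, 0 <= v x <= clen j) ->
  exists m : {finite_measure set (MR R * MR R)%type -> \bar R},
    m (~` (pdom i `*` pdom j)) = 0%E /\
    forall f, uc f -> wrap_invariant i j f -> Lam (fun x => w x * f (u x, v x)) = \int[m]_z f z.
Proof.
move=> bw w0 ui vj.
have [m0 [m0supp m0E]] := @weighted_riesz _ _ _ LamP w (fun b x => if b then v x else u x)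
  (fun b => if b then clen j else clen i) bw w0
  (fun b => match b with true => ltW (clen_gt0 j) | false => ltW (clen_gt0 i) end)
  (fun b x => match b with true => vj x | false => ui x end).
pose W (z : (MR R * MR R)%type) : (MR R * MR R)%type := (wrap i z.1, wrap j z.2).
have mW : measurable_fun setT W.
  apply/measurable_fun_pairP; split.
    exact: (measurableT_comp (measurable_wrap i) measurable_fst).
  exact: (measurableT_comp (measurable_wrap j) measurable_snd).
have mP : measurable (pdom i `*` pdom j : set (MR R * MR R)%type).
  by apply: measurableX; exact: measurable_pdom.
exists (finite_push m0 mW); split.
  rewrite finite_pushE; apply: subset_measure0 m0supp.
  - by rewrite -[X in measurable X]setTI; apply: mW => //; exact: measurableC.
  - by apply: measurableC; exact: measurable_rect.
  - by move=> z /= h [z1 z2]; apply: h; split; exact: wrap_pdom.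
move=> f ucf winv; rewrite (m0E f ucf).
have [K fK] := uc_bnd ucf.
rewrite (@Rintegral_finite_push _ _ _ _ _ m0 W mW setT f K)//; last exact: uc_meas ucf.
rewrite preimage_setT.
rewrite !(@Rintegral_null_compl _ _ _ m0 _ _ (measurable_rect (clen i) (clen j)) m0supp).
by apply: eq_Rintegral => z; rewrite inE => -[z1 z2]; rewrite winv.
Qed.

(** The planar statement with both coordinates equal to [u], projected to the first axis. *)
Lemma line_measure i (w : X -> R) (u : X -> R) : bnd w -> (forall x, 0 <= w x) ->
  (forall x, 0 <= u x <= clen i) ->
  exists m : {finite_measure set (MR R) -> \bar R},
    m (~` pdom i) = 0%E /\
    forall g, uc1 g -> (circ i -> g (clen i) = g 0) ->
      Lam (fun x => w x * g (u x)) = \int[m]_(s in pdom i) g s.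
Proof.
move=> bw w0 ui; have [m0 [m0supp m0E]] := plane_measure bw w0 ui ui.
have mf : measurable_fun setT (fst : (MR R * MR R)%type -> MR R) by exact: measurable_fst.
have mP := measurable_pdom i.
have msupp : finite_push m0 mf (~` pdom i) = 0%E.
  rewrite finite_pushE; apply: subset_measure0 m0supp.
  - by rewrite -[X in measurable X]setTI; apply: mf => //; exact: measurableC.
  - by apply: measurableC; exact: measurableX.
  - by move=> z /= h [z1 z2].
exists (finite_push m0 mf); split=> // g ucg gper.
have [K gK] := uc1_bnd ucg.
rewrite -(Rintegral_null_compl _ mP msupp).
rewrite (@Rintegral_finite_push _ _ _ _ _ m0 fst mf setT g K)//; last exact: uc1_meas ucg.
rewrite preimage_setT -(m0E (fun z => g z.1))//; first exact: uc_fst.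
move=> z _ _ /=; rewrite /wrap; case: ifP => // /andP[ci /eqP ->]; exact/esym/gper.
Qed.

End link_riesz.

(** * Contacts and their action on the components *)

Section contacts.
Context {R : realType} (L : glink R).
Implicit Types (i j : 'I_(ncomp L)) (xi zeta : vfield L).

Let T := fine (LThi L).

(** Every element carries the proof that it is active, so a functional on functions of this type
    sees only actual struts and wall points. *)
Inductive contact : Type :=
  | Cstrut i j (z : R * R) of strut i j z
  | Cwall i (j : 'I_(nobs i)) (s : R) of wall j s.

Definition rate xi (x : contact) : R :=
  match x with
  | Cstrut i j z _ => AS xi i j z
  | Cwall _ j s _ => AW xi j s
  end.

Lemma within_dot (l : R) (f g : R -> 'rV[R]_3) :
  (forall k, {within `[0, l], continuous (fun s => f s 0 k)}) ->
  (forall k, {within `[0, l], continuous (fun s => g s 0 k)}) ->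
  {within `[0, l], continuous (fun s => dot (f s) (g s))}.
Proof.
move=> cf cg.
rewrite (_ : (fun s => _) = (fun s => f s 0 0 * g s 0 0 + f s 0 1 * g s 0 1
  + f s 0 2%:R * g s 0 2%:R)); last by apply/funext => s; exact: dotE.
move=> s; apply: cvgD; [apply: cvgD|];
  by apply: cvgM; [exact: cf|exact: cg].
Qed.

Lemma gradient_within i (j : 'I_(nobs i)) k :
  {within `[0, clen i], continuous (fun s => gradient (obs L i j) (curve i s) 0 k)}.
Proof.
move=> s; have [_ cg] := obs_C1 j.
apply: (@cvg_comp _ _ _ (fun s => gradient (obs L i j) (curve i s)) (fun M : 'rV[R]_3 => M 0 k)).
  by apply: (@cvg_comp _ _ _ (curve i) (gradient (obs L i j)) _ _ _ (@curve_continuous R L i s)); exact: cg.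
exact: coord_continuous.
Qed.

Lemma obs_within i (j : 'I_(nobs i)) :
  {within `[0, clen i], continuous (fun s => obs L i j (curve i s))}.
Proof.
move=> s; have [dg _] := obs_C1 j.
apply: (@cvg_comp _ _ _ (curve i) (obs L i j : _ -> R^o) _ _ _ (@curve_continuous R L i s)).
exact: (differentiable_continuous (dg (curve i s))).
Qed.

Lemma AW_within xi i (j : 'I_(nobs i)) : VF xi ->
  {within `[0, clen i], continuous (fun s => AW xi j s)}.
Proof.
by move=> vxi; apply: within_dot => k; [exact: VF_component|exact: gradient_within].
Qed.

Lemma rate_bnd xi : VF xi -> bnd (rate xi).
Proof.
move=> vxi; have [B HB] := AS_bounded vxi.
have H (q : {i : 'I_(ncomp L) & 'I_(nobs i)}) : exists B : R, forall s, 0 <= s <= clen (tag q) ->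
    `|AW xi (tagged q) s| <= B.
  exact: (continuous_itv_bounded (@AW_within xi (tag q) (tagged q) vxi)).
have [C HC] := choice H.
have C0 q : 0 <= C q.
  by apply: le_trans (HC q 0 _); rewrite ?lexx ?(ltW (clen_gt0 _)).
exists (`|B| + \sum_q C q); case=> [i j z st|i j s ws] /=.
  by apply: le_trans (HB _ _ _ st) _; rewrite -[leLHS]addr0 lerD ?ler_norm// sumr_ge0.
have s0 : 0 <= s <= clen i by case: ws => /pdom_subset.
have := HC (Tagged (fun i => 'I_(nobs i)) j) s s0 => /= h; apply: le_trans h _.
rewrite (bigD1 (Tagged (fun i => 'I_(nobs i)) j))//= addrCA lerDl addr_ge0// sumr_ge0//.
Qed.

(** Parameter at which the contact touches component [i0]. The two components of a strut are
    distinct, so there is at most one; 0 is a default for components that are not touched, on which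
    [leg_force] vanishes. *)
Definition leg_par i0 (x : contact) : R :=
  match x with
  | Cstrut i j z _ => if i0 == j then z.2 else if i0 == i then z.1 else 0
  | Cwall i _ s _ => if i0 == i then s else 0
  end.

(** A strut pushes its two components apart by opposite unit vectors, its length being [T]; a wall
    acts by the gradient of the obstacle. *)
Definition leg_force i0 (x : contact) : 'rV[R]_3 :=
  match x with
  | Cstrut i j z _ => if i0 == j then T^-1 *: (curve j z.2 - curve i z.1)
      else if i0 == i then - T^-1 *: (curve j z.2 - curve i z.1) else 0
  | Cwall i j s _ => if i0 == i then gradient (obs L i j) (curve i s) else 0
  end.

Lemma leg_par_itv i0 x : 0 <= leg_par i0 x <= clen i0.
Proof.
have l0 : 0 <= (0 : R) <= clen i0 by rewrite lexx ltW ?clen_gt0.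
case: x => [i j z [ij z1 z2 _]|i j s [sp _]] /=.
  case: eqP => [->|_]; first exact: pdom_subset.
  by case: eqP => [->|_]; first exact: pdom_subset.
by case: eqP => [->|_]; first exact: pdom_subset.
Qed.

(** Writing rates as forces paired with the field, component by component, is what turns a
    functional on contacts into a force along the link. *)
Lemma rateE xi x : rate xi x = \sum_(i0 < ncomp L) dot (leg_force i0 x) (xi i0 (leg_par i0 x)).
Proof.
case: x => [i j z st|i j s ws] /=; last first.
  rewrite (bigD1 i)//= eqxx big1 ?addr0; first by rewrite /AW dotC.
  by move=> i0 /negbTE ->; rewrite dot0l.
have [ij _ _ zT] := st; have [T0 TE] := strut_gt0 st.
have ij' : i != j by rewrite neq_ltn ij.
rewrite (bigD1 j)//= eqxx (bigD1 i)//= (negbTE ij') eqxx big1 ?addr0; last first.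
  by move=> i0 /andP[/negbTE -> /negbTE ->]; rewrite dot0l.
have zT' : enorm (curve j z.2 - curve i z.1) = T by rewrite /T -zT.
rewrite /AS zT' !dotZl dotBl (dotC (xi j z.2)) (dotC (xi i z.1)).
ring.
Qed.

Lemma leg_force_bnd i0 k : bnd (fun x => leg_force i0 x 0 k).
Proof.
have H (q : {i : 'I_(ncomp L) & 'I_(nobs i)}) : exists B : R, forall s, 0 <= s <= clen (tag q) ->
    `|gradient (obs L (tag q) (tagged q)) (curve (tag q) s) 0 k| <= B.
  exact: (continuous_itv_bounded (@gradient_within (tag q) (tagged q) k)).
have [C HC] := choice H.
have C0 q : 0 <= C q.
  by apply: le_trans (HC q 0 _); rewrite ?lexx ?(ltW (clen_gt0 _)).
have S0 : 0 <= \sum_q C q by rewrite sumr_ge0.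
exists (1 + \sum_q C q); case=> [i j z st|i j s ws] /=; last first.
  case: eqP => _; last by rewrite mxE normr0 addr_ge0.
  have s0 : 0 <= s <= clen i by case: ws => /pdom_subset.
  have := HC (Tagged (fun i => 'I_(nobs i)) j) s s0 => /= h; apply: le_trans h _.
  by rewrite (bigD1 (Tagged (fun i => 'I_(nobs i)) j))//= addrCA lerDl addr_ge0// sumr_ge0.
have [_ _ _ zT] := st; have [T0 TE] := strut_gt0 st.
have zT' : enorm (curve j z.2 - curve i z.1) = T by rewrite /T -zT.
have h (a : R) : `|a| = T^-1 -> `|(a *: (curve j z.2 - curve i z.1)) 0 k| <= 1 + \sum_q C q.
  move=> aT; apply: (@le_trans _ _ 1); last by rewrite lerDl.
  apply: le_trans (coord_le_enorm _ _) _; rewrite enormZ zT' aT mulVf// gt_eqF//.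
case: eqP => _; first by apply: h; rewrite gtr0_norm// invr_gt0.
case: eqP => _; first by apply: h; rewrite normrN gtr0_norm// invr_gt0.
by rewrite mxE normr0 addr_ge0.
Qed.

Definition strut_part i j (x : contact) : R :=
  if x is Cstrut i' j' _ _ then ((i' == i) && (j' == j))%:R else 0.

(** Obstacle indices are compared as natural numbers because the type of [j'] depends on [i']. *)
Definition wall_part i (j : 'I_(nobs i)) (x : contact) : R :=
  if x is Cwall i' j' _ _ then ((i' == i) && (j' == j :> nat))%:R else 0.

Lemma sum_parts x :
  \sum_(i < ncomp L) \sum_(j < ncomp L) strut_part i j x +
  \sum_(i < ncomp L) \sum_(j < nobs i) wall_part j x = 1.
Proof.
case: x => [i j z st|i j s ws] /=.
  rewrite [X in _ + X]big1 ?addr0; last by move=> i' _; rewrite big1.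
  rewrite (bigD1 i)//= (bigD1 j)//= !eqxx/= big1 ?addr0; last first.
    by move=> j' jj'; rewrite eq_sym (negbTE jj').
  rewrite big1 ?addr0// => i' ii'; rewrite big1// => j' _.
  by rewrite eq_sym (negbTE ii').
rewrite [X in X + _]big1 ?add0r; last by move=> i' _; rewrite big1.
rewrite (bigD1 i)//= (bigD1 j)//= !eqxx/= big1 ?addr0; last first.
  by move=> j' jj'; case: eqP => // /val_inj jE; rewrite jE eqxx in jj'.
rewrite big1 ?addr0// => i' ii'; rewrite big1// => j' _.
by rewrite eq_sym (negbTE ii').
Qed.

End contacts.

(** * Representation of functionals on contacts *)

Section representation.
Context {R : realType} (L : glink R) (Lam : (contact L -> R) -> R).
Hypothesis LamP : posfun Lam.
Implicit Types (i j : 'I_(ncomp L)) (xi : vfield L).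

Let T := fine (LThi L).

Lemma posfun_null (f : contact L -> R) : (forall x, f x = 0) -> Lam f = 0.
Proof.
move=> f0; rewrite (_ : f = fun=> 0); last exact/funext.
by rewrite (posfun_cst LamP) mul0r.
Qed.

Lemma clamp_per i (f : R -> R) : (circ i -> f (clen i) = f 0) ->
  circ i -> (f \o clamp (clen i)) (clen i) = (f \o clamp (clen i)) 0.
Proof.
move=> h ci; have l0 := ltW (clen_gt0 i).
by rewrite /= !clamp_id ?lexx ?l0// h.
Qed.

(** The positive and negative parts of each coordinate of [leg_force] are nonnegative weights, and
    [line_measure] turns each into a measure on the component. The difference of the two is the
    coordinate of the force. *)
Lemma adjoint_force_exists :
  exists F : force L, forall xi, VF xi -> force_pair F xi = Lam (rate xi).
Proof.
pose pos (b : bool) (q : 'I_(ncomp L) * 'I_3) x :=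
  Num.max (if b then leg_force q.1 x 0 q.2 else - leg_force q.1 x 0 q.2) 0.
have pos0 b q x : 0 <= pos b q x by rewrite le_max lexx orbT.
have posbnd b q : bnd (pos b q).
  have [M HM] := leg_force_bnd q.1 q.2; exists M => x.
  have := HM x; have M0 := le_trans (normr_ge0 _) (HM x).
  rewrite (ger0_norm (pos0 _ _ _)) /pos ge_max M0 andbT ler_norml => /andP[h1 h2].
  by case: b => //; rewrite lerNl.
have H (b : bool) q : exists m : {finite_measure set (MR R) -> \bar R},
    m (~` pdom q.1) = 0%E /\
    forall g, uc1 g -> (circ q.1 -> g (clen q.1) = g 0) ->
      Lam (fun x => pos b q x * g (leg_par q.1 x)) = \int[m]_(s in pdom q.1) g s.
  by apply: (line_measure LamP) => // x; exact: leg_par_itv.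
have [mp Hp] := choice (H true); have [mn Hn] := choice (H false).
pose F0 i k := charge_diff (mp (i, k)) (mn (i, k)).
have F0supp i k (B : set (MR R)) : measurable B -> B `&` pdom i = set0 -> F0 i k B = 0%E.
  move=> mB Bp; rewrite /F0 charge_diffE.
  have z (m : {finite_measure set (MR R) -> \bar R}) : m (~` pdom i) = 0%E -> m B = 0%E.
    move=> m0; apply: subset_measure0 m0 => //; first by apply: measurableC; exact: measurable_pdom.
    by move=> s Bs ps; have : (B `&` pdom i) s by []; rewrite Bp.
  by rewrite !z ?sube0//; [have [] := Hn (i, k)|have [] := Hp (i, k)].
exists (@Force R L F0 F0supp) => xi vxi.
have bxi i k : bnd (fun x => xi i (leg_par i x) 0 k).
  have [M HM] := VF_component_bnd i k vxi; exists M => x; apply: HM; exact: leg_par_itv.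
have -> : rate xi = fun x => \sum_(i < ncomp L) \sum_(k < 3)
    (leg_force i x 0 k * xi i (leg_par i x) 0 k).
  by apply/funext => x; rewrite rateE.
rewrite (posfun_sum LamP); last first.
  by move=> i; apply: bnd_sum => k; apply: bndM => //; exact: leg_force_bnd.
apply: eq_bigr => i _; rewrite (posfun_sum LamP); last first.
  by move=> k; apply: bndM => //; exact: leg_force_bnd.
apply: eq_bigr => k _.
pose g := (fun s => xi i s 0 k) \o clamp (clen i).
have ucg : uc1 g := uc1_clamp (clen_gt0 i) (@VF_component _ L xi i k vxi).
have gper : circ i -> g (clen i) = g 0.
  by apply: clamp_per => ci; have [_ /(_ ci) ->] := vxi i.
have gE (s : R) : 0 <= s <= clen i -> g s = xi i s 0 k by move=> h; rewrite /g /= clamp_id.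
have [M HM] := VF_component_bnd i k vxi.
rewrite (@charge_integral_sub _ _ _ _ (mp (i, k)) (mn (i, k)) _ _ M); last 4 first.
- by move=> A _; exact: charge_diffE.
- exact: measurable_pdom.
- apply: measurable_funS (@VF_component_meas _ L xi i k vxi); first exact: measurable_itv.
  by move=> s /pdom_subset; rewrite /= in_itv.
- by move=> s /pdom_subset; exact: HM.
have E b (m : {finite_measure set (MR R) -> \bar R}) :
    Lam (fun x => pos b (i, k) x * g (leg_par i x)) = \int[m]_(s in pdom i) g s ->
    \int[m]_(s in pdom i) xi i s 0 k = Lam (fun x => pos b (i, k) x * g (leg_par i x)).
  by move=> ->; apply: eq_Rintegral => s; rewrite inE => /pdom_subset /gE ->.
have bg b : bnd (fun x => pos b (i, k) x * g (leg_par i x)).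
  by apply: bndM => //; have [K HK] := uc1_bnd ucg; exists K => x; exact: HK.
rewrite (E true _ ((Hp (i, k)).2 g ucg gper)) (E false _ ((Hn (i, k)).2 g ucg gper)).
rewrite -(posfunB LamP)//; congr Lam; apply/funext => x.
rewrite -mulrBl gE ?leg_par_itv//; congr (_ * _); rewrite /pos/=.
by case: (leP (leg_force i x 0 k) 0) => h; case: (leP (- leg_force i x 0 k) 0) => h'; lra.
Qed.

Lemma strut_setE i j : (i < j)%N -> strut i j =
  (pdom i `*` pdom j) `&` [set z | ~~ ((enorm (gap (@curve R L) i j z) - T) ^+ 2 != 0)] :> set (MR R * MR R)%type.
Proof.
move=> ij; have n1 : (1 < ncomp L)%N.
  by apply: leq_ltn_trans (ltn_ord j); exact: leq_ltn_trans (leq0n i) ij.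
have [i0 [j0 [z0 st0]]] := strut_exists n1; have [_ TE] := strut_gt0 st0.
apply/seteqP; split => z /=.
  move=> [_ z1 z2 zT]; split=> //; rewrite negbK sqrf_eq0 gap_pdom// subr_eq0.
  by apply/eqP; rewrite /T -zT.
move=> [[z1 z2]]; rewrite negbK sqrf_eq0 gap_pdom// subr_eq0 => /eqP zT.
by split=> //; rewrite TE zT.
Qed.

Lemma uc_gap_sqr i j : uc (fun z => (enorm (gap (@curve R L) i j z) - T) ^+ 2).
Proof.
have h : uc (fun z => enorm (gap (@curve R L) i j z) + - T).
  apply: ucD; last exact: ucc.
  by apply: uc_enorm => k; apply: uc_gap; exact: curve_VF.
exact: (ucM h h).
Qed.

Lemma measurable_strut i j : (i < j)%N -> measurable (strut i j : set (MR R * MR R)%type).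
Proof.
move=> ij; rewrite strut_setE//; apply: measurableI.
  by apply: measurableX; exact: measurable_pdom.
have mh := uc_meas (uc_gap_sqr i j).
rewrite (_ : [set z | _] = (fun z => (enorm (gap (@curve R L) i j z) - T) ^+ 2) @^-1` [set 0]).
  by rewrite -[X in measurable X]setTI; apply: mh => //; exact: measurable_set1.
by apply/seteqP; split => z /=; rewrite negbK => /eqP.
Qed.

Lemma gap_wrap_invariant (c : vfield L) i j (z : R * R) : VF c ->
  0 <= z.1 <= clen i -> 0 <= z.2 <= clen j ->
  gap c i j (wrap i z.1, wrap j z.2) = gap c i j z.
Proof.
move=> vc z1 z2; rewrite (gap_wrap vc z1 z2) gap_pdom//; exact: wrap_pdom.
Qed.

(** The measure is carried by the struts because the nonnegative function [(enorm gap - T) ^+ 2]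
    vanishes on every strut: its integral is therefore 0, and its zero set inside the parameter
    domain is the strut set. *)
Lemma strut_measure i j : exists m : {finite_measure set (MR R * MR R)%type -> \bar R},
  m (~` strut i j) = 0%E /\
  forall xi, VF xi -> Lam (fun x => strut_part i j x * rate xi x) = \int[m]_(z in strut i j) AS xi i j z.
Proof.
have li := ltW (clen_gt0 i); have lj := ltW (clen_gt0 j).
pose u (x : contact L) := clamp (clen i) (if x is Cstrut i' j' z _ then z.1 else 0).
pose v (x : contact L) := clamp (clen j) (if x is Cstrut i' j' z _ then z.2 else 0).
have w0 (x : contact L) : 0 <= strut_part i j x by case: x.
have bw : bnd (@strut_part R L i j).
  by exists 1; case=> [i' j' z st|*] /=; [case: (_ && _)|]; rewrite ?normr1 ?normr0.
have ui x : 0 <= u x <= clen i by exact: clamp_itv.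
have vj x : 0 <= v x <= clen j by exact: clamp_itv.
have [m [msupp mE]] := plane_measure LamP bw w0 ui vj.
exists m.
have mP : measurable (pdom i `*` pdom j : set (MR R * MR R)%type).
  by apply: measurableX; exact: measurable_pdom.
(* Struts are indexed by [i < j]. For other indices the weight is identically 0, and testing against
   the constant 1 shows that the measure vanishes. *)
have [ij|ji] := ltnP i j; last first.
  have z (f : contact L -> R) : Lam (fun x => strut_part i j x * f x) = 0.
    apply: posfun_null => -[i' j' z' st|*] /=; rewrite ?mul0r//; have [/= ij' _ _ _] := st.
    have [ii|?] := eqVneq i' i; last by rewrite mul0r.
    have [jj|?] := eqVneq j' j; last by rewrite mul0r.
    by exfalso; move: ij'; rewrite ii jj ltnNge ji.
  have m0 : m setT = 0%E.
    have := mE (fun=> 1) (ucc 1) (fun _ _ _ => erefl).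
    rewrite z Rintegral_cst// mul1r => h.
    by rewrite -[LHS]fineK ?fin_num_measure// -h.
  have strut0 : strut i j = set0.
    by apply/seteqP; split => // z' [/= ij' _ _ _]; move: ij'; rewrite ltnNge ji.
  split; first by rewrite strut0 setC0.
  by move=> xi _; rewrite z strut0 Rintegral_set0.
have mS := measurable_strut ij.
have partE (f g : contact L -> R) :
    (forall z (st : strut i j z), f (Cstrut st) = g (Cstrut st)) ->
    (fun x => strut_part i j x * f x) = (fun x => strut_part i j x * g x).
  move=> fg; apply/funext => -[i' j' z st|*] /=; rewrite ?mul0r//.
  have [ii|?] := eqVneq i' i; last by rewrite !mul0r.
  have [jj|?] := eqVneq j' j; last by rewrite !mul0r.
  by subst i' j'; rewrite fg.
have uvE (z : R * R) (st : strut i j z) : (u (Cstrut st), v (Cstrut st)) = z.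
  have [_ z1 z2 _] := st.
  by rewrite /u /v !clamp_id ?(pdom_subset z1) ?(pdom_subset z2)//; case: z {st z1 z2}.
have msupp' : m (~` strut i j) = 0%E.
  pose h z := (enorm (gap (@curve R L) i j z) - T) ^+ 2.
  have uch : uc h := uc_gap_sqr i j.
  have hinv : wrap_invariant i j h.
    by move=> z z1 z2; rewrite /h gap_wrap_invariant//; exact: curve_VF.
  have h0 : \int[m]_z h z = 0.
    rewrite -(mE _ uch hinv) (partE _ (fun=> 0)).
      by apply: posfun_null => x; exact: mulr0.
    move=> z st; rewrite uvE /h; move: (st); rewrite strut_setE// => -[_ /=].
    by rewrite negbK => /eqP.
  have [K HK] := uc_bnd uch.
  have hK z : 0 <= h z <= K.
    by rewrite sqr_ge0/=; apply: le_trans (HK z); exact: ler_norm.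
  have mh := Rintegral_eq0_null (uc_meas uch) hK h0.
  have mN : measurable ([set z | h z != 0] : set (MR R * MR R)%type).
    rewrite (_ : [set z | _] = h @^-1` (~` [set 0])).
      rewrite -[X in measurable X]setTI; apply: (uc_meas uch) => //.
      by apply: measurableC; exact: measurable_set1.
    by apply/seteqP; split => z /= => [/eqP|] // ?; exact/eqP.
  rewrite strut_setE// setCI.
  have -> : ~` [set z | ~~ (h z != 0)] = [set z | h z != 0] :> set (MR R * MR R)%type.
    by apply/seteqP; split => z /=; [move/negP; rewrite negbK|move=> ? /negP].
  by rewrite measureU0//; exact: measurableC.
split=> // xi vxi.
(* On struts the denominator of [AS] is [T]; with this constant in its place the function is
   uniformly continuous on the whole plane. *)
pose a z := T^-1 * dot (gap xi i j z) (gap (@curve R L) i j z).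
have uca : uc a.
  apply: ucM; first exact: ucc.
  by apply: uc_dot => k; apply: uc_gap => //; exact: curve_VF.
have ainv : wrap_invariant i j a.
  by move=> z z1 z2; rewrite /a !gap_wrap_invariant//; exact: curve_VF.
have aE z : strut i j z -> AS xi i j z = a z.
  by move=> [_ z1 z2 zT]; rewrite /AS /a !gap_pdom// mulrC /T -zT.
rewrite (partE _ (fun x => a (u x, v x))); last by move=> z st; rewrite uvE/= aE.
rewrite (mE _ uca ainv) (Rintegral_null_compl _ mS msupp').
by apply: eq_Rintegral => z; rewrite inE => /aE ->.
Qed.

(** As for struts, with the obstacle function along the curve as the nonnegative function whose
    zeros are the wall. *)
Lemma wall_measure i (j : 'I_(nobs i)) : exists m : {finite_measure set (MR R) -> \bar R},
  m (~` wall j) = 0%E /\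
  forall xi, VF xi -> Lam (fun x => wall_part j x * rate xi x) = \int[m]_(s in wall j) AW xi j s.
Proof.
have li := ltW (clen_gt0 i).
pose u (x : contact L) := clamp (clen i) (if x is Cwall i' j' s _ then s else 0).
have w0 (x : contact L) : 0 <= wall_part j x by case: x.
have bw : bnd (@wall_part R L i j).
  by exists 1; case=> [*|i' j' s ws] /=; [|case: (_ && _)]; rewrite ?normr1 ?normr0.
have ui x : 0 <= u x <= clen i by exact: clamp_itv.
have [m [msupp mE]] := line_measure LamP bw w0 ui.
exists m; have mP := measurable_pdom i.
have partE (f g : contact L -> R) :
    (forall s (ws : wall j s), f (Cwall ws) = g (Cwall ws)) ->
    (fun x => wall_part j x * f x) = (fun x => wall_part j x * g x).
  move=> fg; apply/funext => -[*|i' j' s ws] /=; rewrite ?mul0r//.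
  have [ii|?] := eqVneq i' i; last by rewrite !mul0r.
  subst i'; have [/val_inj jj|?] := eqVneq (j' : nat) j; last by rewrite !mul0r.
  by subst j'; rewrite fg.
have uE s (ws : wall j s) : u (Cwall ws) = s.
  by have [ps _] := ws; rewrite /u clamp_id// pdom_subset.
pose h := (fun s => obs L i j (curve i s)) \o clamp (clen i).
have uch : uc1 h := uc1_clamp (clen_gt0 i) (@obs_within _ L i j).
have hper : circ i -> h (clen i) = h 0.
  by apply: clamp_per => ci; rewrite curve_circ.
have wallE : wall j = pdom i `&` [set s | ~~ (h s != 0)] :> set (MR R).
  apply/seteqP; split => s /= [ps hs]; split=> //.
    by rewrite negbK /h/= clamp_id ?pdom_subset// hs.
  by move: hs; rewrite negbK /h/= clamp_id ?pdom_subset// => /eqP.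
have mN : measurable ([set s | h s != 0] : set (MR R)).
  rewrite (_ : [set s | _] = h @^-1` (~` [set 0])).
    rewrite -[X in measurable X]setTI; apply: (uc1_meas uch) => //.
    by apply: measurableC; exact: measurable_set1.
  by apply/seteqP; split => s /= => [/eqP|] // ?; exact/eqP.
have NE : ~` [set s | ~~ (h s != 0)] = [set s | h s != 0] :> set (MR R).
  by apply/seteqP; split => s /=; [move/negP; rewrite negbK|move=> ? /negP].
have mS : measurable (wall j : set (MR R)).
  by rewrite wallE; apply: measurableI => //; rewrite -[X in measurable X]setCK NE; exact: measurableC.
have msupp' : m (~` wall j) = 0%E.
  have h0 : \int[m]_s h s = 0.
    rewrite (Rintegral_null_compl _ mP msupp) -(mE _ uch hper) (partE _ (fun=> 0)).
      by apply: posfun_null => x; exact: mulr0.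
    by move=> s ws; rewrite uE; move: (ws); rewrite wallE => -[_ /=]; rewrite negbK => /eqP.
  have [K HK] := uc1_bnd uch.
  have hK s : 0 <= h s <= K.
    apply/andP; split; last by apply: le_trans (HK s); exact: ler_norm.
    rewrite /h/= -curve_wrap; apply: obs_ge0; apply: wrap_pdom; exact: clamp_itv.
  have mh := Rintegral_eq0_null (uc1_meas uch) hK h0.
  rewrite wallE setCI NE.
  by rewrite measureU0//; exact: measurableC.
split=> // xi vxi.
pose a := (fun s => AW xi j s) \o clamp (clen i).
have uca : uc1 a := uc1_clamp (clen_gt0 i) (@AW_within _ L xi i j vxi).
have aper : circ i -> a (clen i) = a 0.
  apply: clamp_per => ci; rewrite /AW curve_circ//.
  by have [_ /(_ ci) ->] := vxi i.
have aE s : wall j s -> AW xi j s = a s.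
  by move=> [ps _]; rewrite /a/= clamp_id// pdom_subset.
rewrite (partE _ (fun x => a (u x))); last by move=> s ws; rewrite uE/= aE.
rewrite (mE _ uca aper) -(Rintegral_null_compl _ mP msupp) (Rintegral_null_compl _ mS msupp').
by apply: eq_Rintegral => s; rewrite inE => /aE ->.
Qed.

(** The indicators of the contact classes add up to 1, so that [Lam (rate xi)] is the sum of the
    integrals over the classes. *)
Lemma contact_measure_exists :
  exists mu : contact_measure L, forall xi, VF xi -> contact_integral mu xi = Lam (rate xi).
Proof.
have [ms Hs] := choice (fun p : 'I_(ncomp L) * 'I_(ncomp L) => strut_measure p.1 p.2).
have [mw Hw] := choice (fun q : {i : 'I_(ncomp L) & 'I_(nobs i)} => wall_measure (tagged q)).
exists (@ContactMeasure R L (fun i j => ms (i, j))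
  (fun i (j : 'I_(nobs i)) => mw (Tagged (fun i => 'I_(nobs i)) j))
  (fun i j => (Hs (i, j)).1) (fun i (j : 'I_(nobs i)) => (Hw (Tagged (fun i => 'I_(nobs i)) j)).1)) => xi vxi.
have br := rate_bnd vxi.
have bs i j : bnd (fun x => strut_part i j x * rate xi x).
  apply: bndM => //; exists 1; case=> [i' j' z st|*] /=; rewrite ?normr0//.
  by case: (_ && _); rewrite ?normr1 ?normr0.
have bw i (j : 'I_(nobs i)) : bnd (fun x => wall_part j x * rate xi x).
  apply: bndM => //; exists 1; case=> [*|i' j' s ws] /=; rewrite ?normr0//.
  by case: (_ && _); rewrite ?normr1 ?normr0.
have -> : rate xi = (fun x => \sum_(i < ncomp L) \sum_(j < ncomp L) strut_part i j x * rate xi x +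
    \sum_(i < ncomp L) \sum_(j < nobs i) wall_part j x * rate xi x).
  apply/funext => x; rewrite -[LHS]mul1r -[X in X * _](sum_parts x) mulrDl !mulr_suml.
  by congr (_ + _); apply: eq_bigr => i _; rewrite mulr_suml.
rewrite (posfunD LamP); last 2 first.
- by apply: bnd_sum => i; exact: bnd_sum.
- by apply: bnd_sum => i; exact: bnd_sum.
rewrite (posfun_sum LamP); last by move=> i; exact: bnd_sum.
rewrite (posfun_sum LamP); last by move=> i; exact: bnd_sum.
congr (_ + _); apply: eq_bigr => i _; rewrite (posfun_sum LamP)//; apply: eq_bigr => j _.
  by rewrite ((Hs (i, j)).2 _ vxi).
by rewrite ((Hw (Tagged (fun i => 'I_(nobs i)) j)).2 _ vxi).
Qed.

End representation.

(** * Strong criticality implies balance of forces *)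

Section necessity.
Context {R : realType} (L : glink R).
Hypothesis hL : arclength_parametrized L.
Implicit Types (i j : 'I_(ncomp L)) (xi zeta : vfield L).

Definition combine (a : R) xi zeta : vfield L := fun i s => a *: xi i s + zeta i s.

Lemma combine_coord a xi zeta i k :
  (fun s => combine a xi zeta i s 0 k) = (fun s => a * xi i s 0 k + zeta i s 0 k).
Proof. by apply/funext => s; rewrite !mxE. Qed.

Lemma combine_smooth a xi zeta : smooth_field xi -> smooth_field zeta ->
  smooth_field (combine a xi zeta).
Proof.
move=> sxi szeta i; have [sx px] := sxi i; have [sz pz] := szeta i; split=> [k|ci s].
  by rewrite combine_coord; apply: smoothD (sz k); apply: smoothM (sx k); exact: smooth_cst.
by rewrite /combine px// pz.
Qed.

Lemma combine_compatible a xi zeta : compatible xi -> compatible zeta ->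
  compatible (combine a xi zeta).
Proof. by move=> cx cz i b ci; rewrite memvD ?memvZ ?cx ?cz. Qed.

Lemma combine_rate a xi zeta x : rate (combine a xi zeta) x = a * rate xi x + rate zeta x.
Proof.
case: x => [i j z st|i j s ws] /=; rewrite /combine.
  rewrite /AS mulrA -mulrDl; congr (_ / _).
  by rewrite !dotBl !dotDl !dotZl; ring.
by rewrite /AW dotDl dotZl.
Qed.

Lemma combine_dLen a xi zeta : smooth_field xi -> smooth_field zeta ->
  dLen (combine a xi zeta) = a * dLen xi + dLen zeta.
Proof.
move=> sxi szeta; rewrite (dLenE hL sxi) (dLenE hL szeta) (dLenE hL (combine_smooth a sxi szeta)).
rewrite mulr_sumr -big_split/=; apply: eq_bigr => i _.
rewrite mulr_sumr -big_split/=; apply: eq_bigr => k _.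
have [/(_ k) sx _] := sxi i; have [/(_ k) sz _] := szeta i.
rewrite -(tangent_integral_lin hL i k a (smooth_continuous (smooth_derive1 sx))
  (smooth_continuous (smooth_derive1 sz))).
apply: eq_Rintegral => s _; congr (_ * _); rewrite combine_coord.
apply: derive1E_is; apply: is_deriveD; last exact: smooth_is_derive.
by apply: is_deriveZ; exact: smooth_is_derive.
Qed.

Definition zero_field : vfield L := fun _ _ => 0.

Lemma zero_field_smooth : smooth_field zero_field.
Proof.
move=> i; split=> // k; rewrite (_ : (fun s => _) = (fun=> 0)); first exact: smooth_cst.
by apply/funext => s; rewrite mxE.
Qed.

Lemma zero_field_compatible : compatible zero_field.
Proof. by move=> i b _; exact: mem0v. Qed.

Lemma combine0 a xi : combine a xi zero_field = fun i s => a *: xi i s.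
Proof. by apply/funext => i; apply/funext => s; rewrite /combine addr0. Qed.

Lemma rate0 x : rate zero_field x = 0.
Proof.
case: x => [i j z st|i j s ws] /=; first by rewrite /AS subr0 dot0l mul0r.
by rewrite /AW dot0l.
Qed.

Lemma dLen0 : dLen zero_field = 0.
Proof.
have := combine_dLen 1 zero_field_smooth zero_field_smooth.
by rewrite combine0 (_ : (fun _ => _) = zero_field); [lra|apply/funext => i; apply/funext => s; rewrite scaler0].
Qed.

Definition length_graph : set ((contact L -> R) * R) :=
  [set p | exists xi, [/\ smooth_field xi, compatible xi & p = (rate xi, dLen xi)]].

(** Let [lam = dLen xi] be positive and the rates of [xi] at most [b]. Then [- xi / lam] has length
    variation -1 and rates at least [- b / lam], so criticality gives [- b / lam <= - eps], that is
    [lam <= eps^-1 * b]. *)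
Lemma length_dominated (eps : R) : 0 < eps ->
  (forall xi : vfield L, smooth_field xi -> compatible xi -> dLen xi = -1 ->
      (Order.min (dLThi xi) (dO xi) <= (- eps)%:E)%E) ->
  domgraph eps^-1 length_graph.
Proof.
move=> e0 crit; split.
- move=> _ _ [xi [sx cx ->]] [zeta [sz cz ->]] /=; exists (combine 1 xi zeta).
  split; [exact: combine_smooth|exact: combine_compatible|].
  by rewrite (combine_dLen 1 sx sz) mul1r; congr pair; apply/funext => x; rewrite combine_rate mul1r.
- move=> a _ [xi [sx cx ->]] /=; exists (combine a xi zero_field).
  split; [exact: combine_smooth zero_field_smooth|exact: combine_compatible zero_field_compatible|].
  rewrite (combine_dLen a sx zero_field_smooth) dLen0 addr0.
  by congr pair; apply/funext => x; rewrite combine_rate rate0 addr0.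
- by move=> _ [xi [sx cx ->]]; apply: rate_bnd; exact: smooth_field_VF.
move=> _ b [xi [sx cx ->]] /= b0 hb.
have [l0|l0] := leP (dLen xi) 0.
  by apply: le_trans l0 _; rewrite mulr_ge0// invr_ge0 ltW.
set lam := dLen xi in l0 *.
pose zeta := combine (- lam^-1) xi zero_field.
have sz : smooth_field zeta by exact: combine_smooth zero_field_smooth.
have cz : compatible zeta by exact: combine_compatible zero_field_compatible.
have lz : dLen zeta = -1.
  rewrite (combine_dLen (- lam^-1) sx zero_field_smooth) dLen0 addr0 -/lam mulNr mulVf//.
  by rewrite gt_eqF.
have rz x : - (b / lam) <= rate zeta x.
  by rewrite combine_rate rate0 addr0 mulNr lerN2 mulrC ler_pM2r ?invr_gt0.
suff h : ((- (b / lam))%:E <= (- eps)%:E)%E.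
  rewrite lee_fin lerN2 ler_pdivlMr// in h.
  by rewrite mulrC ler_pdivlMr// mulrC.
have := crit zeta sz cz lz; rewrite ge_min => /orP[]; last first.
  apply: le_trans; apply: le_ereal_inf_tmp => _ [i [j [s [ws ->]]]].
  by rewrite lee_fin; exact: (rz (Cwall ws)).
(* With a single component [dLThi] is infinite and cannot be the term below [- eps]. *)
have [n1|n1] := boolP (1 < ncomp L)%N; last by rewrite /dLThi (negbTE n1) leye_eq.
have [m [-> _ hm]] := danskin (smooth_field_VF sz) n1.
apply: le_trans; rewrite lee_fin; apply: hm => i j z st; exact: (rz (Cstrut st)).
Qed.

Lemma critical_functional : strongly_critical L -> exists Lam : (contact L -> R) -> R,
  posfun Lam /\ forall xi, smooth_field xi -> compatible xi -> Lam (rate xi) = dLen xi.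
Proof.
move=> [eps e0 crit].
have [|Lam [LamP LamG _]] := hahn_banach_positive (length_dominated e0 crit).
  exists (rate zero_field, dLen zero_field), zero_field; split=> //.
  - exact: zero_field_smooth.
  - exact: zero_field_compatible.
exists Lam; split=> // xi sx cx.
by apply: (LamG (rate xi, dLen xi)); exists xi.
Qed.

End necessity.

Section critical_balance.
Context {R : realType} (L : glink R).
Hypothesis hL : arclength_parametrized L.
Local Notation leb := (@lebesgue_measure R).
Implicit Types (i j : 'I_(ncomp L)) (k : 'I_3) (xi : vfield L).

Lemma row_cvg (f : R -> 'rV[R]_3) (v : 'rV[R]_3) :
  (forall k, f t 0 k @[t --> 0^'+] --> v 0 k) -> f t @[t --> 0^'+] --> v.
Proof.
move=> h; apply/cvgrPdist_lt => e e0.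
have : \forall t \near 0^'+, forall k, `|v 0 k - f t 0 k| < e.
  by apply: filter_forall => k; move/cvgrPdist_lt: (h k); apply.
apply: filterS => t ht; rewrite /Num.norm/= mx_normrE.
apply/bigmax_ltP; split=> // -[a b] _ /=; rewrite ord1 !mxE; exact: ht.
Qed.

(* The end atoms of the curvature force are the one-sided tangents provided by
   du Bois-Reymond's lemma, whatever the atoms of the adjoint force are. *)
Definition truncated_charge (m1 m2 : {finite_measure set (MR R) -> \bar R}) (l c0 c1 : R) :
    {charge set (MR R) -> \bar R} :=
  cadd (charge_diff (mrestr m1 (measurable_itv `]0, l[ : measurable (`]0, l[%classic : set (MR R))))
                    (mrestr m2 (measurable_itv `]0, l[ : measurable (`]0, l[%classic : set (MR R)))))
   (cadd (cscale c0 (charge_of_finite_measure (dirac (0 : MR R))))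
         (cscale c1 (charge_of_finite_measure (dirac (l : MR R))))).

Lemma truncated_chargeE m1 m2 l c0 c1 (A : set (MR R)) :
  truncated_charge m1 m2 l c0 c1 A =
  ((m1 (A `&` `]0%R, l[%classic) - m2 (A `&` `]0%R, l[%classic))
   + (c0%:E * \d_(0%R : MR R) A + c1%:E * \d_(l : MR R) A))%E.
Proof. by rewrite /truncated_charge/= /cadd/= charge_diffE. Qed.

Lemma dirac_set1 (a b : R) : \d_(a : MR R) [set b] = ((a == b)%:R : R)%:E.
Proof.
rewrite diracE; congr ((nat_of_bool _)%:R)%:E.
by apply/idP/eqP => [/set_mem//|->]; exact: mem_set.
Qed.

Lemma dLen_localized i phi (v : 'rV[R]_3) : smooth phi ->
  (circ i -> forall s, phi (s + clen i) = phi s) ->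
  dLen (localized i phi v) = \sum_(k < 3) v 0 k *
    \int[leb]_(s in `[0, clen i]) (tangent i s 0 k * derive1 (phi : R -> R^o) s).
Proof.
move=> sphi pphi; have cphi := smooth_continuous (smooth_derive1 sphi).
have sl := localized_smooth v sphi pphi.
have E j k : \int[leb]_(s in `[0, clen j]) (tangent j s 0 k *
      derive1 (fun s => localized i phi v j s 0 k) s) =
    (if j == i then v 0 k else 0) *
    \int[leb]_(s in `[0, clen j]) (tangent j s 0 k * derive1 (phi : R -> R^o) s).
  set c := if _ then _ else _.
  have c0 : continuous (fun _ : R => 0 : R) by move=> s; exact: cst_continuous.
  have := tangent_integral_lin hL j k c cphi c0.
  have -> : \int[leb]_(s in `[0, clen j]) (tangent j s 0 k * 0) = 0.
    rewrite (@eq_Rintegral _ _ _ _ _ (fun=> 0)); last by move=> s _; rewrite mulr0.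
    by rewrite Rintegral_cst ?mul0r//; exact: measurable_itv.
  rewrite addr0 => <-; apply: eq_Rintegral => s _; congr (_ * _).
  rewrite localized_coord addr0; apply: derive1E_is.
  by apply: is_deriveZ; exact: smooth_is_derive.
rewrite (dLenE hL sl) (bigD1 i)//= [X in _ + X]big1 ?addr0; last first.
  by move=> j ji; rewrite big1// => k _; rewrite E (negbTE ji) mul0r.
by apply: eq_bigr => k _; rewrite E eqxx.
Qed.

Lemma test_end_vanish i phi : test_function i phi -> ~~ circ i ->
  phi 0 = 0 /\ phi (clen i) = 0.
Proof.
move=> [_]; case: (circ i) => // -[a [b [a0 bl supp]]] _.
by split; apply: supp; [left|right].
Qed.

(** [F] and [mu] come from the same [Lam], hence are adjoint on all continuous fields. On smooth
    compatible fields [Lam] gives [dLen]; localized test fields are among these, so [- F] solves the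
    equation of the curvature force away from the ends. *)
Lemma critical_balance : strongly_critical L ->
  finite_total_curvature L /\
  exists (K : force L) (mu : contact_measure L) (F : force L),
    [/\ is_curvature_force K, is_adjoint_force mu F & balanced_on_VFc K F].
Proof.
move=> crit; have [Lam [LamP LamE]] := critical_functional hL crit.
have [F FE] := adjoint_force_exists LamP; have [mu muE] := contact_measure_exists LamP.
have adj : is_adjoint_force mu F by move=> xi vxi; rewrite FE// muE.
have FdLen xi : smooth_field xi -> compatible xi -> dLen xi = force_pair F xi.
  by move=> sxi cxi; rewrite FE ?LamE//; exact: smooth_field_VF.
have [f1 Hf1] := choice (fun q : 'I_(ncomp L) * 'I_3 => charge_jordan (F q.1 q.2)).
have [f2 f12] := choice Hf1.
(* The charge [- F], obtained by exchanging the two measures of a decomposition of [F]. *)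
pose nF i k := charge_diff (f2 (i, k)) (f1 (i, k)).
have nFE i k (A : set (MR R)) : measurable A -> nF i k A = (- F i k A)%E.
  move=> mA; rewrite /nF charge_diffE (f12 (i, k) A mA) fin_num_oppeB ?fin_num_measure//.
  by rewrite addeC.
have test i k phi : test_function i phi ->
    \int[leb]_(s in `[0, clen i]) (tangent i s 0 k * derive1 (phi : R -> R^o) s)
    = - charge_integral (nF i k) (pdom i) phi.
  move=> tphi; have [sphi tsupp] := tphi; have cphi := smooth_continuous sphi.
  have pphi : circ i -> forall s, phi (s + clen i) = phi s by move=> ci; rewrite ci in tsupp.
  have [M HM] := continuous_itv_bounded (continuous_subspaceT cphi : {within `[0, clen i], continuous phi}).
  rewrite -(@charge_integral_opp _ (F i k) (nF i k) (pdom i) M phi) ?opprK; last 4 first.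
  - exact: measurable_pdom.
  - by apply: measurable_funTS; exact: measurable_smooth.
  - by move=> s /pdom_subset; exact: HM.
  - by move=> B mB _; rewrite nFE.
  rewrite -force_pair_coord// -FdLen.
  - rewrite dLen_localized// (bigD1 k)//= mxE !eqxx mul1r big1 ?addr0// => k' kk'.
    by rewrite mxE eqxx (negbTE kk') mul0r.
  - exact: (localized_smooth _ sphi pphi).
  - move=> j b cj; rewrite /localized; case: eqP => [ji|_]; last exact: mem0v.
    rewrite ji in b cj *; have [z1 z2] := test_end_vanish tphi cj.
    by rewrite /epar /end_param; case: b; rewrite ?z1 ?z2 scale0r mem0v.
have [n1 Hn1] := choice (fun q : 'I_(ncomp L) * 'I_3 => curvature_test_bv hL (test q.1 q.2)).
have [n2 Hn2] := choice Hn1; have [c0 Hc0] := choice Hn2.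
pose c1 q := - (c0 q + (fine (n1 q `]0, clen q.1[%classic) - fine (n2 q `]0, clen q.1[%classic))).
(* On a circle [- F] itself is kept, as there are no ends to correct. *)
pose K0 i k : {charge set (MR R) -> \bar R} := if circ i then nF i k
  else truncated_charge (n1 (i, k)) (n2 (i, k)) (clen i) (c0 (i, k)) (c1 (i, k)).
have K0supp i k (B : set (MR R)) : measurable B -> B `&` pdom i = set0 -> K0 i k B = 0%E.
  move=> mB Bp; rewrite /K0; case: ifPn => ci; first by rewrite nFE// force_supp// oppe0.
  have nB s : pdom i s -> ~ B s by move=> ps Bs; have : (B `&` pdom i) s by []; rewrite Bp.
  have pE b : pdom i (epar i b).
    rewrite /pdom /param_dom (negbTE ci) /epar /end_param.
    by case: b; rewrite /= in_itv/= lexx ltW// clen_gt0.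
  rewrite truncated_chargeE (_ : B `&` _ = set0); last first.
    by apply/seteqP; split => s //= [Bs /subset_pdom]; move/nB; exact.
  rewrite !measure0 sube0 add0e !diracE !memNset ?mule0 ?adde0//.
    exact: nB (pE true).
  exact: nB (pE false).
pose K := @Force R L K0 K0supp.
have Kin i k (B : set (MR R)) : measurable B -> B `<=` pdom i ->
    (~~ circ i -> forall b, ~ B (epar i b)) -> (- K i k B)%E = F i k B.
  move=> mB Bp Bend; rewrite /K/= /K0; case: ifPn => ci; first by rewrite nFE// oppeK.
  have B0 : ~ B 0 := Bend ci false; have Bl : ~ B (clen i) := Bend ci true.
  have BO : B `<=` `]0, clen i[%classic.
    move=> s Bs; have /andP[s0 sl] := pdom_subset (Bp _ Bs).
    rewrite /= in_itv/= !lt_neqAle s0 sl !andbT; apply/andP; split; apply/eqP => e.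
      by apply: B0; rewrite e.
    by apply: Bl; rewrite -e.
  rewrite truncated_chargeE !diracE !memNset// !mule0 !adde0 (setIidl BO).
  have [nE _] := Hc0 (i, k); rewrite -nE// nFE// oppeK//.
have Kends i k : ~~ circ i -> fine (K i k [set (0 : R)]) = c0 (i, k) /\
    fine (K i k [set clen i]) = c1 (i, k).
  move=> ci; have l0 := clen_gt0 i; rewrite /K/= /K0 (negbTE ci) !truncated_chargeE.
  have e1 (a : R) : ~ (0 < a < clen i) -> [set a] `&` `]0, clen i[%classic = set0 :> set (MR R).
    by move=> h; apply/seteqP; split => s //= [-> ]; rewrite in_itv/=; exact: h.
  rewrite !e1 ?ltxx ?andbF//; rewrite !measure0 !sube0 !add0e !dirac_set1 !eqxx.
  by rewrite (gt_eqF l0) (lt_eqF l0) !mule0 !mule1 adde0 add0e.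
have Kcurv : is_curvature_force K.
  split=> [i k phi tphi|i ci].
    rewrite test//; congr (- _); have [sphi _] := tphi; have cphi := smooth_continuous sphi.
    have [M HM] := continuous_itv_bounded (continuous_subspaceT cphi : {within `[0, clen i], continuous phi}).
    have mphi D : measurable_fun D (phi : MR R -> R).
      by apply: measurable_funTS; exact: measurable_smooth.
    have [ci|ci] := boolP (circ i).
      by rewrite /K/= /K0 ci.
    have [z1 z2] := test_end_vanish tphi ci.
    rewrite /pdom /param_dom (negbTE ci) !(charge_integral_ends _ (clen_gt0 i) (mphi _) HM).
    rewrite z1 z2 !mul0r !add0r !addr0.
    have mO : measurable (`]0, clen i[%classic : set (MR R)) by exact: measurable_itv.
    have HM' x : `]0, clen i[%classic x -> `|phi x| <= M by move=> /subset_pdom/pdom_subset; exact: HM.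
    rewrite -(@charge_integral_opp _ (F i k) (nF i k) _ M phi mO (mphi _) HM'); last first.
      by move=> B mB _; rewrite nFE.
    apply: (@charge_integral_opp _ (F i k) (K i k) _ M phi mO (mphi _) HM') => B mB BO.
    rewrite -(Kin i k B mB) ?oppeK//; first exact: subset_trans BO (@subset_pdom _ L i).
    by move=> _ b /BO; rewrite /epar /end_param; case: b; rewrite /= in_itv/= ltxx ?andbF.
  split; apply: row_cvg => k; have [_ bvT] := Hc0 (i, k); rewrite mxE.
    by rewrite (Kends i k ci).1; under eq_fun do rewrite !mxE; exact: bvt_right bvT.
  by rewrite (Kends i k ci).2; under eq_fun do rewrite !mxE; exact: bvt_left bvT.
split; first by apply: (curvature_test_finite hL (K := K)); case: Kcurv.
(* Balance is known on smooth fields only; the criterion by atoms extends it to all continuous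
   compatible fields. *)
exists K, mu, F; split=> //; apply/balanced_atoms; split=> [//|i b ci v vb].
apply: (balanced_normal Kin) => // xi sxi cxi.
by rewrite -FdLen// (dLen_force_pair hL Kcurv sxi).
Qed.

End critical_balance.

Theorem theorem8p4 (R : realType) (L : glink R)
    (hL : arclength_parametrized L) :
  (strongly_critical L <->
     finite_total_curvature L /\
     exists (K : force L) (mu : contact_measure L) (F : force L),
       [/\ is_curvature_force K, is_adjoint_force mu F &
           balanced_on_VFc K F]) /\
  (forall (K : force L) (mu : contact_measure L) (F : force L),
     is_curvature_force K -> is_adjoint_force mu F ->
     (balanced_on_VFc K F <-> balanced_upto_normal_atoms K F)).
Proof.
split; last by move=> K mu F _ _; exact: balanced_atoms.
split; first exact: critical_balance.
by move=> [_ [K [mu [F [cK adj bal]]]]]; exact: (balance_strongly_critical hL cK adj bal).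
Qed.
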